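(* Let $d\ge 1$ and let $\mu$ and $\nu$ be two Borel probability measures on $\mathbb{R}^d$ with finite second moments, such that $\mu$ satisfies assumption (H-source) and $\nu$ satisfies assumption (H-target), both defined in the context. For $\varepsilon>0$ let $\lambda_1(\varepsilon),\dots,\lambda_d(\varepsilon)>0$ be weights such that for all $k\in\{1,\dots,d-1\}$, $\lambda_k(\varepsilon)/\lambda_{k+1}(\varepsilon)\to 0$ as $\varepsilon\to 0$. Let $c_\varepsilon(x,y)=\sum_{i=1}^d\lambda_i(\varepsilon)(x_i-y_i)^2$ and let $\gamma_\varepsilon$ be an optimal transport plan between $\mu$ and $\nu$ for the cost $c_\varepsilon$, i.e. a minimizer of $\int_{\mathbb{R}^d\times\mathbb{R}^d} c_\varepsilon\,d\pi$ among all $\pi\in\Gamma(\mu,\nu)$. Let $T$ be the Knothe-Rosenblatt map from $\mu$ to $\nu$ and let $\gamma_K:=(\mathrm{id}\times T)_\sharp\mu$ be the associated transport plan. Then $\gamma_\varepsilon\rightharpoonup\gamma_K$ (weak convergence of probability measures on $\mathbb{R}^d\times\mathbb{R}^d$) as $\varepsilon\to 0$. Moreover, if the plans $\gamma_\varepsilon$ are induced by transport maps $T_\varepsilon$, i.e. $\gamma_\varepsilon=(\mathrm{id}\times T_\varepsilon)_\sharp\mu$, then $T_\varepsilon\to T$ in $L^2(\mu)$ as $\varepsilon\to 0$.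
   Context: $\Gamma(\mu,\nu)$ is the set of probability measures on $\mathbb{R}^d\times\mathbb{R}^d$ with marginals $\mu$ and $\nu$; $S_\sharp\mu$ denotes the push-forward; $(\mathrm{id}\times T)(x)=(x,T(x))$. Disintegrations. $\mu^d$ is the marginal of $\mu$ on the last coordinate $x_d$. For $k=d-1,\dots,1$, $\mu^{k}_{(x_d,\dots,x_{k+1})}$ is the probability measure on $\mathbb{R}$ which is the conditional law (disintegration) of the coordinate $x_k$ under $\mu$ given $(x_d,\dots,x_{k+1})$. The measures $\nu^d$ and $\nu^k_{(y_d,\dots,y_{k+1})}$ are defined in the same way from $\nu$. Assumption (H-source) on $\mu$: the measure $\mu^d$, as well as $\mu^d$-almost all the measures $\mu^{d-1}_{x_d}$, the measures $\mu^{d-2}_{(x_d,x_{d-1})}$ for $\mu^d$-a.e. $x_d$ and $\mu^{d-1}_{x_d}$-a.e. $x_{d-1}$, and so on up to almost all the measures $\mu^1_{(x_d,\dots,x_2)}$, have no atoms. Assumption (H-target) on $\nu$: the measure $\nu^d$, as well as $\nu^d$-almost all the measures $\nu^{d-1}_{y_d}$, the measures $\nu^{d-2}_{(y_d,y_{d-1})}$ for $\nu^d$-a.e. $y_d$ and $\nu^{d-1}_{y_d}$-a.e. $y_{d-1}$, and so on up to almost all the measures $\nu^2_{(y_d,\dots,y_3)}$, have no atoms (no condition is imposed on the last disintegration $\nu^1_{(y_d,\dots,y_2)}$). Knothe-Rosenblatt map. Under (H-source), $T_d=T_d(x_d)$ is the ($\mu^d$-a.e. unique) nondecreasing map with $(T_d)_\sharp\mu^d=\nu^d$.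 Iteratively, for $k=d-1,\dots,1$, $T_k=T_k(x_k,x_{k+1},\dots,x_d)$ is such that, for a.e. $(x_{k+1},\dots,x_d)$, the map $T_k(\cdot,x_{k+1},\dots,x_d)$ is the nondecreasing map transporting $\mu^k_{(x_d,\dots,x_{k+1})}$ onto $\nu^k_{(T_d,\dots,T_{k+1})}$, where $T_d,\dots,T_{k+1}$ are evaluated at $(x_{k+1},\dots,x_d)$. Then $T(x)=(T_1(x_1,\dots,x_d),\dots,T_{d-1}(x_{d-1},x_d),T_d(x_d))$, and $T_\sharp\mu=\nu$. *)

(* Defs.v *)
From HB Require Import structures.
From mathcomp Require Import all_boot all_order all_algebra.
From mathcomp Require Import all_classical all_reals all_analysis.

Set Implicit Arguments.
Unset Strict Implicit.
Unset Printing Implicit Defensive.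

Import Order.TTheory GRing.Theory Num.Theory.
Import numFieldNormedType.Exports.

Local Open Scope classical_set_scope.
Local Open Scope ring_scope.
Local Open Scope ereal_scope.

(* R^d is [d.-tuple R], whose library sigma-algebra is the one generated by
   the coordinates, i.e. the Borel one.  With coordinates x_1, ..., x_d, x_k is
   [tnth x i] with i = k - 1.

   The disintegrations run from the last coordinate to the first one, so they
   are indexed by the number m = d - k of coordinates that are conditioned
   upon, and these are listed in the order (x_d, ..., x_{k+1}). *)

Section coordinates.
Context {R : realType} {d : nat}.

(* x_{d-m}, for m < d *)
Definition rcoord (m : nat) (x : d.-tuple R) : R := nth 0%R (rev x) m.

(* (x_d, ..., x_{d-m+1}), for m <= d *)
Definition rcoords (m : nat) (x : d.-tuple R) : m.-tuple R :=
  [tuple rcoord i x | i < m].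

End coordinates.

Section disintegration.
Context {R : realType}.

(* kappa m (x_d, ..., x_{d-m+1}) is a regular version of the conditional law
   of x_{d-m} given (x_d, ..., x_{d-m+1}); kappa 0 [tuple] is the law of x_d.
   The kernels kappa m with m >= d are irrelevant. *)
Definition disintegration (d : nat) (mu : probability (d.-tuple R) R)
    (kappa : forall m : nat, R.-pker (m.-tuple R) ~> R) : Prop :=
  forall m : nat, (m < d)%N ->
  forall (A : set (m.-tuple R)) (B : set R), measurable A -> measurable B ->
    mu (rcoords m @^-1` A `&` rcoord m @^-1` B) =
    \int[mu]_(x in rcoords m @^-1` A) kappa m (rcoords m x) B.

(* for kappa 0 [tuple]-a.e. x_d, for kappa 1 (x_d)-a.e. x_{d-1}, ...,
   P (x_d, ..., x_{d-m+1}) *)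
Fixpoint ae_iterated (kappa : forall m : nat, R.-pker (m.-tuple R) ~> R)
    (m : nat) : (m.-tuple R -> Prop) -> Prop :=
  match m with
  | 0 => fun P => P [tuple]
  | m'.+1 => fun P => ae_iterated kappa
      (fun t : m'.-tuple R => {ae kappa m' t, forall s, P [tuple of rcons t s]})
  end.

Definition no_atoms (m : {measure set R -> \bar R}) : Prop :=
  forall s : R, m [set s] = 0.

Definition H_source (d : nat)
    (kappa : forall m : nat, R.-pker (m.-tuple R) ~> R) : Prop :=
  forall m : nat, (m < d)%N -> ae_iterated kappa (fun t => no_atoms (kappa m t)).

(* m = d - 1, i.e. the conditional law of y_1, is left out. *)
Definition H_target (d : nat)
    (kappa : forall m : nat, R.-pker (m.-tuple R) ~> R) : Prop :=
  forall m : nat, (m.+1 < d)%N ->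
    ae_iterated kappa (fun t => no_atoms (kappa m t)).

End disintegration.

Section Knothe_Rosenblatt.
Context {R : realType}.

(* U m (x_d, ..., x_{d-m+1}) x_{d-m} stands for T_{d-m} (x_{d-m}, ..., x_d).
   [KR_coords U] maps (x_d, ..., x_{d-m+1}) to (T_d, ..., T_{d-m+1}). *)
Definition KR_coords (U : forall m : nat, m.-tuple R -> R -> R) (m : nat)
    (t : m.-tuple R) : m.-tuple R :=
  [tuple U i [tuple nth 0%R t j | j < i] (nth 0%R t i) | i < m].

(* "Nondecreasing" is required on a set of full measure only: the monotone
   real-valued transport map onto a law with unbounded support need not be
   monotone (nor even have a monotone extension) on the whole line. *)
Definition monotone_transport (m1 m2 : {measure set R -> \bar R})
    (f : R -> R) : Prop :=
  (exists D : set R, [/\ measurable D, m1 (~` D) = 0 &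
     forall r s, D r -> D s -> (r <= s)%R -> (f r <= f s)%R]) /\
  (forall B : set R, measurable B -> m1 (f @^-1` B) = m2 B).

Definition is_Knothe_Rosenblatt (d : nat) (mu : probability (d.-tuple R) R)
    (mu_ nu_ : forall m : nat, R.-pker (m.-tuple R) ~> R)
    (T : d.-tuple R -> d.-tuple R) : Prop :=
  exists U : forall m : nat, m.-tuple R -> R -> R,
    (forall x : d.-tuple R,
       T x = [tuple of rev (KR_coords U [tuple of rev x])]) /\
    (forall m : nat, (m < d)%N ->
       {ae pushforward mu (@rcoords R d m), forall t,
          monotone_transport (mu_ m t) (nu_ m (KR_coords U t)) (U m t)}).

End Knothe_Rosenblatt.

Section transport_plans.
Context {R : realType} {d : nat}.
Implicit Types mu nu : probability (d.-tuple R) R.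

Definition id_times (T : d.-tuple R -> d.-tuple R) (x : d.-tuple R) :
  d.-tuple R * d.-tuple R := (x, T x).

Section id_times_mfun.
Variable T : {mfun d.-tuple R >-> d.-tuple R}.

Let measurable_id_times : measurable_fun [set: d.-tuple R] (id_times T).
Proof. by apply: measurable_fun_pair. Qed.

HB.instance Definition _ := isMeasurableFun.Build _ _ _ _ (id_times T)
  measurable_id_times.

End id_times_mfun.

Definition plan_of_map mu (T : {mfun d.-tuple R >-> d.-tuple R}) :
    probability (d.-tuple R * d.-tuple R)%type R :=
  distribution mu (id_times T).

Definition finite_second_moment mu : Prop :=
  \int[mu]_x (\sum_(i < d) tnth x i ^+ 2)%R%:E < +oo.

Definition coupling mu nu
    (pi : probability (d.-tuple R * d.-tuple R)%type R) : Prop :=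
  forall A : set (d.-tuple R), measurable A ->
    pi (fst @^-1` A) = mu A /\ pi (snd @^-1` A) = nu A.

Definition weighted_cost (w : 'I_d -> R) (z : d.-tuple R * d.-tuple R) : R :=
  (\sum_(i < d) w i * (tnth z.1 i - tnth z.2 i) ^+ 2)%R.

Definition optimal_plan mu nu (c : d.-tuple R * d.-tuple R -> R)
    (g : probability (d.-tuple R * d.-tuple R)%type R) : Prop :=
  coupling mu nu g /\
  forall pi : probability (d.-tuple R * d.-tuple R)%type R,
    coupling mu nu pi -> \int[g]_z (c z)%:E <= \int[pi]_z (c z)%:E.

(* The library puts no topology on tuples: continuity on R^d x R^d is tested
   through the identification of R^d with row vectors. *)
Definition tuple_of_rV (v : 'rV[R]_d) : d.-tuple R :=
  [tuple v ord0 i | i < d].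

Definition weak_cvg (F : set_system R)
    (g : R -> probability (d.-tuple R * d.-tuple R)%type R)
    (g0 : probability (d.-tuple R * d.-tuple R)%type R) : Prop :=
  forall f : d.-tuple R * d.-tuple R -> R,
    continuous (fun p : 'rV[R]_d * 'rV[R]_d =>
                  f (tuple_of_rV p.1, tuple_of_rV p.2)) ->
    (exists M : R, forall z, (`|f z| <= M)%R) ->
    (\int[g eps]_z f z)%R @[eps --> F] --> (\int[g0]_z f z)%R.

(* the L^2(mu) distance, for the Euclidean norm on R^d *)
Definition L2_dist mu (S T : d.-tuple R -> d.-tuple R) : \bar R :=
  Lnorm mu 2%:E (fun x =>
    (Num.sqrt (\sum_(i < d) (tnth (S x) i - tnth (T x) i) ^+ 2))%R%:E).

End transport_plans.

(* Main.v *)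
(* The coordinates are treated one after the other, from the last one x_d down,
   showing that y_k - T_k(x) tends to 0 in probability under gamma_eps.

   Suppose this is known for the coordinates above x_k. As the marginals do not
   depend on eps, the events [y in B] and [T x in B] then asymptotically agree
   for every Borel set B of upper coordinates; and since nu has atomless
   conditional laws there, T is a.e. invertible on these coordinates. Two
   estimates follow.
   - A one-sided bound: asymptotically, P(x_k > a, y_k > b | upper coordinates)
     is at most its value min(P(x_k > a), P(T_k > b)) for the monotone coupling
     of the conditional laws.
   - Optimality against the competitor that keeps the upper coordinates of
     gamma_eps, draws x_k and y_k from their conditional laws by the quantile
     coupling and completes the lower coordinates in the same way. After
     division by lambda_k the lower coordinates contribute at most a constant
     times the sum of lambda_i / lambda_k over i < k, which vanishes; hence
     E[x_k y_k] is asymptotically at least E[x_k T_k(x)].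
   As E[x_k y_k] is a positive combination of the joint tails, the one-sided
   bounds are equalities in the limit. So the law of (x_k, ..., x_d, y_k)
   converges on products of Borel sets with rays, and testing it on [T_k <= b]
   and [y_k > b] gives the claim for x_k.

   No compactness of the set of plans is needed: L^2 convergence of y - T x
   under gamma_eps follows from the fixed second moments, and it implies both
   conclusions. *)

Require Import Defs.
From HB Require Import structures.
From mathcomp Require Import all_boot all_order all_algebra.
From mathcomp Require Import all_classical all_reals all_analysis.
From mathcomp Require Import measurable_realfun ring lra.
Import Order.TTheory GRing.Theory Num.Theory.
Import numFieldNormedType.Exports.
Local Open Scope classical_set_scope.
Local Open Scope ring_scope.

Set Implicit Arguments.
Unset Strict Implicit.
Unset Printing Implicit Defensive.

(** Both marginals are fixed, so a tail or truncation error that involves a single marginal is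
    uniform over the plans; every estimate is arranged so that only such errors occur.

    The one-sided bound rests on a splitting. Let p and q be the conditional probabilities of an
    up-set of x_k and of the corresponding up-set of T_k, given the upper coordinates. Then min(p,
    q) is p on the set [p <= q] and q elsewhere. Keeping only the event on x over that set, and only
    the event on y off it, leaves quantities that depend on one marginal each, once the set [p <= q]
    of upper x has been rewritten as a set of upper y. Invertibility of T rewrites it as a set of
    upper T x, and asymptotic agreement replaces T x by y.

    The equality case is extracted from a single moment: a truncation of x_k and its remainder are
    both nondecreasing, and likewise for y_k, so E[x_k y_k] is a sum of three moments of monotone
    functions, each with its own asymptotic upper bound. A lower bound on the sum is then a lower
    bound on each of them. *)

Definition Pr {disp} {T : measurableType disp} {R : realType}
  (P : probability T R) (A : set T) : R := fine (P A).

Definition L1 {disp} {T : measurableType disp} {R : realType}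
  (P : probability T R) (f : T -> R) : Prop :=
  P.-integrable setT (EFin \o f).

(** Measurability is a separate clause because integrability of the square does not give it: the
    square may be measurable when the function is not. *)
Definition L2 {disp} {T : measurableType disp} {R : realType}
    (P : probability T R) (f : T -> R) : Prop :=
  measurable_fun setT f /\ L1 P (fun x => f x ^+ 2).

Definition E {disp} {T : measurableType disp} {R : realType}
  (P : probability T R) (f : T -> R) : R := (\int[P]_x f x)%R.

Section measurable_sets.
Context {disp} {T : measurableType disp} {R : realType}.
Implicit Types f g : T -> R.

Lemma measurable_lt_set f g : measurable_fun setT f -> measurable_fun setT g ->
  measurable [set x | f x < g x].
Proof.
move=> mf mg; have := measurable_fun_ltr mf mg measurableT (I : measurable [set true]).
by rewrite setTI; congr measurable; apply/seteqP; split => x /=.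
Qed.

Lemma measurable_le_set f g : measurable_fun setT f -> measurable_fun setT g ->
  measurable [set x | f x <= g x].
Proof.
move=> mf mg; have := measurable_fun_ler mf mg measurableT (I : measurable [set true]).
by rewrite setTI; congr measurable; apply/seteqP; split => x /=.
Qed.

Lemma measurable_gtc_set f (c : R) : measurable_fun setT f ->
  measurable [set x | c < f x].
Proof. exact: measurable_lt_set. Qed.

Lemma measurable_preimage {d2} {S : measurableType d2} (X : T -> S) (B : set S) :
  measurable_fun setT X -> measurable B -> measurable (X @^-1` B).
Proof. by move=> mX mB; rewrite -[X in measurable X]setTI; exact: mX. Qed.

End measurable_sets.

(** * Probabilities and expectations *)

Section prob.
Context {disp} {T : measurableType disp} {R : realType}.
Variable P : probability T R.
Implicit Types (A B : set T) (f g : T -> R).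

Lemma PrE A : measurable A -> P A = (Pr P A)%:E.
Proof. by move=> mA; rewrite /Pr fineK// fin_num_measure. Qed.

Lemma Pr_ge0 A : 0 <= Pr P A.
Proof. by rewrite /Pr fine_ge0. Qed.

Lemma PrT : Pr P setT = 1.
Proof. by rewrite /Pr probability_setT. Qed.

Lemma Pr_le A B : measurable A -> measurable B -> A `<=` B -> Pr P A <= Pr P B.
Proof.
by move=> mA mB AB; rewrite -lee_fin -!PrE// le_measure// inE.
Qed.

Lemma Pr_le1 A : measurable A -> Pr P A <= 1.
Proof. by move=> mA; rewrite -PrT; exact: Pr_le. Qed.

Lemma PrC A : measurable A -> Pr P (~` A) = 1 - Pr P A.
Proof.
by move=> mA; rewrite /Pr probability_setC// PrE.
Qed.

Lemma PrU_le A B : measurable A -> measurable B ->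
  Pr P (A `|` B) <= Pr P A + Pr P B.
Proof.
move=> mA mB; rewrite -lee_fin EFinD -!PrE//; last exact: measurableU.
exact: measureU2.
Qed.

Lemma PrD A B : measurable A -> measurable B ->
  Pr P A = Pr P (A `&` B) + Pr P (A `\` B).
Proof.
move=> mA mB; apply: EFin_inj; rewrite EFinD -!PrE//.
- by rewrite addeC -measureDI.
- exact: measurableD.
- exact: measurableI.
Qed.

Lemma L1_measurable f : L1 P f -> measurable_fun setT f.
Proof. by move=> /measurable_int/measurable_EFinP. Qed.

Lemma L1D f g : L1 P f -> L1 P g -> L1 P (fun x => f x + g x).
Proof. by move=> f1 g1; exact: (integrableD measurableT f1 g1). Qed.

Lemma L1Z (r : R) f : L1 P f -> L1 P (fun x => r * f x).
Proof. by move=> f1; exact: (integrableZl measurableT r f1). Qed.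

Lemma L1B f g : L1 P f -> L1 P g -> L1 P (fun x => f x - g x).
Proof. by move=> f1 g1; exact: (integrableB measurableT f1 g1). Qed.

Lemma L1_le f g : measurable_fun setT f -> L1 P g ->
  (forall x, `|f x| <= g x) -> L1 P f.
Proof.
move=> mf g1 fg; apply: (le_integrable measurableT _ _ g1).
  exact/measurable_EFinP.
by move=> x _ /=; rewrite lee_fin (le_trans (fg x))// ler_norm.
Qed.

Lemma L1cst (r : R) : L1 P (fun=> r).
Proof. exact: finite_measure_integrable_cst. Qed.

Lemma L1_bounded f (M : R) : measurable_fun setT f ->
  (forall x, `|f x| <= M) -> L1 P f.
Proof. by move=> mf fM; exact: (L1_le mf (L1cst M)). Qed.

Lemma L1_abs f : L1 P f -> L1 P (fun x => `|f x|).
Proof. by move=> f1; exact: (integrable_abse f1). Qed.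

Lemma L1_sum (I : Type) (s : seq I) (F : I -> T -> R) :
  (forall i, L1 P (F i)) -> L1 P (fun x => \sum_(i <- s) F i x).
Proof.
move=> F1; elim: s => [|i s ih].
  by under eq_fun do rewrite big_nil; exact: L1cst.
by under eq_fun do rewrite big_cons; apply: L1D.
Qed.

Lemma ED f g : L1 P f -> L1 P g -> E P (fun x => f x + g x) = E P f + E P g.
Proof. by move=> f1 g1; rewrite /E RintegralD. Qed.

Lemma EB f g : L1 P f -> L1 P g -> E P (fun x => f x - g x) = E P f - E P g.
Proof. by move=> f1 g1; rewrite /E RintegralB. Qed.

Lemma EZ (r : R) f : L1 P f -> E P (fun x => r * f x) = r * E P f.
Proof. by move=> f1; rewrite /E RintegralZl. Qed.

Lemma Ecst (r : R) : E P (fun=> r) = r.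
Proof.
by rewrite /E Rintegral_cst// [fine _](_ : _ = 1) ?mulr1//; exact: PrT.
Qed.

Lemma Ele f g : L1 P f -> L1 P g -> (forall x, f x <= g x) -> E P f <= E P g.
Proof. by move=> f1 g1 fg; apply: le_Rintegral. Qed.

Lemma E_ge0 f : (forall x, 0 <= f x) -> 0 <= E P f.
Proof. by move=> f0; apply: Rintegral_ge0. Qed.

Lemma E_abs_le f : L1 P f -> `|E P f| <= E P (fun x => `|f x|).
Proof. by move=> f1; apply: le_normr_Rintegral. Qed.

Lemma E_dist_le f g (c : R) (h : T -> R) : L1 P f -> L1 P g -> L1 P h ->
  (forall x, `|f x - g x| <= h x) -> E P h <= c -> `|E P f - E P g| <= c.
Proof.
move=> f1 g1 h1 fgh hc; rewrite -EB//.
apply: le_trans (E_abs_le (L1B f1 g1)) _; apply: le_trans hc.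
by apply: Ele => //; exact/L1_abs/L1B.
Qed.

Lemma E_sum (I : Type) (s : seq I) (F : I -> T -> R) :
  (forall i, L1 P (F i)) ->
  E P (fun x => \sum_(i <- s) F i x) = \sum_(i <- s) E P (F i).
Proof.
move=> F1; elim: s => [|i s ih].
  by under eq_fun do rewrite big_nil; rewrite Ecst big_nil.
under eq_fun do rewrite big_cons.
by rewrite ED//; [rewrite ih big_cons|exact: L1_sum].
Qed.

Lemma L1_indic A : measurable A -> L1 P \1_A.
Proof.
move=> mA; apply: (@L1_bounded _ 1); first exact: measurable_indic.
by move=> x; rewrite indicE; case: (_ \in _); rewrite ?normr1 ?normr0.
Qed.

Lemma E_indic A : measurable A -> E P \1_A = Pr P A.
Proof. by move=> mA; rewrite /E /Rintegral integral_indic// setIT. Qed.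

Lemma L2_L1 f g : L2 P f -> L2 P g -> L1 P (fun x => f x * g x).
Proof.
move=> [mf f2] [mg g2]; apply: (L1_le _ (L1D f2 g2)).
  exact: measurable_funM.
move=> x; rewrite normrM.
rewrite -(real_normK (num_real (f x))) -(real_normK (num_real (g x))).
have := sqr_ge0 (`|f x| - `|g x|).
have := mulr_ge0 (normr_ge0 (f x)) (normr_ge0 (g x)).
nra.
Qed.

Lemma L2_le f g : measurable_fun setT f -> L2 P g ->
  (forall x, `|f x| <= `|g x|) -> L2 P f.
Proof.
move=> mf [mg g2] fg; split=> //; apply: (L1_le _ g2).
  exact: measurable_funX.
move=> x; rewrite normrX -[leRHS]real_normK ?num_real//.
by rewrite lerXn2r ?nnegrE.
Qed.

Lemma L2_measurable f : L2 P f -> measurable_fun setT f.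
Proof. by case. Qed.

Lemma L2_bounded f (M : R) : measurable_fun setT f ->
  (forall x, `|f x| <= M) -> L2 P f.
Proof.
move=> mf fM; split=> //; apply: (@L1_bounded _ (M ^+ 2)).
  exact: measurable_funX.
move=> x; rewrite normrX lerXn2r ?nnegrE//.
exact: le_trans (normr_ge0 _) (fM x).
Qed.

Lemma L2cst (r : R) : L2 P (fun=> r).
Proof. exact: (@L2_bounded _ `|r|). Qed.

Lemma L2D f g : L2 P f -> L2 P g -> L2 P (fun x => f x + g x).
Proof.
move=> f2 g2; have fg := L2_L1 f2 g2.
split; first by apply: measurable_funD; exact: L2_measurable.
under eq_fun do rewrite sqrrD.
apply: L1D; last by case: g2.
apply: L1D; first by case: f2.
by under eq_fun do rewrite -mulr_natl; exact: L1Z.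
Qed.

Lemma L2Z (r : R) f : L2 P f -> L2 P (fun x => r * f x).
Proof.
move=> [mf f2]; split; first exact: measurable_funM.
by under eq_fun do rewrite exprMn; exact: L1Z.
Qed.

Lemma L2B f g : L2 P f -> L2 P g -> L2 P (fun x => f x - g x).
Proof.
move=> f2 /(L2Z (-1)) g2; have := L2D f2 g2.
by under eq_fun do rewrite mulN1r.
Qed.

Lemma L2_sqrB f g : L2 P f -> L2 P g -> L1 P (fun x => (f x - g x) ^+ 2).
Proof. by move=> f2 g2; case: (L2B f2 g2). Qed.

Lemma E_sqrB f g : L2 P f -> L2 P g ->
  E P (fun x => (f x - g x) ^+ 2) =
  E P (fun x => f x ^+ 2) + E P (fun x => g x ^+ 2)
  - 2 * E P (fun x => f x * g x).
Proof.
move=> f2 g2; have fg := L2_L1 f2 g2.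
case: (f2) => _ ff; case: (g2) => _ gg.
rewrite -ED// -EZ// -EB; [|exact: L1D|exact: L1Z].
by congr E; apply/funext => x; ring.
Qed.

(* AM-GM in place of Cauchy-Schwarz: the free parameter [k] is sent to
   infinity after the second factor has been made small. *)
Lemma E_mul_le f g (k : R) : 0 < k -> L2 P f -> L2 P g ->
  E P (fun x => `|f x * g x|) <=
  k^-1 * E P (fun x => f x ^+ 2) + k * E P (fun x => g x ^+ 2).
Proof.
move=> k0 f2 g2; have fg := L2_L1 f2 g2.
case: (f2) => _ ff; case: (g2) => _ gg.
rewrite -EZ// -EZ// -ED; [|exact: L1Z..].
apply: Ele; [exact: L1_abs|by apply: L1D; exact: L1Z|move=> x].
rewrite normrM.
rewrite -(real_normK (num_real (f x))) -(real_normK (num_real (g x))).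
have -> : `|f x| * `|g x| = (k^-1 * `|f x|) * (k * `|g x|).
  by field; rewrite gt_eqF.
have ki : 0 < k^-1 by rewrite invr_gt0.
have -> : k^-1 * `|f x| ^+ 2 = (k^-1 * `|f x|) ^+ 2 * k.
  by field; rewrite gt_eqF.
have -> : k * `|g x| ^+ 2 = (k * `|g x|) ^+ 2 * k^-1.
  by field; rewrite gt_eqF.
set a := k^-1 * `|f x|; set b := k * `|g x|.
have -> : a ^+ 2 * k + b ^+ 2 * k^-1 = (a - b * k^-1) ^+ 2 * k + 2 * (a * b).
  by field; rewrite gt_eqF.
have := mulr_ge0 (sqr_ge0 (a - b * k^-1)) (ltW k0).
have : 0 <= a * b by rewrite !mulr_ge0 ?(ltW ki) ?(ltW k0).
lra.
Qed.

End prob.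

(** Push-forwards are compared set by set, on possibly different probability spaces, so that no
    measure has to be built on the target. *)
Definition same_law {d1 d2 d3} {T1 : measurableType d1} {T2 : measurableType d2}
    {S : measurableType d3} {R : realType} (P1 : probability T1 R)
    (X1 : T1 -> S) (P2 : probability T2 R) (X2 : T2 -> S) : Prop :=
  forall B, measurable B -> P1 (X1 @^-1` B) = P2 (X2 @^-1` B).

Section same_law.
Context {d1 d2 d3} {T1 : measurableType d1} {T2 : measurableType d2}
  {S : measurableType d3} {R : realType}.
Variables (P1 : probability T1 R) (X1 : T1 -> S).
Variables (P2 : probability T2 R) (X2 : T2 -> S).
Hypothesis (mX1 : measurable_fun setT X1) (mX2 : measurable_fun setT X2).

Lemma same_law_sym : same_law P1 X1 P2 X2 -> same_law P2 X2 P1 X1.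
Proof. by move=> h B mB; rewrite h. Qed.

Lemma same_law_integral (h : S -> \bar R) : same_law P1 X1 P2 X2 ->
  measurable_fun setT h -> (forall x, 0 <= h x)%E ->
  (\int[P1]_x h (X1 x) = \int[P2]_x h (X2 x))%E.
Proof.
move=> law mh h0.
rewrite -[LHS](@ge0_integral_pushforward _ _ _ _ R X1 mX1 P1 setT h)//.
rewrite -[RHS](@ge0_integral_pushforward _ _ _ _ R X2 mX2 P2 setT h)//.
by apply: eq_measure_integral => A mA _; exact: law.
Qed.

Lemma same_law_L1 (h : S -> R) : same_law P1 X1 P2 X2 ->
  measurable_fun setT h -> L1 P1 (h \o X1) -> L1 P2 (h \o X2).
Proof.
move=> law mh /integrableP[_ hoo]; apply/integrableP; split.
  by apply/measurable_EFinP; exact: measurableT_comp.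
rewrite -(same_law_integral (h := fun s => `|(h s)%:E|%E))//.
by apply: measurableT_comp => //; exact/measurable_EFinP.
Qed.

Lemma same_law_L2 (h : S -> R) : same_law P1 X1 P2 X2 ->
  measurable_fun setT h -> L2 P1 (h \o X1) -> L2 P2 (h \o X2).
Proof.
move=> law mh [_ h2]; split; first exact: measurableT_comp.
by apply: (same_law_L1 (h := fun s => h s ^+ 2)) => //; exact: measurable_funX.
Qed.

Lemma same_law_E (h : S -> R) : same_law P1 X1 P2 X2 ->
  measurable_fun setT h -> L1 P1 (h \o X1) -> E P1 (h \o X1) = E P2 (h \o X2).
Proof.
move=> law mh h1; have h2 := same_law_L1 law mh h1.
rewrite /E /Rintegral; congr fine.
have mh' : measurable_fun setT (EFin \o h) by exact/measurable_EFinP.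
rewrite -[LHS](@integral_pushforward _ _ _ _ R X1 mX1 P1 setT (EFin \o h))//.
rewrite -[RHS](@integral_pushforward _ _ _ _ R X2 mX2 P2 setT (EFin \o h))//.
by apply: eq_measure_integral => A mA _; exact: law.
Qed.

Lemma same_law_Pr (B : set S) : same_law P1 X1 P2 X2 -> measurable B ->
  Pr P1 (X1 @^-1` B) = Pr P2 (X2 @^-1` B).
Proof. by move=> law mB; rewrite /Pr law. Qed.

End same_law.

(** This is a <= b + o(1) along [F]. Both sides may move with the parameter and neither needs a
    limit, which suits comparisons between two families of plans. *)
Definition limsup_le {I : Type} {R : realType} (F : set_system I)
  (a b : I -> R) : Prop :=
  forall e : R, 0 < e -> \forall i \near F, a i <= b i + e.

(** * Asymptotic inequalities and mixed moments *)

Section limsup_le.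
Context {I : Type} {R : realType} (F : set_system I) {FF : Filter F}.
Implicit Types a b c : I -> R.

Lemma limsup_leW a b : (forall i, a i <= b i) -> limsup_le F a b.
Proof.
by move=> ab e e0; apply: nearW => i; rewrite (le_trans (ab i))// lerDl ltW.
Qed.

Lemma eq_limsup_le a' b' a b : a =1 a' -> b =1 b' ->
  limsup_le F a' b' -> limsup_le F a b.
Proof. by move=> /funext -> /funext ->. Qed.

Lemma limsup_le_trans b a c :
  limsup_le F a b -> limsup_le F b c -> limsup_le F a c.
Proof.
move=> ab bc e e0; have e2 : 0 < e / 2 by rewrite divr_gt0.
near=> i.
have : a i <= b i + e / 2 by near: i; exact: ab.
have : b i <= c i + e / 2 by near: i; exact: bc.
lra.
Unshelve. all: by end_near. Qed.

Lemma limsup_leD a b a' b' : limsup_le F a b -> limsup_le F a' b' ->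
  limsup_le F (fun i => a i + a' i) (fun i => b i + b' i).
Proof.
move=> ab bc e e0; have e2 : 0 < e / 2 by rewrite divr_gt0.
near=> i.
have : a i <= b i + e / 2 by near: i; exact: ab.
have : a' i <= b' i + e / 2 by near: i; exact: bc.
lra.
Unshelve. all: by end_near. Qed.

Lemma limsup_leN a b : limsup_le F a b ->
  limsup_le F (fun i => - b i) (fun i => - a i).
Proof.
move=> ab e e0; near=> i.
have : a i <= b i + e by near: i; exact: ab.
lra.
Unshelve. all: by end_near. Qed.

Lemma limsup_leB a b a' b' : limsup_le F a b -> limsup_le F b' a' ->
  limsup_le F (fun i => a i - a' i) (fun i => b i - b' i).
Proof. by move=> ab /limsup_leN; exact: limsup_leD. Qed.

Lemma limsup_leZ (r : R) a b : 0 <= r -> limsup_le F a b ->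
  limsup_le F (fun i => r * a i) (fun i => r * b i).
Proof.
rewrite le_eqVlt => /predU1P[<- _|r0 ab e e0].
  by apply: limsup_leW => i; rewrite !mul0r.
have er : 0 < e / r by rewrite divr_gt0.
near=> i.
have : a i <= b i + e / r by near: i; exact: ab.
by rewrite -(ler_pM2l r0) mulrDr mulrCA divff ?mulr1// gt_eqF.
Unshelve. all: by end_near. Qed.

Lemma limsup_le_sum (J : Type) (s : seq J) (a b : J -> I -> R) :
  (forall j, limsup_le F (a j) (b j)) ->
  limsup_le F (fun i => \sum_(j <- s) a j i) (fun i => \sum_(j <- s) b j i).
Proof.
move=> ab; elim: s => [|j s ih].
  by apply: limsup_leW => i; rewrite !big_nil.
apply: eq_limsup_le (limsup_leD (ab j) ih) => i; exact: big_cons.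
Qed.

(** The approximants may depend on the error [e], but the two approximation bounds hold for every
    [i]; the error is therefore spent before the limit is taken. *)
Lemma limsup_le_approx a b :
  (forall e : R, 0 < e -> exists a' b', [/\ limsup_le F a' b',
     forall i, a i <= a' i + e & forall i, b' i <= b i + e]) ->
  limsup_le F a b.
Proof.
move=> h e e0; have e3 : 0 < e / 3 by rewrite divr_gt0.
have [a' [b' [ab aa bb]]] := h _ e3.
near=> i.
have : a' i <= b' i + e / 3 by near: i; exact: ab.
have := aa i; have := bb i; lra.
Unshelve. all: by end_near. Qed.

Lemma limsup_le_cvg a (l : R) : limsup_le F a (fun=> l) ->
  limsup_le F (fun=> l) a -> a @ F --> l.
Proof.
move=> al la; apply/cvgrPdist_le => e e0; near=> i.
have : a i <= l + e by near: i; exact: al.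
have : l <= a i + e by near: i; exact: la.
rewrite ler_norml; lra.
Unshelve. all: by end_near. Qed.

Lemma cvg_limsup_le a (l : R) : a @ F --> l -> limsup_le F a (fun=> l).
Proof.
move=> /cvgrPdist_le al e e0; near=> i.
have : `|l - a i| <= e by near: i; exact: al.
rewrite ler_norml; lra.
Unshelve. all: by end_near. Qed.

Lemma cvg_limsup_ge a (l : R) : a @ F --> l -> limsup_le F (fun=> l) a.
Proof.
move=> /cvgrPdist_le al e e0; near=> i.
have : `|l - a i| <= e by near: i; exact: al.
rewrite ler_norml; lra.
Unshelve. all: by end_near. Qed.

End limsup_le.

(** * Approximation of the identity by step functions *)

Section step.
Context {R : realType}.
Implicit Types r s : R.

Definition level (n k : nat) : R := k.+1%:R / n.+1%:R - n.+1%:R.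

(** Rounding down to the grid of mesh 1/(n+1), clamped to [-(n+1), n+1]; this window has 2(n+1)^2
    cells. The form is a sum of indicators of open upper rays with equal positive weights, so that
    expectations of products become positive combinations of joint tails. *)
Definition step (n : nat) (r : R) : R :=
  n.+1%:R^-1 * (\sum_(k < 2 * n.+1 ^ 2) (level n k < r)%R%:R) - n.+1%:R.

Let count (K : nat) s : R := \sum_(k < K) (k.+1%:R < s)%R%:R.

(** [count K s] is the number of integers among 1, ..., K that are strictly below [s]. The clauses
    are proved together because the induction on [K] draws on several of them at once. *)
Let countP (K : nat) s : [/\ s <= 0 -> count K s = 0, 0 <= s -> count K s <= s,
  0 <= count K s <= K%:R, s <= K%:R -> s <= count K s + 1 &
  K%:R < s -> count K s = K%:R].
Proof.
rewrite /count; elim: K => [|K [h1 h2 h3 h4 h5]].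
  by rewrite big_ord0; split; rewrite ?lexx// => h; rewrite (le_trans h)// add0r.
rewrite big_ord_recr/= -natr1.
case: (ltrP (K%:R + 1) s) => Ks /=.
  have K0 := ler0n R K; rewrite h5; last by lra.
  by split; lra.
rewrite addr0; have [sK|Ks'] := lerP s K%:R; have K0 := ler0n R K.
  by split => //; [lra|by move=> _; exact: h4].
by rewrite h5//; split => //; lra.
Qed.

Let stepE n r : step n r =
  n.+1%:R^-1 * count (2 * n.+1 ^ 2) (n.+1%:R * (r + n.+1%:R)) - n.+1%:R.
Proof.
rewrite /step /count; congr (_ * _ - _); apply: eq_bigr => k _; congr (_%:R).
congr nat_of_bool; rewrite /level ltrBlDr ltr_pdivrMr ?ltr0n//.
by rewrite [(_ + _) * _]mulrC.
Qed.

Lemma step_dist n r : `|r| <= n.+1%:R -> `|r - step n r| <= n.+1%:R^-1.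
Proof.
rewrite ler_norml => /andP[r1 r2]; rewrite stepE.
set N : R := n.+1%:R in r1 r2 *; have N0 : 0 < N by rewrite ltr0n.
have [_ h2 _ h4 _] := countP (2 * n.+1 ^ 2) (N * (r + N)).
set c := count _ _ in h2 h4 *.
have rN : 0 <= N * (r + N) by apply: mulr_ge0; [exact: ltW|lra].
have {}h2 := h2 rN.
have : N * (r + N) <= (2 * n.+1 ^ 2)%:R.
  rewrite natrM natrX -/N expr2 mulrCA ler_pM2l//; lra.
move=> /h4{}h4.
have {}h2 : N^-1 * c <= r + N by rewrite mulrC ler_pdivrMr// mulrC.
have {}h4 : r + N <= N^-1 * c + N^-1.
  rewrite -[X in _ <= _ + X]mulr1 -mulrDr mulrC ler_pdivlMr// mulrC.
  exact: h4.
have : 0 < N^-1 by rewrite invr_gt0.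
rewrite ler_norml; move: h2 h4; move: (N^-1 * c) (N^-1) => a b; lra.
Qed.

(** The bound does not depend on [n]: it is the dominating function in [E_step_dist]. *)
Lemma step_dist_le n r : `|r - step n r| <= 1 + `|r|.
Proof.
have [rn|rn] := leP `|r| n.+1%:R.
  apply: (le_trans (step_dist rn)); apply: (@le_trans _ _ 1).
    by rewrite invf_le1 ?ltr0n// ler1n.
  by rewrite lerDl.
rewrite stepE.
set N : R := n.+1%:R in rn *; have N0 : 0 < N by rewrite ltr0n.
have [h1 _ /andP[h3 h3'] _ h5] := countP (2 * n.+1 ^ 2) (N * (r + N)).
set c := count _ _ in h1 h3 h5 h3' *.
have [r0|r0] := ltrP r 0.
  have -> : c = 0.
    apply: h1; rewrite pmulr_rle0//.
    by move: rn; rewrite (ltr0_norm r0); lra.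
  by rewrite mulr0 (ltr0_norm r0) ler_norml; move: rn; rewrite (ltr0_norm r0); lra.
have -> : c = (2 * n.+1 ^ 2)%:R.
  apply: h5; rewrite natrM natrX -/N expr2 mulrCA ltr_pM2l//.
  by move: rn; rewrite (ger0_norm r0); lra.
rewrite natrM natrX -/N expr2.
have -> : N^-1 * (2 * (N * N)) = 2 * N by field; rewrite gt_eqF.
by move: rn; rewrite (ger0_norm r0) ler_norml; lra.
Qed.

Lemma measurable_step n : measurable_fun setT (step n).
Proof.
apply: measurable_funB => //; apply: measurable_funM => //.
apply: measurable_sum => k.
have -> : (fun r => (level n k < r)%R%:R) = \1_[set r | level n k < r] :> (R -> R).
  apply/funext => r; rewrite indicE; congr (nat_of_bool _)%:R.
  by apply/idP/idP; rewrite inE.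
exact/measurable_indic/measurable_gtc_set.
Qed.

Lemma cvg_step r : step n r @[n --> \oo] --> r.
Proof.
apply/cvgrPdist_le => e e0.
have h : \forall n \near \oo, n.+1%:R^-1 <= e.
  have := @cvg_harmonic R; move/cvgrPdist_le => /(_ _ e0).
  by apply: filterS => n; rewrite sub0r normrN /= ger0_norm.
near=> n; apply: (@le_trans _ _ n.+1%:R^-1); last by near: n.
apply: step_dist; apply: (@le_trans _ _ n%:R); last by rewrite ler_nat.
by near: n; exact: nbhs_infty_ger.
Unshelve. all: by end_near. Qed.

End step.

Section step_expectation.
Context {disp} {T : measurableType disp} {R : realType}.
Variable P : probability T R.
Implicit Types (X Y : T -> R).

Lemma L2_step X n : L2 P X -> L2 P (step n \o X).
Proof.
move=> X2; have mX := L2_measurable X2.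
have -> : step n \o X = (fun x => X x - (X x - step n (X x))).
  by apply/funext => x /=; rewrite opprB addrCA subrr addr0.
apply: L2B => //.
apply: (@L2_le _ _ _ _ _ (fun x => 1 + `|X x|)).
- by apply: measurable_funB => //; apply: measurableT_comp => //; exact: measurable_step.
- apply: L2D; first exact: L2cst.
  by apply: (L2_le _ X2) => [|x]; [exact: measurableT_comp|rewrite normr_id].
- move=> x; apply: (le_trans (step_dist_le _ _)).
  by rewrite [leRHS]ger0_norm// addr_ge0.
Qed.

Lemma E_step_dist X (e : R) : 0 < e -> L2 P X ->
  \forall n \near \oo, E P (fun x => (X x - step n (X x)) ^+ 2) <= e.
Proof.
move=> e0 X2; have mX := L2_measurable X2.
have mS n : measurable_fun setT (fun x => (X x - step n (X x)) ^+ 2).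
  apply: measurable_funX; apply: measurable_funB => //.
  by apply: measurableT_comp => //; exact: measurable_step.
have G2 : L2 P (fun x => 1 + `|X x|).
  apply: L2D; first exact: L2cst.
  by apply: (L2_le _ X2) => [|x]; [exact: measurableT_comp|rewrite normr_id].
have [] := @dominated_convergence _ T R P setT measurableT
  (fun n x => ((X x - step n (X x)) ^+ 2)%:E) (cst 0%E)
  (fun x => ((1 + `|X x|) ^+ 2)%:E).
- by move=> n; exact/measurable_EFinP.
- exact: measurable_cst.
- apply: aeW => x _; apply/cvg_EFin; first exact: nearW.
  have : X x - step n (X x) @[n --> \oo] --> (X x - X x).
    by apply: cvgB; [exact: cvg_cst|exact: cvg_step].
  by rewrite subrr => h; have := cvgM h h; rewrite mulr0; exact.
- by case: G2.
- apply: aeW => x n _ /=; rewrite lee_fin normrX lerXn2r ?nnegrE//.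
  exact: step_dist_le.
move=> _ _; rewrite integral0 => h.
have h' : E P (fun x => (X x - step n (X x)) ^+ 2) @[n --> \oo] --> (0 : R).
  exact: (fine_cvg h).
move/cvgrPdist_le : h' => /(_ _ e0); apply: filterS => n.
by rewrite sub0r normrN => /(le_trans (ler_norm _)).
Qed.

(** Expanding the product, the joint tails appear with the positive coefficient 1/(n+1)^2, and the
    subtracted sums involve one marginal each. One-sided bounds on joint tails thus pass to the
    moment when the marginals are fixed. *)
Lemma E_step_mul X Y n : measurable_fun setT X -> measurable_fun setT Y ->
  E P (fun x => step n (X x) * step n (Y x)) =
  n.+1%:R^-1 ^+ 2 * (\sum_(k < 2 * n.+1 ^ 2) \sum_(l < 2 * n.+1 ^ 2)
    Pr P [set x | level n k < X x /\ level n l < Y x])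
  - \sum_(k < 2 * n.+1 ^ 2) Pr P (X @^-1` [set r | level n k < r])
  - \sum_(k < 2 * n.+1 ^ 2) Pr P (Y @^-1` [set r | level n k < r])
  + n.+1%:R ^+ 2.
Proof.
move=> mX mY; set N : R := n.+1%:R; set K := (2 * _)%N.
have N0 : N != 0 by rewrite pnatr_eq0.
pose A (Z : T -> R) (k : nat) := Z @^-1` [set r | level n k < r].
pose AB (k l : nat) := [set x | level n k < X x /\ level n l < Y x].
have mA (Z : T -> R) k : measurable_fun setT Z -> measurable (A Z k).
  by move=> mZ; exact: measurable_gtc_set.
have mAB k l : measurable (AB k l).
  by apply: measurableI; exact: measurable_gtc_set.
have AE (Z : T -> R) k x : (level n k < Z x)%R%:R = \1_(A Z k) x :> R.
  rewrite indicE; congr (nat_of_bool _)%:R.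
  by apply/idP/idP; rewrite inE.
have -> : (fun x => step n (X x) * step n (Y x)) = (fun x =>
    (N^-1 ^+ 2 * (\sum_(k < K) \sum_(l < K) \1_(AB k l) x)
     - \sum_(k < K) \1_(A X k) x) - \sum_(k < K) \1_(A Y k) x + N ^+ 2).
  apply/funext => x; rewrite /step -/N -/K.
  under eq_bigr do rewrite AE.
  under [X in _ * (N^-1 * X - _)]eq_bigr do rewrite AE.
  have -> : \sum_(k < K) \sum_(l < K) \1_(AB k l) x =
      (\sum_(k < K) \1_(A X k) x) * (\sum_(k < K) \1_(A Y k) x) :> R.
    rewrite mulr_suml; apply: eq_bigr => k _.
    rewrite mulr_sumr; apply: eq_bigr => l _.
    rewrite !indicE -natrM mulnb; congr (nat_of_bool _)%:R.
    by apply/idP/andP => [/set_mem[? ?]|[/set_mem ? /set_mem ?]];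
      [split; exact/mem_set|exact/mem_set].
  by field.
have iA Z : measurable_fun setT Z -> L1 P (fun x => \sum_(k < K) \1_(A Z k) x).
  by move=> mZ; apply: L1_sum => k; exact/L1_indic/mA.
have iAB : L1 P (fun x => \sum_(k < K) \sum_(l < K) \1_(AB k l) x).
  by apply: L1_sum => k; apply: L1_sum => l; exact: L1_indic.
rewrite ED; [|apply: L1B|exact: L1cst]; [|apply: L1B|]; [|exact: L1Z|..]; [|exact: iA..].
rewrite EB; [|apply: L1B|exact: iA]; [|exact: L1Z|exact: iA].
rewrite EB; [|exact: L1Z|exact: iA].
rewrite EZ// Ecst E_sum; last by move=> k; apply: L1_sum => l; exact: L1_indic.
congr (_ * _ - _ - _ + _).
- apply: eq_bigr => k _; rewrite E_sum; last by move=> l; exact: L1_indic.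
  by apply: eq_bigr => l _; rewrite E_indic.
- rewrite E_sum; last by move=> k; exact/L1_indic/mA.
  by apply: eq_bigr => k _; rewrite E_indic//; exact: mA.
- rewrite E_sum; last by move=> k; exact/L1_indic/mA.
  by apply: eq_bigr => k _; rewrite E_indic//; exact: mA.
Qed.

(** With s = [step n], XY - s(X) s(Y) = Y (X - s(X)) + s(X) (Y - s(Y)), and [E_mul_le] bounds each
    product. The right side involves one variable at a time, hence is the same for all couplings of
    given laws. *)
Lemma E_step_mul_dist X Y n (k : R) : 0 < k -> L2 P X -> L2 P Y ->
  `|E P (fun x => X x * Y x) - E P (fun x => step n (X x) * step n (Y x))| <=
  k^-1 * (E P (fun x => Y x ^+ 2) + E P (fun x => (1 + 2 * `|X x|) ^+ 2))
  + k * (E P (fun x => (X x - step n (X x)) ^+ 2) +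
         E P (fun x => (Y x - step n (Y x)) ^+ 2)).
Proof.
move=> k0 X2 Y2.
have sX := L2_step n X2; have sY := L2_step n Y2.
have dX := L2B X2 sX; have dY := L2B Y2 sY.
have k0' := invr_gt0 k; rewrite k0 in k0'.
have G2 : L2 P (fun x => 1 + 2 * `|X x|).
  apply: L2D; first exact: L2cst.
  apply: L2Z; apply: (L2_le _ X2) => [|x]; last by rewrite normr_id.
  exact/measurableT_comp/(L2_measurable X2).
have G3 : E P (fun x => step n (X x) ^+ 2) <= E P (fun x => (1 + 2 * `|X x|) ^+ 2).
  apply: Ele; [by case: sX|by case: G2|move=> x].
  rewrite -[leLHS]real_normK ?num_real// lerXn2r ?nnegrE ?addr_ge0 ?mulr_ge0//.
  have := step_dist_le n (X x); have := ler_normB (X x) (X x - step n (X x)).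
  by rewrite opprB addrCA subrr addr0; lra.
have m1 := L2_L1 X2 Y2; have m2 := L2_L1 sX sY.
have m3 := L2_L1 Y2 dX; have m4 := L2_L1 sX dY.
apply: (@E_dist_le _ _ _ _ _ _ _
  (fun x => `|Y x * (X x - step n (X x))| + `|step n (X x) * (Y x - step n (Y x))|)) => //.
- by apply: L1D; exact: L1_abs.
- move=> x; apply: le_trans (ler_normD _ _); rewrite le_eqVlt; apply/orP; left.
  by apply/eqP; congr `|_|; ring.
- rewrite ED; [|exact: L1_abs..].
  have /= h1 := E_mul_le k0 Y2 dX; have /= h2 := E_mul_le k0 sX dY.
  apply: (le_trans (lerD h1 h2)).
  have := ler_wpM2l (ltW k0') G3; rewrite /=; lra.
Qed.

End step_expectation.

Section mixed_moments.
Context {I : Type} {R : realType} (F : set_system I) {FF : Filter F}.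
Context {d1 d2 d3 d4} {T1 : measurableType d1} {T2 : measurableType d2}
  {S1 : measurableType d3} {S2 : measurableType d4}.
Variables (P : I -> probability T1 R) (X Y : T1 -> R).
Variables (P' : I -> probability T2 R) (X' Y' : T2 -> R).
Variables (Q1 : probability S1 R) (A : S1 -> R).
Variables (Q2 : probability S2 R) (B : S2 -> R).
Hypotheses (mX : measurable_fun setT X) (mY : measurable_fun setT Y).
Hypotheses (mX' : measurable_fun setT X') (mY' : measurable_fun setT Y').
Hypotheses (A2 : L2 Q1 A) (B2 : L2 Q2 B).
Hypotheses (lX : forall i, same_law Q1 A (P i) X)
  (lX' : forall i, same_law Q1 A (P' i) X')
  (lY : forall i, same_law Q2 B (P i) Y)
  (lY' : forall i, same_law Q2 B (P' i) Y').

(* Once the marginals are fixed, E[XY] is, up to an error independent of the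
   coupling, a positive combination of the P(X > c, Y > c'). *)
Lemma limsup_le_mixed_moment :
  (forall c c' : R, limsup_le F
     (fun i => Pr (P i) [set x | c < X x /\ c' < Y x])
     (fun i => Pr (P' i) [set x | c < X' x /\ c' < Y' x])) ->
  limsup_le F (fun i => E (P i) (fun x => X x * Y x))
    (fun i => E (P' i) (fun x => X' x * Y' x)).
Proof.
move=> h; apply: limsup_le_approx => e e0.
have mA := L2_measurable A2; have mB := L2_measurable B2.
pose C := E Q2 (fun x => B x ^+ 2) + E Q1 (fun x => (1 + 2 * `|A x|) ^+ 2).
have C0 : 0 <= C by rewrite addr_ge0//; apply: E_ge0 => x; exact: sqr_ge0.
(* This [k] makes the error term C / k at most e / 2, the summand 1 keeping it positive when C = 0;
   [n] is then taken so large that the other term, with factor [k], is also at most e / 2. *)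
pose k := 2 * (C + 1) / e.
have k0 : 0 < k by rewrite divr_gt0// mulr_gt0//; lra.
have [n [hA hB]] : exists n,
    E Q1 (fun x => (A x - step n (A x)) ^+ 2) <= e / (4 * k) /\
    E Q2 (fun x => (B x - step n (B x)) ^+ 2) <= e / (4 * k).
  have ek : 0 < e / (4 * k) by rewrite divr_gt0// mulr_gt0.
  exact: filter_ex (filterI (E_step_dist ek A2) (E_step_dist ek B2)).
have err : k^-1 * C + k * (E Q1 (fun x => (A x - step n (A x)) ^+ 2) +
    E Q2 (fun x => (B x - step n (B x)) ^+ 2)) <= e.
  have : k^-1 * C <= e / 2.
    rewrite /k invf_div mulrAC ler_pdivrMr; last by rewrite mulr_gt0//; lra.
    have : 0 <= e * 1 by rewrite mulr1 ltW.
    lra.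
  have := lerD hA hB; rewrite -(ler_pM2l k0).
  have -> : k * (e / (4 * k) + e / (4 * k)) = e / 2 by field; rewrite gt_eqF.
  lra.
have m1 : measurable_fun setT (fun r : R => (1 + 2 * `|r|) ^+ 2).
  apply: measurable_funX; apply: measurable_funD => //.
  by apply: measurable_funM => //; exact: normr_measurable.
have m2 : measurable_fun setT (fun r : R => (r - step n r) ^+ 2).
  apply: measurable_funX; apply: measurable_funB => //; exact: measurable_step.
have m3 : measurable_fun setT (fun r : R => r ^+ 2) by exact: exprn_measurable.
have G2 : L2 Q1 (fun x => 1 + 2 * `|A x|).
  apply: L2D; first exact: L2cst.
  apply: L2Z; apply: (L2_le _ A2) => [|x]; last by rewrite normr_id.
  exact: measurableT_comp.
have [_ G3] := L2B A2 (L2_step n A2); have [_ G4] := L2B B2 (L2_step n B2).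
case: (A2) (B2) (G2) => _ A2' [_ B2'] [_ G2'].
pose a i := E (P i) (fun x => step n (X x) * step n (Y x)).
pose b i := E (P' i) (fun x => step n (X' x) * step n (Y' x)).
exists a, b; split.
- apply: eq_limsup_le => [i|i|].
  + exact: E_step_mul.
  + exact: E_step_mul.
  apply: limsup_leD; last exact: limsup_leW.
  apply: limsup_leB; first apply: limsup_leB; first apply: limsup_leZ.
  + exact: sqr_ge0.
  + by apply: limsup_le_sum => j; apply: limsup_le_sum => l; exact: h.
  + apply: limsup_leW => i; apply: ler_sum => j _.
    by rewrite -(same_law_Pr (lX i)) -?(same_law_Pr (lX' i))//; exact: measurable_gtc_set.
  + apply: limsup_leW => i; apply: ler_sum => j _.
    by rewrite -(same_law_Pr (lY i)) -?(same_law_Pr (lY' i))//; exact: measurable_gtc_set.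
- move=> i; rewrite addrC -lerBlDr; apply: le_trans (ler_norm _) _.
  apply: le_trans err; apply: le_trans (E_step_mul_dist _ k0 _ _) _.
  + exact: (same_law_L2 (h := id) mA mX (lX i)).
  + exact: (same_law_L2 (h := id) mB mY (lY i)).
  rewrite /C.
  rewrite (same_law_E mB mY (lY i) m3 B2') (same_law_E mA mX (lX i) m1 G2').
  by rewrite (same_law_E mB mY (lY i) m2 G4) (same_law_E mA mX (lX i) m2 G3).
- move=> i; rewrite addrC -lerBlDr; apply: le_trans (ler_norm _) _.
  rewrite distrC.
  apply: le_trans err; apply: le_trans (E_step_mul_dist _ k0 _ _) _.
  + exact: (same_law_L2 (h := id) mA mX' (lX' i)).
  + exact: (same_law_L2 (h := id) mB mY' (lY' i)).
  rewrite /C.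
  rewrite (same_law_E mB mY' (lY' i) m3 B2') (same_law_E mA mX' (lX' i) m1 G2').
  by rewrite (same_law_E mB mY' (lY' i) m2 G4) (same_law_E mA mX' (lX' i) m2 G3).
Qed.

End mixed_moments.

(** * Events on which two maps asymptotically agree *)

Section generators.
Context {R : realType}.

Lemma real_sigma_ind (G : set (set R)) : sigma_algebra setT G ->
  (forall c : R, G [set r | c < r]) -> measurable `<=` G.
Proof.
move=> sG Gc; rewrite [measurable](RGenOInfty.measurableE R).
apply: smallest_sub => // _ [c ->].
by rewrite (_ : `]c, +oo[%classic = [set r | c < r])// set_itvE.
Qed.

Lemma sigma_algebra_comap {S U : Type} (f : S -> U) (G : set (set S)) :
  sigma_algebra setT G -> sigma_algebra setT [set B | G (f @^-1` B)].
Proof.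
case=> G0 GC GU; split => /=.
- by rewrite preimage_set0.
- by move=> B GB; rewrite setTD preimage_setC -setTD; exact: GC.
- by move=> B GB; rewrite preimage_bigcup; exact: GU.
Qed.

Lemma tuple_sigma_ind (m : nat) (G : set (set (m.-tuple R))) :
  sigma_algebra setT G ->
  (forall i (c : R), G [set t | c < tnth t i]) -> measurable `<=` G.
Proof.
move=> sG Gc; apply: smallest_sub => //.
move=> A; rewrite -bigcup_seq => -[i _] [B mB <-]; rewrite setTI.
have := @real_sigma_ind [set B | G ((fun t : m.-tuple R => tnth t i) @^-1` B)].
apply => //; first exact: (sigma_algebra_comap _ sG).
by move=> c; exact: Gc.
Qed.

End generators.

Lemma Pr_bigsetU_le {disp} {T : measurableType disp} {R : realType}
    (P : probability T R) (D : nat -> set T) (N : nat) :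
  (forall n, measurable (D n)) ->
  Pr P (\big[setU/set0]_(n < N) D n) <= \sum_(n < N) Pr P (D n).
Proof.
move=> mD; elim: N => [|N ih]; first by rewrite !big_ord0 /Pr measure0.
rewrite !big_ord_recr /=; apply: le_trans (PrU_le _ _ _) _ => //.
  exact: bigsetU_measurable.
by rewrite lerD2r.
Qed.

Section asymptotically_equal.
Context {I : Type} {R : realType} (F : set_system I) {FF : Filter F}.
Context {d1 d2} {T : measurableType d1} {S : measurableType d2}.
Variables (P : I -> probability T R) (Y Z : T -> S) (rho : probability S R).
Hypotheses (mY : measurable_fun setT Y) (mZ : measurable_fun setT Z).
Hypotheses (lY : forall i, same_law rho id (P i) Y)
  (lZ : forall i, same_law rho id (P i) Z).

(* As [Y] and [Z] have the same law, P(Y in B, Z notin B) and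
   P(Z in B, Y notin B) coincide, so one of them is enough. *)
Definition asymp_agree (B : set S) : Prop :=
  measurable B /\
  limsup_le F (fun i => Pr (P i) (Y @^-1` B `\` Z @^-1` B)) (fun=> 0).

Let mYB B : measurable B -> measurable (Y @^-1` B).
Proof. exact: measurable_preimage. Qed.

Let mZB B : measurable B -> measurable (Z @^-1` B).
Proof. exact: measurable_preimage. Qed.

Lemma asymp_agreeC_Pr (B : set S) i : measurable B ->
  Pr (P i) (Z @^-1` B `\` Y @^-1` B) = Pr (P i) (Y @^-1` B `\` Z @^-1` B).
Proof.
move=> mB; have := PrD (P i) (mYB mB) (mZB mB).
have := PrD (P i) (mZB mB) (mYB mB).
rewrite -(same_law_Pr (lY i))// -(same_law_Pr (lZ i))// setIC => -> /addrI.
by move=> ->.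
Qed.

Lemma asymp_agree_sym B : asymp_agree B ->
  limsup_le F (fun i => Pr (P i) (Z @^-1` B `\` Y @^-1` B)) (fun=> 0).
Proof.
by case=> mB h; apply: eq_limsup_le h => // i; rewrite asymp_agreeC_Pr.
Qed.

(** Complements exchange the two differences, which have equal probability. For a countable union,
    the part outside the first N sets has small [rho]-mass, hence small mass under [Y] uniformly in
    [i] because the law of [Y] is fixed; the first N sets contribute a finite sum. *)
Lemma asymp_agree_sigma_algebra : sigma_algebra setT asymp_agree.
Proof.
split.
- split; first exact: measurable0.
  by apply: limsup_leW => i; rewrite preimage_set0 set0D /Pr measure0.
- move=> B [mB h]; rewrite setTD; split; first exact: measurableC.
  apply: eq_limsup_le h => // i; rewrite -[RHS](asymp_agreeC_Pr i mB).
  congr (Pr (P i) _); apply/seteqP; split => w /= [] yB zB; split => //.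
  exact: contrapT.
- move=> B h; have mB n : measurable (B n) by case: (h n).
  have mU : measurable (\bigcup_k B k) by exact: bigcup_measurable.
  split=> // e e0; have e2 : 0 < e / 2 by rewrite divr_gt0.
  pose U N := \big[setU/set0]_(k < N) B k.
  have mUN N : measurable (U N) by exact: bigsetU_measurable.
  have [N hN] : exists N, Pr rho (\bigcup_k B k) <= Pr rho (U N) + e / 2.
    have := nondecreasing_cvg_mu (mu := rho) mUN.
    have -> : \bigcup_n U n = \bigcup_k B k.
      apply/seteqP; split => s [n _].
        by rewrite /U -bigcup_mkord => -[k _ Bk]; exists k.
      by move=> Bn; exists n.+1 => //; rewrite /U -bigcup_mkord; exists n => /=.
    move=> /(_ mU) H.
    have ndU : nondecreasing_seq U.
      by move=> m n mn; apply/subsetPset; exact: subset_bigsetU.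
    have := H ndU; rewrite [X in _ --> X]PrE// => /fine_cvg /= Ucvg.
    have /cvg_limsup_ge/(_ _ e2) := Ucvg.
    exact: filter_ex.
  pose D n := Y @^-1` (B n) `\` Z @^-1` (B n).
  have hs : limsup_le F (fun i => \sum_(n < N) Pr (P i) (D n))
      (fun=> \sum_(n < N) 0).
    by apply: limsup_le_sum => n; case: (h n).
  near=> i; rewrite add0r.
  have : \sum_(n < N) Pr (P i) (D n) <= \sum_(n < N) 0 + e / 2.
    by near: i; exact: hs.
  have mD n : measurable (D n) by apply: measurableD; [exact: mYB|exact: mZB].
  have mDN : measurable (Y @^-1` (\bigcup_k B k `\` U N)).
    by apply: mYB; exact: measurableD.
  have mDU : measurable (\big[setU/set0]_(n < N) D n).
    exact: bigsetU_measurable.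
  have : Pr (P i) (Y @^-1` (\bigcup_k B k) `\` Z @^-1` (\bigcup_k B k)) <=
      Pr (P i) (Y @^-1` (\bigcup_k B k `\` U N) `|` \big[setU/set0]_(n < N) D n).
    apply: Pr_le.
    - by apply: measurableD; [exact: mYB|exact: mZB].
    - exact: measurableU.
    - move=> w /= [Yw Zw]; have [YU|YU] := pselect (U N (Y w)); last by left.
      right; move: YU; rewrite /U -!bigcup_mkord => -[n /= nN Bn].
      by exists n => //; split => // ZB; apply: Zw; exists n.
  have : Pr (P i) (\big[setU/set0]_(n < N) D n) <= \sum_(n < N) Pr (P i) (D n).
    exact: Pr_bigsetU_le.
  have -> : \sum_(n < N) (0 : R) = 0 by rewrite big1.
  have := PrU_le (P i) mDN mDU.
  rewrite -(same_law_Pr (lY i))//; last exact: measurableD.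
  rewrite preimage_id.
  have := PrD rho mU (mUN N); rewrite setIidr; last first.
    by move=> x; rewrite /U -bigcup_mkord => -[n _ Bn]; exists n.
  lra.
Unshelve. all: by end_near. Qed.

(** The second moments of h(Y) and h(Z) are fixed, so it is enough that E[h(Y) h(Z)] is
    asymptotically at least E[h^2]. The comparison is with [h] coupled to itself, whose joint tail
    at (c, c') is the tail at [Num.max c c']; there [Y] and [Z] asymptotically agree. *)
Lemma asymp_agree_E_sqr (h : S -> R) : L2 rho h ->
  (forall c, asymp_agree [set s | c < h s]) ->
  limsup_le F (fun i => E (P i) (fun w => (h (Y w) - h (Z w)) ^+ 2)) (fun=> 0).
Proof.
move=> h2 hc; have mh := L2_measurable h2.
have hY i : same_law rho h (P i) (h \o Y).
  by move=> B mB; exact: (lY i (measurable_preimage mh mB)).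
have hZ i : same_law rho h (P i) (h \o Z).
  by move=> B mB; exact: (lZ i (measurable_preimage mh mB)).
have key : limsup_le F (fun=> E rho (fun s => h s * h s))
    (fun i => E (P i) (fun w => h (Y w) * h (Z w))).
  apply: (limsup_le_mixed_moment (P := fun=> rho) (Q1 := rho) (A := h)
    (Q2 := rho) (B := h)) => //; try exact: measurableT_comp.
  move=> c c'; pose m := Num.max c c'.
  have [mm hm] := hc m.
  suff H i : Pr rho [set x | c < h x /\ c' < h x] <=
      Pr (P i) [set x | c < (h \o Y) x /\ c' < (h \o Z) x] +
      Pr (P i) (Y @^-1` [set s | m < h s] `\` Z @^-1` [set s | m < h s]).
    move=> e e0; near=> i; apply: (le_trans (H i)).
    by rewrite lerD2l; near: i; have := hm _ e0; under eq_near do rewrite add0r.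
  have -> : [set x | c < h x /\ c' < h x] = [set s | m < h s].
    by apply/seteqP; split => s; rewrite /= gt_max => /andP.
  rewrite (_ : Pr rho _ = Pr (P i) (Y @^-1` [set s | m < h s])); last first.
    by rewrite -(same_law_Pr (lY i)).
  rewrite (PrD (P i) (mYB mm) (mZB mm)) lerD2r; apply: Pr_le.
  - by apply: measurableI; [exact: mYB|exact: mZB].
  - by apply: measurableI; apply: measurable_gtc_set; exact: measurableT_comp.
  - by move=> w /= []; rewrite !gt_max => /andP[? ?] /andP[? ?].
have L2Y i : L2 (P i) (h \o Y).
  exact: (same_law_L2 (h := id) mh (measurableT_comp mh mY) (hY i)).
have L2Z i : L2 (P i) (h \o Z).
  exact: (same_law_L2 (h := id) mh (measurableT_comp mh mZ) (hZ i)).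
have EY i : E (P i) (fun w => h (Y w) ^+ 2) = E rho (fun s => h s ^+ 2).
  case: h2 => _ h2.
  by rewrite (same_law_E (h := fun r => r ^+ 2) mh (measurableT_comp mh mY) (hY i)).
have EZ' i : E (P i) (fun w => h (Z w) ^+ 2) = E rho (fun s => h s ^+ 2).
  case: h2 => _ h2.
  by rewrite (same_law_E (h := fun r => r ^+ 2) mh (measurableT_comp mh mZ) (hZ i)).
move=> e e0; have e2 : 0 < e / 2 by rewrite divr_gt0.
near=> i.
have : E rho (fun s => h s * h s) <= E (P i) (fun w => h (Y w) * h (Z w)) + e / 2.
  by near: i; exact: key.
have /= -> := E_sqrB (L2Y i) (L2Z i); rewrite EY EZ'.
under [in E rho (fun s => h s * h s)]eq_fun do rewrite -expr2.
lra.
Unshelve. all: by end_near. Qed.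

Lemma asymp_agree_E_abs (h : S -> R) : L2 rho h ->
  (forall c, asymp_agree [set s | c < h s]) ->
  limsup_le F (fun i => E (P i) (fun w => `|h (Y w) - h (Z w)|)) (fun=> 0).
Proof.
move=> h2 hc; have H := asymp_agree_E_sqr h2 hc.
have mh := L2_measurable h2.
(* In [E_mul_le] with first factor 1, this [k] and the threshold [e ^+ 2 / 4] make both terms equal
   to e / 2. *)
move=> e e0; pose k := 2 / e; have k0 : 0 < k by rewrite divr_gt0.
have e' : 0 < e ^+ 2 / 4 by rewrite divr_gt0// exprn_gt0.
near=> i.
have L2Y : L2 (P i) (h \o Y).
  by apply: (same_law_L2 (X1 := id) _ mY (lY i)) => //; exact: measurable_id.
have L2Z : L2 (P i) (h \o Z).
  by apply: (same_law_L2 (X1 := id) _ mZ (lZ i)) => //; exact: measurable_id.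
have := E_mul_le k0 (L2cst (P i) 1) (L2B L2Y L2Z).
under [X in E _ X <= _]eq_fun do rewrite mul1r /=.
move=> /le_trans; apply.
under [X in _ * E _ X + _ <= _]eq_fun do rewrite expr1n.
rewrite Ecst mulr1 add0r.
have H' : E (P i) (fun w => (h (Y w) - h (Z w)) ^+ 2) <= 0 + e ^+ 2 / 4.
  by near: i; exact: H.
rewrite add0r -(ler_pM2l k0) in H'.
apply: (le_trans (lerD (lexx _) H')); rewrite /k invf_div.
rewrite le_eqVlt; apply/orP; left; apply/eqP; field.
by rewrite gt_eqF.
Unshelve. all: by end_near. Qed.

End asymptotically_equal.

(** * Null sets and laws of pairs *)

Section null_sets.
Context {disp} {T : measurableType disp} {R : realType}.
Variable P : probability T R.

Lemma ae_eq_E (N : set T) (f g : T -> R) : measurable N -> P N = 0%E ->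
  measurable_fun setT f -> measurable_fun setT g ->
  (forall x, ~ N x -> f x = g x) -> E P f = E P g.
Proof.
move=> mN N0 mf mg fg; rewrite /E /Rintegral; congr fine.
apply: ae_eq_integral => //; try exact/measurable_EFinP.
exists N; split => // x /= /not_implyP[_ fgx]; apply: contrapT => Nx.
by apply: fgx; rewrite fg.
Qed.

Lemma ae_le_E (N : set T) (f g : T -> R) : measurable N -> P N = 0%E ->
  L1 P f -> L1 P g -> (forall x, ~ N x -> f x <= g x) -> E P f <= E P g.
Proof.
move=> mN N0 f1 g1 fg; have mf := L1_measurable f1; have mg := L1_measurable g1.
have mm : measurable_fun setT (fun x => Num.min (f x) (g x)).
  exact: measurable_minr.
have m1 : L1 P (fun x => Num.min (f x) (g x)).
  apply: (L1_le mm (L1D (L1_abs f1) (L1_abs g1))) => x.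
  by rewrite minEle; case: ifPn => _; rewrite ?lerDl ?lerDr.
rewrite (@ae_eq_E N _ (fun x => Num.min (f x) (g x)))//; last first.
  by move=> x Nx; rewrite min_l// fg.
by apply: Ele => // x; rewrite ge_min lexx orbT.
Qed.

Lemma Pr_ae_eq (N A B : set T) : measurable N -> P N = 0%E ->
  measurable A -> measurable B -> (forall x, ~ N x -> A x <-> B x) ->
  Pr P A = Pr P B.
Proof.
move=> mN N0 mA mB AB; rewrite -!E_indic//.
apply: (ae_eq_E mN) => //; try exact: measurable_indic.
move=> x /AB ABx; rewrite !indicE; congr (nat_of_bool _)%:R.
by apply/idP/idP => /set_mem/ABx/mem_set.
Qed.

End null_sets.

Section product_laws.
Context {d1 d2 d3 d4} {T1 : measurableType d1} {T2 : measurableType d2}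
  {S : measurableType d3} {S' : measurableType d4} {R : realType}.
Variables (P1 : probability T1 R) (P2 : probability T2 R).

Lemma same_law_pair (X1 : T1 -> S) (Y1 : T1 -> S') (X2 : T2 -> S) (Y2 : T2 -> S') :
  measurable_fun setT X1 -> measurable_fun setT Y1 ->
  measurable_fun setT X2 -> measurable_fun setT Y2 ->
  (forall A B, measurable A -> measurable B ->
     P1 (X1 @^-1` A `&` Y1 @^-1` B) = P2 (X2 @^-1` A `&` Y2 @^-1` B)) ->
  same_law P1 (fun x => (X1 x, Y1 x)) P2 (fun x => (X2 x, Y2 x)).
Proof.
move=> mX1 mY1 mX2 mY2 h.
have mZ1 : measurable_fun setT (fun x => (X1 x, Y1 x)).
  exact: measurable_fun_pair.
have mZ2 : measurable_fun setT (fun x => (X2 x, Y2 x)).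
  exact: measurable_fun_pair.
move=> C; rewrite [measurable]measurable_prod_measurableType; move: C.
apply: dynkin_induction.
- exact: measurable_prod_measurableType.
- move=> _ _ [A1 mA1 [B1 mB1 <-]] [A2 mA2 [B2 mB2 <-]].
  exists (A1 `&` A2); first exact: measurableI.
  by exists (B1 `&` B2); [exact: measurableI|rewrite setXI].
- by rewrite [LHS]probability_setT [RHS]probability_setT.
- by move=> _ [A mA [B mB <-]]; exact: h.
- move=> C mC hC.
  rewrite [LHS](probability_setC P1 (measurable_preimage mZ1 mC)).
  by rewrite [RHS](probability_setC P2 (measurable_preimage mZ2 mC)) hC.
- move=> G mG tG hG.
  rewrite [LHS](measure_bigcup P1 setT (fun n => _ @^-1` (G n))).
  + rewrite [RHS](measure_bigcup P2 setT (fun n => _ @^-1` (G n))).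
    * by apply: eq_eseriesr => n _; exact: hG.
    * by move=> n _; exact: measurable_preimage.
    * by move=> i j _ _ [x [Gi Gj]]; apply: tG => //; exists (X2 x, Y2 x).
  + by move=> n _; exact: measurable_preimage.
  + by move=> i j _ _ [x [Gi Gj]]; apply: tG => //; exists (X1 x, Y1 x).
Qed.

(** Dynkin induction on [B] with the events [A1] and [A2] carried along; since these need not have
    probability 1, the case of the whole line is a hypothesis of its own. *)
Lemma ray_law (A1 : set T1) (A2 : set T2) (Y1 : T1 -> R) (Y2 : T2 -> R) :
  measurable A1 -> measurable A2 ->
  measurable_fun setT Y1 -> measurable_fun setT Y2 ->
  P1 A1 = P2 A2 ->
  (forall c, P1 (A1 `&` [set x | c < Y1 x]) = P2 (A2 `&` [set x | c < Y2 x])) ->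
  forall B, measurable B -> P1 (A1 `&` Y1 @^-1` B) = P2 (A2 `&` Y2 @^-1` B).
Proof.
move=> mA1 mA2 mY1 mY2 hA h B; rewrite [measurable](RGenOInfty.measurableE R).
move: B; apply: dynkin_induction.
- exact: RGenOInfty.measurableE.
- move=> _ _ [a ->] [b ->]; exists (Num.max a b).
  by apply/seteqP; split => x /=; rewrite !in_itv/= !andbT gt_max => /andP.
- by rewrite [_ `&` _]setIT [A2 `&` _]setIT.
- move=> _ [c ->]; have -> : `]c, +oo[%classic = [set r | c < r].
    by rewrite set_itvE.
  exact: h.
- move=> C mC hC; change (P1 (A1 `\` Y1 @^-1` C) = P2 (A2 `\` Y2 @^-1` C)).
  rewrite measureD//; [|exact: measurable_preimage|].
    rewrite [RHS]measureD//; [by congr (_ - _)%E|exact: measurable_preimage|].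
    by rewrite ltey_eq fin_num_measure.
  by rewrite ltey_eq fin_num_measure.
- move=> G mG tG hG.
  have -> : A1 `&` Y1 @^-1` (\bigcup_k G k) = \bigcup_k (A1 `&` Y1 @^-1` G k).
    by rewrite preimage_bigcup setI_bigcupr.
  have -> : A2 `&` Y2 @^-1` (\bigcup_k G k) = \bigcup_k (A2 `&` Y2 @^-1` G k).
    by rewrite preimage_bigcup setI_bigcupr.
  rewrite measure_bigcup; first rewrite [RHS]measure_bigcup.
  + by apply: eq_eseriesr => n _; exact: hG.
  + by move=> n _; apply: measurableI => //; exact: measurable_preimage.
  + by move=> i j _ _ [x [[_ Gi] [_ Gj]]]; apply: tG => //; exists (Y2 x).
  + by move=> n _; apply: measurableI => //; exact: measurable_preimage.
  + by move=> i j _ _ [x [[_ Gi] [_ Gj]]]; apply: tG => //; exists (Y1 x).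
Qed.

End product_laws.

(** * Disintegrations *)

Section kernel_probability.
Context {d1 d2} {X : measurableType d1} {Y : measurableType d2} {R : realType}.
Variable k : R.-pker X ~> Y.

(** The value of the kernel at [x] seen as a [probability], so that [Pr] applies to it. *)
Definition kprob (x : X) : set Y -> \bar R := k x.

HB.instance Definition _ x := Measure.on (kprob x).

Let kprob_setT x : kprob x setT = 1%E.
Proof. exact: prob_kernel. Qed.

HB.instance Definition _ x :=
  Measure_isProbability.Build _ _ _ (kprob x) (kprob_setT x).

Lemma measurable_kprob_xsection (C : set (X * Y)) : measurable C ->
  measurable_fun setT (fun x => kprob x (xsection C x)).
Proof.
by move=> mC; apply: (@measurable_fun_xsection_finite_kernel _ _ X Y R k);
  rewrite inE.
Qed.

Lemma measurable_Pr_xsection (C : set (X * Y)) : measurable C ->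
  measurable_fun setT (fun x => Pr (kprob x) (xsection C x)).
Proof.
move=> mC; apply: (measurableT_comp (fine_measurable measurableT)).
exact: measurable_kprob_xsection.
Qed.

Lemma measurable_Pr_kprob (B : set Y) : measurable B ->
  measurable_fun setT (fun x => Pr (kprob x) B).
Proof.
move=> mB; have := measurable_Pr_xsection (measurableX measurableT mB).
by congr measurable_fun; apply/funext => x; rewrite in_xsectionX// inE.
Qed.

Lemma Pr_kprob_bound (x : X) (B : set Y) : measurable B ->
  `|Pr (kprob x) B| <= 1.
Proof. by move=> mB; rewrite ger0_norm ?Pr_ge0// Pr_le1. Qed.

End kernel_probability.

Section coordinates.
Context {R : realType}.

Lemma rcoord_tnth (d m : nat) (md : (m < d)%N) (x : d.-tuple R) :
  rcoord m x = tnth x (rev_ord (Ordinal md)).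
Proof.
rewrite /rcoord nth_rev size_tuple//.
by rewrite (tnth_nth 0)/=.
Qed.

Lemma rcoord_rev_ord (d : nat) (i : 'I_d) (x : d.-tuple R) :
  rcoord (rev_ord i) x = tnth x i.
Proof.
rewrite (rcoord_tnth (ltn_ord (rev_ord i))); congr tnth.
by rewrite -[RHS](rev_ordK i); congr rev_ord; apply/val_inj.
Qed.

Lemma measurable_nth (m n : nat) :
  measurable_fun setT (fun t : m.-tuple R => nth 0 t n).
Proof.
have [nm|mn] := ltnP n m.
  under eq_fun do rewrite -(tnth_nth 0 _ (Ordinal nm)).
  exact: measurable_tnth.
rewrite (_ : (fun t => _) = cst 0); first exact: measurable_cst.
by apply/funext => t; rewrite nth_default ?size_tuple.
Qed.

Lemma measurable_rcoord (d m : nat) : measurable_fun setT (@rcoord R d m).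
Proof.
rewrite /rcoord; have [md|dm] := ltnP m d.
  rewrite (_ : (fun x => _) = (fun x : d.-tuple R => nth 0 x (d - m.+1))).
    exact: measurable_nth.
  by apply/funext => x; rewrite nth_rev size_tuple.
rewrite (_ : (fun x => _) = cst 0); first exact: measurable_cst.
by apply/funext => t; rewrite nth_default ?size_rev ?size_tuple.
Qed.

Lemma tnth_rcoords (d m : nat) (x : d.-tuple R) (i : 'I_m) :
  tnth (rcoords m x) i = rcoord i x.
Proof. by rewrite tnth_mktuple. Qed.

Lemma measurable_rcoords (d m : nat) : measurable_fun setT (@rcoords R d m).
Proof.
apply/measurable_fun_tnthP => i.
rewrite (_ : _ \o _ = @rcoord R d i); first exact: measurable_rcoord.
by apply/funext => x /=; rewrite tnth_rcoords.
Qed.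

Definition trunc (m n : nat) (t : m.-tuple R) : n.-tuple R :=
  [tuple nth 0 t j | j < n].

Lemma measurable_trunc (m n : nat) : measurable_fun setT (@trunc m n).
Proof.
apply/measurable_fun_tnthP => i.
rewrite (_ : _ \o _ = fun t : m.-tuple R => nth 0 t i).
  exact: measurable_nth.
by apply/funext => x /=; rewrite tnth_mktuple.
Qed.

Lemma nth_rcoords (d m n : nat) (x : d.-tuple R) : (n < m)%N ->
  nth 0 (rcoords m x) n = rcoord n x.
Proof.
by move=> nm; rewrite -[LHS](tnth_nth 0 _ (Ordinal nm)) tnth_rcoords.
Qed.

Lemma trunc_rcoords (d m n : nat) (x : d.-tuple R) : (n <= m)%N ->
  trunc n (rcoords m x) = rcoords n x.
Proof.
move=> nm; apply: eq_from_tnth => j; rewrite tnth_mktuple tnth_rcoords.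
by rewrite nth_rcoords// (leq_trans _ nm).
Qed.

Definition snoc (m : nat) (p : m.-tuple R * R) : m.+1.-tuple R :=
  [tuple of rcons p.1 p.2].

Lemma nth_snoc (m n : nat) (p : m.-tuple R * R) :
  nth 0 (snoc p) n = if (n < m)%N then nth 0 p.1 n else
                     if n == m then p.2 else 0.
Proof. by rewrite nth_rcons size_tuple. Qed.

Lemma measurable_snoc (m : nat) : measurable_fun setT (@snoc m).
Proof.
apply/measurable_fun_tnthP => i.
have [im|mi] := ltnP i m.
  rewrite (_ : _ \o _ = (fun t : m.-tuple R => nth 0 t i) \o fst).
    by apply: measurableT_comp; [exact: measurable_nth|exact: measurable_fst].
  by apply/funext => p /=; rewrite (tnth_nth 0) nth_snoc im.
rewrite (_ : _ \o _ = snd); first exact: measurable_snd.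
apply/funext => p /=; rewrite (tnth_nth 0) nth_snoc ltnNge mi/=.
by rewrite eqn_leq mi -ltnS ltn_ord.
Qed.

Definition rpair (d m : nat) (x : d.-tuple R) : m.-tuple R * R :=
  (rcoords m x, rcoord m x).

Lemma measurable_rpair (d m : nat) : measurable_fun setT (@rpair d m).
Proof.
apply: measurable_fun_pair; first exact: measurable_rcoords.
exact: measurable_rcoord.
Qed.

Lemma snoc_rpair (d m : nat) (x : d.-tuple R) :
  snoc (rpair m x) = rcoords m.+1 x.
Proof.
apply: eq_from_tnth => i; rewrite tnth_rcoords (tnth_nth 0) nth_snoc.
case: ltnP => [im|mi]; first by rewrite nth_rcoords.
have -> : i = m :> nat by apply/eqP; rewrite eqn_leq mi -ltnS ltn_ord.
by rewrite eqxx.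
Qed.

(** A right inverse of [rcoords m] for m <= d, the lower coordinates being filled with the default
    0. Composition with it turns measurability in the whole vector into measurability in the upper
    coordinates. *)
Definition pad (d m : nat) (t : m.-tuple R) : d.-tuple R :=
  [tuple of rev [tuple nth 0 t i | i < d]].

Lemma rcoord_pad (d m n : nat) (t : m.-tuple R) : (n < d)%N ->
  rcoord n (pad d t) = nth 0 t n.
Proof.
move=> nd; rewrite /rcoord /pad /= revK.
transitivity (tnth [tuple nth 0 t i | i < d] (Ordinal nd)).
  by rewrite (tnth_nth 0).
by rewrite tnth_mktuple.
Qed.

Lemma rcoords_pad (d m n : nat) (t : m.-tuple R) : (n <= d)%N ->
  rcoords n (pad d t) = trunc n t.
Proof.
move=> nd; apply: eq_from_tnth => i; rewrite tnth_rcoords tnth_mktuple.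
by rewrite rcoord_pad// (leq_trans _ nd).
Qed.

Lemma trunc_id (m : nat) (t : m.-tuple R) : trunc m t = t.
Proof. by apply: eq_from_tnth => i; rewrite tnth_mktuple -tnth_nth. Qed.

Lemma pad_rcoords (d : nat) (x : d.-tuple R) : pad d (rcoords d x) = x.
Proof.
apply: eq_from_tnth => i; rewrite -2!rcoord_rev_ord.
by rewrite rcoord_pad// nth_rcoords.
Qed.

Lemma measurable_pad (d m : nat) : measurable_fun setT (@pad d m).
Proof.
apply/measurable_fun_tnthP => i.
rewrite (_ : _ \o _ = fun t : m.-tuple R => nth 0 t (rev_ord i)).
  exact: measurable_nth.
by apply/funext => t /=; rewrite -rcoord_rev_ord rcoord_pad.
Qed.

End coordinates.

Section disintegration_theory.
Context {R : realType} (d : nat) (mu : probability (d.-tuple R) R).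
Variable kappa : forall m : nat, R.-pker (m.-tuple R) ~> R.
Hypothesis hmu : disintegration mu kappa.

Let mR := @measurable_rcoords R d.

Lemma measurable_cond_xsection (m : nat) (C : set (m.-tuple R * R)) :
  measurable C ->
  measurable_fun setT (fun x : d.-tuple R =>
    kprob (kappa m) (rcoords m x) (xsection C (rcoords m x))).
Proof.
move=> mC.
exact: (measurableT_comp (measurable_kprob_xsection (kappa m) mC) (@mR m)).
Qed.

(** The definition of [disintegration] speaks of rectangles; a Dynkin induction extends it to all
    measurable sets of pairs, such as those defined by a condition on [U m t r]. *)
Lemma disintegration_set (m : nat) (md : (m < d)%N)
    (C : set (m.-tuple R * R)) : measurable C ->
  mu (@rpair R d m @^-1` C) =
  (\int[mu]_x kprob (kappa m) (rcoords m x) (xsection C (rcoords m x)))%E.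
Proof.
have mZ := @measurable_rpair R d m.
rewrite [measurable]measurable_prod_measurableType; move: C.
apply: dynkin_induction.
- exact: measurable_prod_measurableType.
- move=> _ _ [A1 mA1 [B1 mB1 <-]] [A2 mA2 [B2 mB2 <-]].
  exists (A1 `&` A2); first exact: measurableI.
  by exists (B1 `&` B2); [exact: measurableI|rewrite setXI].
- rewrite probability_setT; under eq_integral do rewrite -setXTT in_xsectionX ?inE// probability_setT.
  rewrite integral_cst// mul1e; exact/esym/probability_setT.
- move=> _ [A mA [B mB <-]]; rewrite [LHS](hmu md mA mB) integral_mkcond.
  apply: eq_integral => x _; rewrite patchE.
  case: ifPn => [/set_mem xA|/negP xA].
    by rewrite in_xsectionX// inE.
  by rewrite notin_xsectionX ?measure0//; apply/negP => /set_mem xA'; apply: xA; exact/mem_set.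
- move=> C mC hC.
  rewrite [LHS](probability_setC mu (measurable_preimage mZ mC)).
  have h : (\int[mu]_x kprob (kappa m) (rcoords m x) (xsection C (rcoords m x)) +
      \int[mu]_x kprob (kappa m) (rcoords m x) (xsection (~` C) (rcoords m x)) = 1)%E.
    rewrite -ge0_integralD//; last 2 first.
    - exact: measurable_cond_xsection.
    - by apply: measurable_cond_xsection; exact: measurableC.
    transitivity (\int[mu]_x (cst 1%E) x)%E.
      apply: eq_integral => x _.
      have -> : xsection (~` C) (rcoords m x) = ~` xsection C (rcoords m x).
        by apply/seteqP; split => r /=; rewrite !xsectionE.
      have mx : measurable (xsection C (rcoords m x)) by exact: measurable_xsection.
      by rewrite probability_setC// addeC subeK// fin_num_measure.
    rewrite integral_cst// mul1e; exact: probability_setT.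
  rewrite -h hC addeC addeK//.
  by rewrite -hC fin_num_measure//; exact: measurable_preimage.
- move=> G mG tG hG.
  rewrite [LHS](measure_bigcup mu setT (fun n => _ @^-1` (G n))).
  + under [RHS]eq_integral do rewrite xsection_bigcup.
    have -> : (\int[mu]_x kprob (kappa m) (rcoords m x) (\bigcup_k xsection (G k) (rcoords m x)) =
        \int[mu]_x (\sum_(k <oo) kprob (kappa m) (rcoords m x) (xsection (G k) (rcoords m x))))%E.
      apply: eq_integral => x _; rewrite measure_bigcup.
      * by apply: eq_eseriesl => n; rewrite in_setT.
      * by move=> n _; exact: measurable_xsection.
      * exact: trivIset_xsection.
    rewrite integral_nneseries//.
    * by rewrite (eq_eseriesl (Q := xpredT)) => [|n]; [apply: eq_eseriesr => n _; exact: hG|rewrite in_setT].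
    * by move=> n; exact: measurable_cond_xsection.
  + by move=> n _; exact: measurable_preimage.
  + by move=> i j _ _ [x [Gi Gj]]; apply: tG => //; exists (rpair m x).
Qed.

Lemma disintegration_Pr (m : nat) (md : (m < d)%N)
    (C : set (m.-tuple R * R)) : measurable C ->
  Pr mu (@rpair R d m @^-1` C) =
  E mu (fun x => Pr (kprob (kappa m) (rcoords m x)) (xsection C (rcoords m x))).
Proof.
move=> mC; rewrite /Pr disintegration_set// /E /Rintegral; congr fine.
apply: eq_integral => x _; rewrite fineK// fin_num_measure//.
exact: measurable_xsection.
Qed.

Lemma disintegration_null (m : nat) (md : (m < d)%N) (N : set (d.-tuple R))
    (C : set (m.-tuple R * R)) :
  measurable N -> mu N = 0%E -> measurable C ->
  (forall x, ~ N x -> kprob (kappa m) (rcoords m x) (xsection C (rcoords m x)) = 0%E) ->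
  mu (@rpair R d m @^-1` C) = 0%E.
Proof.
move=> mN N0 mC h; rewrite disintegration_set//.
rewrite (ae_eq_integral (cst 0%E)) ?integral0//.
- exact: measurable_cond_xsection.
- exists N; split => // x /= /not_implyP[_ hx]; apply: contrapT => Nx.
  by apply: hx; rewrite h.
Qed.

Lemma ae_iterated_sub (m : nat) (P Q : m.-tuple R -> Prop) :
  (forall t, P t -> Q t) -> ae_iterated kappa P -> ae_iterated kappa Q.
Proof.
elim: m P Q => [|m ih] P Q PQ /=; first exact: PQ.
apply: ih => t; apply: filterS => s; exact: PQ.
Qed.

(** Fubini for null sets, one coordinate at a time: the set of prefixes whose fibre has positive
    mass is measurable, and null by induction. This turns the nested almost-everywhere quantifiers
    into one [mu]-null set. *)
Lemma ae_iterated_null (m : nat) (N : set (m.-tuple R)) : (m <= d)%N ->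
  measurable N -> ae_iterated kappa (fun t => ~ N t) ->
  mu (@rcoords R d m @^-1` N) = 0%E.
Proof.
elim: m N => [|m ih] N md mN /= hN.
  rewrite (_ : _ @^-1` _ = set0) ?measure0//.
  by apply/seteqP; split => // x /= Nx; apply: hN; rewrite [X in N X]tuple0 -(tuple0 (rcoords 0 x)).
pose C := @snoc R m @^-1` N.
have mC : measurable C by exact: measurable_preimage (@measurable_snoc R m) mN.
pose N' := [set t | kprob (kappa m) t (xsection C t) != 0%E].
have mN' : measurable N'.
  rewrite (_ : N' = (fun t => kprob (kappa m) t (xsection C t)) @^-1` (~` [set 0%E])).
    apply: measurable_preimage; first exact: measurable_kprob_xsection.
    exact/measurableC/emeasurable_set1.
  by apply/seteqP; split => t /= /eqP.
have N'0 : mu (@rcoords R d m @^-1` N') = 0%E.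
  apply: ih => //; first exact: ltnW.
  apply: ae_iterated_sub hN => t [A [mA A0 sA]] /eqP; apply.
  apply: subset_measure0 A0 => //; first exact: measurable_xsection.
  by move=> s; rewrite xsectionE /= => Cs; apply: sA => /= /(_ Cs).
rewrite (_ : _ @^-1` N = @rpair R d m @^-1` C); last first.
  by apply/seteqP; split => x /=; rewrite /C /= snoc_rpair.
apply: (disintegration_null md _ N'0) => //.
  exact: measurable_preimage (@mR m) mN'.
by move=> x /negP; rewrite negbK => /eqP.
Qed.

End disintegration_theory.

(** * Measurability of the absence of atoms *)

Section no_atoms.
Context {disp} {X : measurableType disp} {R : realType}.
Variable k : R.-pker X ~> R.

(** A dummy real parameter is added to the kernel, so that sets such as [set s] or the ray up to s
    become sections at (x, s) of one measurable set, and their masses are jointly measurable in (x,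
    s). *)
Definition kfst (z : X * R) : {measure set R -> \bar R} := k z.1.

Let measurable_kfst U : measurable U -> measurable_fun setT (kfst ^~ U).
Proof.
move=> mU; apply: (measurableT_comp (measurable_kernel k U mU)).
exact: measurable_fst.
Qed.

HB.instance Definition _ := isKernel.Build _ _ _ _ _ kfst measurable_kfst.

Let kfst_setT z : kfst z setT = 1%E.
Proof. exact: prob_kernel. Qed.

HB.instance Definition _ := Kernel_isProbability.Build _ _ _ _ _ kfst kfst_setT.

Let diag := [set p : (X * R) * R | p.1.2 = p.2].

Let measurable_diag : measurable diag.
Proof.
rewrite (_ : diag = [set p | p.1.2 <= p.2] `&` [set p | p.2 <= p.1.2]).
  have m12 : measurable_fun setT (fun p : (X * R) * R => p.1.2).
    exact: (measurableT_comp measurable_snd measurable_fst).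
  have m2 : measurable_fun setT (fun p : (X * R) * R => p.2).
    exact: measurable_snd.
  by apply: measurableI; exact: measurable_le_set.
apply/seteqP; split => p /=; first by rewrite /diag /= => ->.
by move=> [p1 p2]; apply/eqP; rewrite eq_le p1.
Qed.

(** The sum of the squared masses of the atoms of [k x]: it vanishes exactly when there are none,
    and as an integral it depends measurably on [x]. *)
Let atom_mass (x : X) : \bar R := (\int[k x]_s k x [set s])%E.

Let measurable_atom_mass : measurable_fun setT atom_mass.
Proof.
pose g (z : X * R) := kfst z (xsection diag z).
have mg : measurable_fun setT g.
  by apply: measurable_fun_xsection_finite_kernel; rewrite inE.
rewrite (_ : atom_mass = fun x => (\int[k x]_s g (x, s))%E).
  by apply: measurable_fun_integral_finite_kernel => // z; rewrite /g.
apply/funext => x; apply: eq_integral => s _; rewrite /g /kfst/=.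
by congr (k x _); apply/seteqP; split => r /=; rewrite xsectionE /diag /= => ->.
Qed.

Lemma measurable_no_atoms : measurable [set x | no_atoms (k x)].
Proof.
rewrite (_ : [set x | _] = atom_mass @^-1` [set 0%E]).
  by apply: measurable_preimage => //; exact: emeasurable_set1.
apply/seteqP; split => x /= h.
  by rewrite /atom_mass; under eq_integral do rewrite h; rewrite integral0.
have mk : measurable_fun setT (fun s => k x [set s]).
  rewrite (_ : (fun _ => _) = (fun z => kfst z (xsection diag z)) \o (fun s => (x, s))).
    apply: measurableT_comp; last exact: pair1_measurable.
    by apply: measurable_fun_xsection_finite_kernel; rewrite inE.
  apply/funext => s /=; rewrite /kfst/=.
  by congr (k x _); apply/seteqP; split => r /=; rewrite xsectionE /diag /= => ->.
move=> s; apply/eqP/negPn/negP => ks0.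
have : (k x [set s] * k x [set s] <= atom_mass x)%E.
  rewrite /atom_mass -integral_cst//.
  apply: (@le_trans _ _ (\int[k x]_(r in [set s]) k x [set r])%E).
    apply: ge0_le_integral => //.
    - exact: measurable_funTS.
    - by move=> r ->.
  by apply: ge0_subset_integral.
rewrite h leNgt mule_gt0// lt_neqAle eq_sym ks0/=; exact: measure_ge0.
Qed.

End no_atoms.

Definition enum_rat {R : realType} (n : nat) : R :=
  ratr (odflt 0 (@choice.unpickle rat n)).

Lemma enum_rat_dense {R : realType} (a b : R) : a < b ->
  exists n, a < enum_rat n /\ enum_rat n < b.
Proof.
move=> /rat_in_itvoo[q]; rewrite in_itv/= => /andP[aq qb].
by exists (choice.pickle q); rewrite /enum_rat choice.pickleK.
Qed.

(** * Monotone transport on the line *)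

Section real_line.
Context {R : realType}.
Variable a : probability R R.

Lemma measurable_gt_ray (c : R) : measurable [set r | c < r].
Proof. by rewrite -set_itvE; exact: measurable_itv. Qed.

Lemma measurable_le_ray (c : R) : measurable [set r | r <= c].
Proof. by rewrite -set_itvE; exact: measurable_itv. Qed.

Definition upward_on (D A : set R) :=
  forall r s, D r -> D s -> r <= s -> A r -> A s.

(** Up-sets of a totally ordered set are nested, so on [D] one of the two contains the other. *)
Lemma Pr_upward_setI (D A B : set R) : measurable D -> a (~` D) = 0%E ->
  measurable A -> measurable B -> upward_on D A -> upward_on D B ->
  Pr a (A `&` B) = Num.min (Pr a A) (Pr a B).
Proof.
move=> mD D0 mA mB uA uB.
have sub A' B' : measurable A' -> measurable B' ->
    (forall r, D r -> A' r -> B' r) ->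
    Pr a (A' `&` B') = Num.min (Pr a A') (Pr a B').
  move=> mA' mB' AB.
  have h : Pr a (A' `&` B') = Pr a A'.
    apply: (Pr_ae_eq (measurableC mD) D0) => //; first exact: measurableI.
    move=> r /= /contrapT Dr; split=> [[]//|Ar]; split => //; exact: AB.
  rewrite h min_l// -h; by apply: Pr_le => //; exact: measurableI.
have [AB|] := pselect (forall r, D r -> A r -> B r); first exact: sub.
move=> /existsNP[r0 /not_implyP[Dr0 /not_implyP[Ar0 Br0]]].
rewrite setIC minC; apply: sub => // s Ds Bs; apply: (uA r0) => //.
by rewrite leNgt; apply/negP => /ltW sr0; apply: Br0; exact: (uB s).
Qed.

Let flat (c : R) := [set r | c < r /\ a `]c, r]%classic = 0%E].

(** [flat c] is the stretch to the right of [c] on which the distribution function stays constant.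
    If it has a greatest element r it lies in the null interval ]c, r]; otherwise it is covered by
    the countably many null intervals ]c, q] with q rational in [flat c]. *)
Lemma cdf_flat_null (c : R) (A : set R) : measurable A -> A `<=` flat c ->
  a A = 0%E.
Proof.
move=> mA Afl; have [[r [cr ar] rmax]|nomax] :=
    pselect (exists2 r, flat c r & forall s, flat c s -> s <= r).
  apply: subset_measure0 ar => // s /Afl cs /=; rewrite in_itv/=.
  by case: (cs) => -> _ /=; exact: rmax.
pose B n := if `[< flat c (enum_rat n) >] then `]c, enum_rat n]%classic else set0.
have mB n : measurable (B n) by rewrite /B; case: ifP => // _; exact: measurable_itv.
have B0 : a (\bigcup_n B n) = 0%E.
  apply/negligibleP; first exact: bigcup_measurable.
  apply: negligible_bigcup => n; apply/negligibleP => //.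
  by rewrite /B; case: asboolP => [[]//|]; rewrite measure0.
apply: subset_measure0 B0 => //; first exact: bigcup_measurable.
move=> r /Afl fr; have [s fs rs] : exists2 s, flat c s & r < s.
  apply: contrapT => h; apply: nomax; exists r => // s fs.
  by rewrite leNgt; apply/negP => rs; apply: h; exists s.
have [n [rn ns]] := enum_rat_dense rs.
have fn : flat c (enum_rat n).
  split; first by case: fr => cr _; exact: lt_trans rn.
  case: fs => _; apply: subset_measure0 => //; try exact: measurable_itv.
  by apply: subset_itv => //; rewrite bnd_simp ltW.
exists n => //; rewrite /B; case: asboolP => // _ /=.
by rewrite in_itv/= ltW// andbT; case: fr.
Qed.

Lemma PrD_Ioc (c r : R) : c <= r ->
  Pr a [set s | s <= r] = Pr a [set s | s <= c] + Pr a `]c, r]%classic.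
Proof.
move=> cr; rewrite (PrD a (measurable_le_ray r) (measurable_le_ray c)).
congr (_ + _); congr Pr; apply/seteqP; split => s /=.
- by move=> [].
- by move=> sc; split => //; exact: le_trans cr.
- by rewrite in_itv/= => -[sr /negP]; rewrite -ltNge => ->.
- by rewrite in_itv/= => /andP[cs sr]; split => //; apply/negP; rewrite -ltNge.
Qed.

(* If [f] pushes [a] to an atomless [b], then F_b(f(r)) = F_a(r) for a.e. r,
   so that [r > c] can be read off from [f r]. *)
Lemma monotone_transport_gt (b : probability R R) (f : R -> R) (c : R)
    (A : set R) : measurable_fun setT f -> monotone_transport a b f ->
  no_atoms b -> measurable A ->
  A `<=` [set r | ~ (c < r <->
     Pr a [set s | s <= c] < Pr b [set s | s <= f r])] -> a A = 0%E.
Proof.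
move=> mf [[D [mD D0 mono]] push] nob mA sA.
have fE r : Pr b [set s | s <= f r] = Pr a [set s | f s <= f r].
  by rewrite /Pr -push//; exact: measurable_le_ray.
have mle r : measurable [set s | f s <= f r].
  exact: (measurable_preimage mf (measurable_le_ray (f r))).
have AD : (A `\` D) `<=` ~` D by move=> r [].
have AD0 : a (A `\` D) = 0%E.
  by apply: subset_measure0 AD D0 => //; [exact: measurableD|exact: measurableC].
suff ID0 : a (A `&` D) = 0%E.
  apply/eqP; rewrite eq_le measure_ge0 andbT -(add0e 0%E) -[X in (_ <= X + _)%E]ID0.
  rewrite -[X in (_ <= _ + X)%E]AD0 -[X in (a X <= _)%E](setUIDK A D).
  by apply: measureU2; [exact: measurableI|exact: measurableD].
apply: (@cdf_flat_null c); first exact: measurableI.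
move=> r [/sA /= nr Dr].
(* If c < r, monotonicity gives F_a(r) <= F_b(f r), so the equivalence can fail only when F_a(r) =
   F_a(c), that is when [r] lies in [flat c]. *)
have [cr|rc] := ltP c r.
  split => //; apply/eqP; rewrite PrE; last exact: measurable_itv.
  rewrite eqe eq_le Pr_ge0 andbT leNgt; apply/negP => pos; apply: nr.
  split=> // _; rewrite fE.
  have : Pr a [set s | s <= r] <= Pr a [set s | f s <= f r].
    rewrite (Pr_ae_eq (B := [set s | s <= r] `&` D) (measurableC mD) D0).
    - apply: Pr_le => //; first by apply: measurableI => //; exact: measurable_le_ray.
      by move=> s [/= sr Ds]; exact: mono.
    - exact: measurable_le_ray.
    - by apply: measurableI => //; exact: measurable_le_ray.
    - by move=> s /= /contrapT Ds; split => [?|[]].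
  rewrite (PrD_Ioc (ltW cr)); lra.
(* If r <= c both sides are false. The level set [f s = f r] is null because [b] has no atoms;
   outside it and on [D], f s <= f r forces s <= c, whence F_b(f r) <= F_a(c). *)
exfalso; apply: nr; split => [|h]; first by rewrite ltNge rc.
exfalso; move: h; rewrite ltNge => /negP; apply; rewrite fE.
have mfr : measurable [set s | f s = f r].
  exact: (measurable_preimage mf (measurable_set1 (f r))).
rewrite (Pr_ae_eq (B := [set s | f s <= f r] `\` [set s | f s = f r])
    (measurableU _ _ mfr (measurableC mD))).
- rewrite (Pr_ae_eq (B := ([set s | f s <= f r] `\` [set s | f s = f r]) `&` D)
    (measurableC mD) D0).
  + apply: Pr_le; [|exact: measurable_le_ray|].
      by apply: measurableI => //; exact: measurableD.
    move=> s [[/= fsr fsr']] Ds; rewrite leNgt; apply/negP => cs; apply: fsr'.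
    apply/eqP; rewrite eq_le fsr/=; apply: mono => //.
    exact/ltW/(le_lt_trans rc).
  + exact: measurableD.
  + by apply: measurableI => //; exact: measurableD.
  + by move=> s /= /contrapT Ds; split => [?|[]].
- apply/negligibleP; first by apply: measurableU => //; exact: measurableC.
  apply: negligibleU; apply/negligibleP => //; last exact: measurableC.
  by have := push _ (measurable_set1 (f r)); rewrite nob.
- exact: mle.
- exact: measurableD.
- by move=> s /= /not_orP[? _]; split => [?|[]].
Qed.

End real_line.

Section joint_cdf.
Context {disp} {X : measurableType disp} {R : realType}.
Variable k : R.-pker X ~> R.

Lemma measurable_kcdf :
  measurable_fun setT (fun p : X * R => Pr (kprob k p.1) [set s | s <= p.2]).
Proof.
pose C := [set p : (X * R) * R | p.2 <= p.1.2].
have mC : measurable C.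
  apply: measurable_le_set; first exact: measurable_snd.
  exact: (measurableT_comp measurable_snd measurable_fst).
have := measurable_Pr_xsection (kfst k) mC.
congr measurable_fun; apply/funext => p.
by congr (fine (k p.1 _)); apply/seteqP; split => s /=; rewrite xsectionE.
Qed.

End joint_cdf.

(** * The Knothe-Rosenblatt map *)

Section Knothe_Rosenblatt_theory.
Context {R : realType} (d : nat) (mu nu : probability (d.-tuple R) R).
Variables mu_ nu_ : forall m : nat, R.-pker (m.-tuple R) ~> R.
Hypotheses (hmu_ : disintegration mu mu_) (hnu_ : disintegration nu nu_).
Hypothesis htarget : H_target d nu_.
Variable T : d.-tuple R -> d.-tuple R.
Hypothesis mT : measurable_fun setT T.
Variable U : forall m : nat, m.-tuple R -> R -> R.
Arguments U : clear implicits.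
Hypothesis TU : forall x : d.-tuple R,
  T x = [tuple of rev (KR_coords U [tuple of rev x])].
Hypothesis hU : forall m : nat, (m < d)%N ->
  {ae pushforward mu (@rcoords R d m), forall t,
     monotone_transport (mu_ m t) (nu_ m (KR_coords U t)) (U m t)}.

Lemma rcoord_KR (m : nat) (x : d.-tuple R) : (m < d)%N ->
  rcoord m (T x) = U m (rcoords m x) (rcoord m x).
Proof.
move=> md; rewrite {1}/rcoord TU /= revK.
transitivity (tnth (KR_coords U [tuple of rev x]) (Ordinal md)).
  by rewrite (tnth_nth 0).
rewrite tnth_mktuple/=; congr (U _ _ _).
Qed.

Lemma rcoords_KR (m : nat) (x : d.-tuple R) : (m <= d)%N ->
  rcoords m (T x) = KR_coords U (rcoords m x).
Proof.
move=> md; apply: eq_from_tnth => i; rewrite tnth_rcoords tnth_mktuple.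
rewrite rcoord_KR; last exact: leq_trans (ltn_ord i) md.
by rewrite nth_rcoords// -(@trunc_rcoords _ _ m)// ltnW.
Qed.

(** No measurability of [U] is assumed: it is read off from that of [T] on padded vectors. *)
Lemma measurable_KR_coords (m : nat) : (m <= d)%N ->
  measurable_fun setT (@KR_coords R U m).
Proof.
move=> md; rewrite (_ : @KR_coords R U m = (@rcoords R d m \o T) \o @pad R d m).
  apply: measurableT_comp; last exact: measurable_pad.
  by apply: measurableT_comp => //; exact: measurable_rcoords.
by apply/funext => t /=; rewrite rcoords_KR// rcoords_pad// trunc_id.
Qed.

Lemma measurable_KR_coord (m : nat) : (m < d)%N ->
  measurable_fun setT (fun p : m.-tuple R * R => U m p.1 p.2).
Proof.
move=> md; rewrite (_ : (fun p => _) =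
    (@rcoord R d m \o T) \o (@pad R d m.+1 \o @snoc R m)).
  apply: measurableT_comp; last first.
    by apply: measurableT_comp; [exact: measurable_pad|exact: measurable_snoc].
  by apply: measurableT_comp => //; exact: measurable_rcoord.
apply/funext => p /=; rewrite rcoord_KR// rcoord_pad// rcoords_pad//; last exact: ltnW.
rewrite nth_snoc ltnn eqxx; congr (U _ _ _).
apply: eq_from_tnth => i; rewrite [RHS]tnth_mktuple nth_snoc ltn_ord.
exact: tnth_nth.
Qed.

Lemma measurable_KR_section (m : nat) (t : m.-tuple R) : (m < d)%N ->
  measurable_fun setT (U m t).
Proof.
move=> md.
exact: (measurableT_comp (measurable_KR_coord md) (pair1_measurable t)).
Qed.

Let mR m := @measurable_rcoords R d m.

Let mRT m : measurable_fun setT (@rcoords R d m \o T).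
Proof. by apply: measurableT_comp => //; exact: mR. Qed.

Lemma monotone_transport_ae (m : nat) : (m < d)%N ->
  exists N : set (d.-tuple R), [/\ measurable N, mu N = 0%E & forall x, ~ N x ->
    monotone_transport (kprob (mu_ m) (rcoords m x))
      (kprob (nu_ m) (rcoords m (T x))) (U m (rcoords m x))].
Proof.
move=> md; have [N [mN N0 sN]] := hU md.
exists (@rcoords R d m @^-1` N); split => //.
  exact: measurable_preimage (@mR m) mN.
move=> x Nx; rewrite rcoords_KR; last exact: ltnW.
by apply: contrapT => h; apply: Nx; exact: sN.
Qed.

(** Induction on the level. Almost every fibre map [U m t] pushes [mu_ m t] to
    [nu_ m (KR_coords U t)], so the mass of a rectangle is an integral of [nu_ m] against the law of
    the upper coordinates of [T]; by induction this is the law under [nu], and the disintegration of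
    [nu] concludes. *)
Lemma KR_rcoords_law (m : nat) : (m <= d)%N ->
  same_law mu (@rcoords R d m \o T) nu (@rcoords R d m).
Proof.
elim: m => [|m ih] md.
  move=> B mB.
  have [Bnil|Bnil] := pselect (B [tuple]).
    rewrite (_ : _ @^-1` B = setT); last first.
      by apply/seteqP; split => // x _ /=; rewrite [X in B X]tuple0.
    rewrite (_ : _ @^-1` B = setT) ?probability_setT//.
    by apply/seteqP; split => // x _ /=; rewrite [X in B X]tuple0.
  rewrite (_ : _ @^-1` B = set0); last first.
    by apply/seteqP; split => // x /=; rewrite [X in B X]tuple0.
  rewrite (_ : _ @^-1` B = set0) ?measure0//.
  by apply/seteqP; split => // x /=; rewrite [X in B X]tuple0.
have {}ih := ih (ltnW md).
suff h : same_law mu (fun x => (rcoords m (T x), rcoord m (T x)))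
    nu (fun y => (rcoords m y, rcoord m y)).
  move=> B mB; have := h _ (measurable_preimage (@measurable_snoc R m) mB).
  congr (mu _ = nu _); apply/funext => x /=; congr B.
    exact: (snoc_rpair m (T x)).
  exact: (snoc_rpair m x).
have mrT : measurable_fun setT (fun x => rcoord m (T x)).
  by apply: measurableT_comp => //; exact: measurable_rcoord.
have mr := @measurable_rcoord R d m.
apply: same_law_pair (@mRT m) mrT (@mR m) mr _.
move=> A B mA mB; rewrite (hnu_ md mA mB).
have [N [mN N0 hN]] := monotone_transport_ae md.
pose C := [set p : m.-tuple R * R | A (KR_coords U p.1) /\ B (U m p.1 p.2)].
have mC : measurable C.
  apply: measurableI.
    exact: (measurable_preimage
      (measurableT_comp (measurable_KR_coords (ltnW md)) measurable_fst) mA).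
  exact: (measurable_preimage (measurable_KR_coord md) mB).
have -> : (fun x => rcoords m (T x)) @^-1` A `&` (fun x => rcoord m (T x)) @^-1` B
    = @rpair R d m @^-1` C.
  by apply/seteqP; split => x; rewrite /= rcoords_KR ?rcoord_KR//; exact: ltnW.
rewrite (disintegration_set hmu_ md mC).
pose h (t : m.-tuple R) : \bar R := (kprob (nu_ m) t B * (\1_A t)%:E)%E.
have mh : measurable_fun setT h.
  apply: emeasurable_funM; first exact: measurable_kernel.
  by apply/measurable_EFinP; exact: measurable_indic.
have h0 t : (0 <= h t)%E by rewrite mule_ge0// lee_fin.
transitivity (\int[mu]_x h (rcoords m (T x)))%E.
  apply: ae_eq_integral => //.
  - exact: (measurable_cond_xsection mu_ mC).
  - exact: (measurableT_comp mh (@mRT m)).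
  exists N; split => // x /= /not_implyP[_ hx]; apply: contrapT => Nx; apply: hx.
  have [_ push] := hN _ Nx; rewrite /h -push//.
  rewrite xsectionE indicE; have [/set_mem AT|AT] := boolP (_ \in A).
    rewrite mule1; congr (kprob _ _ _); apply/seteqP; split => r /=.
      by case.
    by move=> Br; split => //=; rewrite -rcoords_KR//; exact: ltnW.
  rewrite mule0 (_ : _ @^-1` _ = set0) ?measure0//.
  apply/seteqP; split => // r [/= AU _]; move/negP : AT; apply.
  by apply/mem_set; rewrite rcoords_KR//; exact: ltnW.
rewrite [LHS](same_law_integral (@mRT m) (@mR m) ih mh h0).
rewrite [RHS]integral_mkcond; apply: eq_integral => y _; rewrite /h patchE indicE.
rewrite (_ : (y \in rcoords m @^-1` A) = (rcoords m y \in A)); last first.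
  by apply/idP/idP => /set_mem ?; exact/mem_set.
by case: ifP => _; rewrite ?mule1 ?mule0.
Qed.

Lemma KR_law : same_law mu T nu id.
Proof.
move=> B mB.
have := KR_rcoords_law (leqnn d) (measurable_preimage (@measurable_pad R d d) mB).
congr (mu _ = nu _); apply/funext => x /=; congr B; exact: pad_rcoords.
Qed.

Lemma no_atoms_ae (m : nat) : (m.+1 < d)%N ->
  exists N : set (d.-tuple R), [/\ measurable N, mu N = 0%E & forall x, ~ N x ->
    no_atoms (kprob (nu_ m) (rcoords m (T x)))].
Proof.
move=> md; pose N := ~` [set t | no_atoms (nu_ m t)].
have mN : measurable N by exact/measurableC/measurable_no_atoms.
exists ((@rcoords R d m \o T) @^-1` N); split => //.
- exact: measurable_preimage (@mRT m) mN.
- rewrite KR_rcoords_law//; last by do 2 apply: ltnW.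
  apply: (ae_iterated_null hnu_) => //; first by do 2 apply: ltnW.
  by apply: ae_iterated_sub (htarget md) => t ht /=; apply.
- by move=> x /contrapT.
Qed.

(* This is where the conditional laws of [nu] must be atomless. *)
Lemma KR_invertible (m : nat) : (m < d)%N ->
  forall A : set (m.-tuple R), measurable A ->
  exists B : set (m.-tuple R), exists N : set (d.-tuple R),
    [/\ measurable B, measurable N, mu N = 0%E &
        forall x, ~ N x -> A (rcoords m x) <-> B (rcoords m (T x))].
Proof.
elim/ltn_ind: m => m IH md; apply: tuple_sigma_ind.
  split.
  - exists set0, set0; split => //; exact: measurable0.
  - move=> A [B [N [mB mN N0 AB]]]; exists (~` B), N; split => //.
      exact: measurableC.
    by move=> x /AB; rewrite setTD /=; tauto.
  - move=> A /choice[B /choice[N BN]].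
    exists (\bigcup_n B n), (\bigcup_n N n); split.
    + by apply: bigcup_measurable => n _; case: (BN n).
    + by apply: bigcup_measurable => n _; case: (BN n).
    + apply/negligibleP; first by apply: bigcup_measurable => n _; case: (BN n).
      by apply: negligible_bigcup => n; case: (BN n) => _ mN N0 _; apply/negligibleP.
    + move=> x Nx; split => -[n _ h]; exists n => //; case: (BN n) => _ _ _ h'.
        by apply/h' => // Nn; apply: Nx; exists n.
      by apply/h' => // Nn; apply: Nx; exists n.
move=> i c; have im := ltn_ord i; have id := ltn_trans im md.
pose p (t : i.-tuple R) := Pr (kprob (mu_ i) t) [set r | r <= c].
pose G (q : i.-tuple R * R) := Pr (kprob (nu_ i) q.1) [set r | r <= q.2].
have mp : measurable_fun setT p by apply: measurable_Pr_kprob; exact: measurable_le_ray.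
have mG : measurable_fun setT G by exact: measurable_kcdf.
(* By [monotone_transport_gt], x_i > c amounts to p < G, where G depends on T x only but p still on
   the upper coordinates of x. Inserting a rational between p and G leaves sets [p <= q], which the
   induction hypothesis at level [i] expresses through T x. *)
have /choice[B /choice[N BN]] : forall n, exists B : set (i.-tuple R),
    exists N : set (d.-tuple R),
    [/\ measurable B, measurable N, mu N = 0%E &
      forall x, ~ N x -> p (rcoords i x) <= enum_rat n <-> B (rcoords i (T x))].
  move=> n; apply: (IH i im id [set t | p t <= enum_rat n]).
  exact: measurable_le_set.
have [N1 [mN1 N10 hN1]] := monotone_transport_ae id.
(* Here i < m < d, so i + 1 < d: exactly the levels covered by [H_target]. *)
have [N2 [mN2 N20 hN2]] := no_atoms_ae (leq_ltn_trans im md).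
pose D := [set q : i.-tuple R * R |
  ~ (c < q.2 <-> p q.1 < G (KR_coords U q.1, U i q.1 q.2))].
have mD : measurable D.
  have mL : measurable [set q : i.-tuple R * R | c < q.2].
    by apply: measurable_lt_set => //; exact: measurable_snd.
  have mr : measurable [set q : i.-tuple R * R |
      p q.1 < G (KR_coords U q.1, U i q.1 q.2)].
    apply: measurable_lt_set.
      exact: (measurableT_comp mp measurable_fst).
    apply: (measurableT_comp mG); apply: measurable_fun_pair.
      exact: (measurableT_comp (measurable_KR_coords (ltnW id)) measurable_fst).
    exact: measurable_KR_coord.
  rewrite (_ : D = ([set q | c < q.2] `\` [set q : i.-tuple R * R |
      p q.1 < G (KR_coords U q.1, U i q.1 q.2)]) `|`
      ([set q : i.-tuple R * R | p q.1 < G (KR_coords U q.1, U i q.1 q.2)] `\`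
       [set q | c < q.2])).
    by apply: measurableU; exact: measurableD.
  apply/seteqP; split => q; rewrite /D /=; last by tauto.
  move=> h; have [h1|h1] := pselect (c < q.2); [left; tauto|right].
  by split => //; apply: contrapT => h2; tauto.
have D0 : mu (@rpair R d i @^-1` D) = 0%E.
  apply: (disintegration_null hmu_ id (measurableU _ _ mN1 mN2) _ mD).
    by apply: null_set_setU.
  move=> x /= /not_orP[/hN1 h1 /hN2 h2].
  apply: (monotone_transport_gt (c := c) (measurable_KR_section _ id) h1 h2).
    exact: measurable_xsection.
  move=> r; rewrite xsectionE /D /= /p /G /= -rcoords_KR//; exact: ltnW.
pose tr := @trunc R m i.
have mtr : measurable_fun setT tr by exact: measurable_trunc.
have mBn n : measurable [set t : m.-tuple R |
    enum_rat n < G (tr t, nth 0 t i) /\ B n (tr t)].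
  apply: measurableI.
    apply: measurable_lt_set => //; apply: (measurableT_comp mG).
    by apply: measurable_fun_pair => //; exact: measurable_nth.
  by apply: (measurable_preimage mtr); case: (BN n).
exists (\bigcup_n [set t : m.-tuple R |
    enum_rat n < G (tr t, nth 0 t i) /\ B n (tr t)]),
  (@rpair R d i @^-1` D `|` \bigcup_n N n).
have mrD : measurable (@rpair R d i @^-1` D).
  exact: measurable_preimage (@measurable_rpair R d i) mD.
have mNn : measurable (\bigcup_n N n).
  by apply: bigcup_measurable => n _; case: (BN n).
split.
- exact: bigcup_measurable.
- exact: measurableU.
- apply: null_set_setU => //; apply/negligibleP => //.
  by apply: negligible_bigcup => n; case: (BN n) => _ mN N0 _; apply/negligibleP.
- move=> x /= /not_orP[/contrapT Dx Nx].
  have tE : tr (rcoords m (T x)) = rcoords i (T x).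
    by rewrite /tr trunc_rcoords// ltnW.
  have nE : nth 0 (rcoords m (T x)) i = rcoord i (T x) by rewrite nth_rcoords.
  have {}Dx : c < rcoord i x <-> p (rcoords i x) < G (rcoords i (T x), rcoord i (T x)).
    by rewrite rcoord_KR// rcoords_KR//; exact: ltnW.
  have Bx n : p (rcoords i x) <= enum_rat n <-> B n (rcoords i (T x)).
    by case: (BN n) => _ _ _; apply => Nn; apply: Nx; exists n.
  rewrite tnth_rcoords; split.
    move=> /Dx/enum_rat_dense[n [pn nG]]; exists n => //=.
    by rewrite tE nE; split => //; exact/Bx/ltW.
  move=> [n _ /=]; rewrite tE nE => -[nG /Bx pn].
  exact/Dx/(le_lt_trans pn).
Qed.

End Knothe_Rosenblatt_theory.

(** * Quantile couplings *)

Section push_probability.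
Context {d1 d2} {T : measurableType d1} {S : measurableType d2} {R : realType}.
Variables (P : probability T R) (f : T -> S) (mf : measurable_fun setT f).

Definition push : set S -> \bar R := fun A => P (f @^-1` A).

Let push0 : push set0 = 0%E.
Proof. by rewrite /push preimage_set0 measure0. Qed.

Let push_ge0 A : (0 <= push A)%E.
Proof. exact: measure_ge0. Qed.

Let push_sigma_additive : semi_sigma_additive push.
Proof.
move=> F mF tF mUF; rewrite /push preimage_bigcup.
apply: measure_semi_sigma_additive.
- by move=> n; exact: measurable_preimage.
- by move=> i j _ _ [x [Fi Fj]]; apply: tF => //; exists (f x).
- by rewrite -preimage_bigcup; exact: measurable_preimage.
Qed.

HB.instance Definition _ := isMeasure.Build _ _ _ push
  push0 push_ge0 push_sigma_additive.

Let push_setT : push setT = 1%E.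
Proof. by rewrite /push preimage_setT; exact: probability_setT. Qed.

HB.instance Definition _ := Measure_isProbability.Build _ _ _ push push_setT.

Definition push_probability : probability S R := push.

End push_probability.

Section product_probability.
Context {d1 d2} {T1 : measurableType d1} {T2 : measurableType d2} {R : realType}.
Variables (P1 : probability T1 R) (P2 : probability T2 R).

Definition pprod : set (T1 * T2) -> \bar R := (P1 \x P2)%E.

HB.instance Definition _ := Measure.on pprod.

Let pprod_setT : pprod setT = 1%E.
Proof.
by rewrite /pprod -setXTT product_measure1E//= !probability_setT mule1.
Qed.

HB.instance Definition _ := Measure_isProbability.Build _ _ _ pprod pprod_setT.

Definition product_probability : probability (T1 * T2)%type R := pprod.

Lemma product_probability_Pr (C : set (T1 * T2)) : measurable C ->
  Pr product_probability C = E P1 (fun x => Pr P2 (xsection C x)).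
Proof.
move=> mC; rewrite /Pr /E /Rintegral; congr fine.
apply: eq_integral => x _; rewrite fineK// fin_num_measure//.
exact: measurable_xsection.
Qed.

Lemma product_probability_fst (A : set T1) : measurable A ->
  product_probability (fst @^-1` A) = P1 A.
Proof.
move=> mA; have -> : fst @^-1` A = A `*` [set: T2].
  by apply/seteqP; split => [[x y]|[x y] []].
by rewrite [LHS]product_measure1E// -[RHS]mule1; congr (_ * _)%E; exact: probability_setT.
Qed.

End product_probability.

Section cdf.
Context {R : realType}.
Variable a : probability R R.

Definition Fcdf (r : R) : R := Pr a [set s | s <= r].

Lemma Fcdf_le (r s : R) : r <= s -> Fcdf r <= Fcdf s.
Proof.
move=> rs; apply: Pr_le; [exact: measurable_le_ray..|].
by move=> x /= xr; exact: le_trans rs.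
Qed.

Lemma Fcdf_ge0 r : 0 <= Fcdf r. Proof. exact: Pr_ge0. Qed.

Lemma Fcdf_le1 r : Fcdf r <= 1.
Proof. by apply: Pr_le1; exact: measurable_le_ray. Qed.

Lemma Pr_gt_ray r : Pr a [set s | r < s] = 1 - Fcdf r.
Proof.
rewrite -PrC; last exact: measurable_le_ray.
congr Pr; apply/seteqP; split => s /=; first by rewrite ltNge => /negP.
by move=> /negP; rewrite -ltNge.
Qed.

Lemma Fcdf_nearly1 (s : R) : s < 1 -> exists r, s <= Fcdf r.
Proof.
move=> s1; pose F n := [set r : R | r <= n%:R].
have mF n : measurable (F n) by exact: measurable_le_ray.
have UF : \bigcup_n F n = setT.
  apply/seteqP; split => // r _; exists (Num.truncn r).+1 => //=.
  by rewrite /F /= ltW// truncnS_gt.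
have : a \o F @ \oo --> 1%E.
  rewrite -(probability_setT a) -UF; apply: nondecreasing_cvg_mu => //.
    by rewrite UF.
  move=> m n mn; apply/subsetPset => r /= /le_trans; apply.
  by rewrite ler_nat.
move=> /fine_cvg /= Fcvg.
have e0 : 0 < 1 - s by rewrite subr_gt0.
have [n /= hn] := filter_ex (cvg_limsup_ge Fcvg e0).
by exists n%:R; move: hn; rewrite /Fcdf /Pr /F /=; lra.
Qed.

Lemma Fcdf_nearly0 (s : R) : 0 < s -> exists r, Fcdf r < s.
Proof.
move=> s0; pose F n := [set r : R | r <= - n%:R].
have mF n : measurable (F n) by exact: measurable_le_ray.
have IF : \bigcap_n F n = set0.
  apply/seteqP; split => // r /(_ (Num.truncn (- r)).+1 I) /=.
  by rewrite /F /= lerNr leNgt truncnS_gt.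
have : a \o F @ \oo --> 0%E.
  rewrite -(measure0 a) -IF; apply: nonincreasing_cvg_mu => //.
  - by rewrite ltey_eq fin_num_measure.
  - by rewrite IF.
  - move=> m n mn; apply/subsetPset => r /= /le_trans; apply.
    by rewrite lerN2 ler_nat.
move=> /fine_cvg /= Fcvg.
have s2 : 0 < s / 2 by rewrite divr_gt0.
have [n /= hn] := filter_ex (cvg_limsup_le Fcvg s2).
by exists (- n%:R); move: hn; rewrite /Fcdf /Pr /F /=; lra.
Qed.

Lemma Fcdf_right (s r : R) : (forall r', r < r' -> s <= Fcdf r') -> s <= Fcdf r.
Proof.
move=> h; pose F n := [set x : R | x <= r + n.+1%:R^-1].
have mF n : measurable (F n) by exact: measurable_le_ray.
have IF : \bigcap_n F n = [set x | x <= r].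
  apply/seteqP; split => x /=.
    move=> xF; apply/ler_addgt0Pr => e e0.
    pose n := Num.truncn e^-1.
    apply: (le_trans (xF n I)); rewrite lerD2l.
    rewrite -[leRHS]invrK lef_pV2 ?posrE ?ltr0n ?invr_gt0//.
    by rewrite ltW// truncnS_gt.
  by move=> xr n _; rewrite /F /= (le_trans xr)// lerDl.
have : a \o F @ \oo --> a [set x | x <= r].
  rewrite -IF; apply: nonincreasing_cvg_mu => //.
  - by rewrite ltey_eq fin_num_measure.
  - by rewrite IF; exact: measurable_le_ray.
  - move=> m n mn; apply/subsetPset => x /= /le_trans; apply.
    by rewrite lerD2l lef_pV2 ?posrE ?ltr0n// ler_nat.
rewrite [X in _ --> X]PrE; last exact: measurable_le_ray.
move=> /fine_cvg /= Fcvg; apply/ler_addgt0Pr => e e0.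
have [n /= hn] := filter_ex (cvg_limsup_le Fcvg e0).
apply: le_trans hn; apply: h; by rewrite ltrDl invr_gt0 ltr0n.
Qed.

(** Outside ]0, 1[ the infimum may run over an empty set or one without lower bound; the default 0
    is harmless because these levels are [unif]-null. *)
Definition quantile (s : R) : R :=
  if 0 < s < 1 then inf [set r | s <= Fcdf r] else 0.

(** The Galois relation between the quantile and the distribution function. It rests on the infimum
    being attained, which is right continuity. *)
Lemma quantile_gt (c s : R) : 0 < s < 1 -> (c < quantile s) = (Fcdf c < s).
Proof.
move=> s01; rewrite /quantile s01; case/andP: s01 => s0 s1.
set S := [set r | _].
have S0 : S !=set0 by have [r hr] := Fcdf_nearly1 s1; exists r.
have lS : has_lbound S.
  have [r hr] := Fcdf_nearly0 s0; exists r => x /= Sx.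
  rewrite leNgt; apply/negP => /ltW/Fcdf_le; rewrite leNgt => /negP; apply.
  exact: lt_le_trans hr Sx.
have infS : S (inf S).
  apply: Fcdf_right => r' infr'.
  have [x Sx xr'] := inf_lt S0 infr'.
  by apply: le_trans Sx _; exact/Fcdf_le/ltW.
apply/idP/idP => [cS|].
  rewrite ltNge; apply/negP => Sc.
  by have := ge_inf lS Sc; rewrite leNgt cS.
rewrite !ltNge; apply: contra => Sc.
exact: le_trans infS (Fcdf_le Sc).
Qed.

End cdf.

Section uniform.
Context {R : realType}.

(** The identity between two presentations of the Borel line: it carries the uniform law to the
    measurable structure used for the coordinates. *)
Let idR : measurableTypeR R -> R := id.

Let measurable_idR : measurable_fun setT idR.
Proof. by move=> _ B mB; rewrite setTI. Qed.

Definition unif : probability R R :=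
  push_probability (uniform_prob (@ltr01 R)) measurable_idR.

Let unifE (A : set R) : measurable A ->
  unif A = lebesgue_measure (A `&` `[0, 1]%classic).
Proof.
move=> mA; rewrite /unif /= /push /uniform_prob integral_uniform_pdf.
rewrite (eq_integral (fun=> 1%E)).
  by rewrite integral_cst ?mul1e//; exact: measurableI.
move=> x /set_mem[_]; rewrite /= in_itv/= /uniform_pdf => ->.
by rewrite subr0 invr1.
Qed.

Lemma unif_gt (p : R) (A : set R) : 0 <= p -> p <= 1 -> measurable A ->
  (forall s, 0 < s < 1 -> A s <-> p < s) -> Pr unif A = 1 - p.
Proof.
move=> p0 p1 mA hA.
have m01 : measurable (`]0, 1[%classic : set R) by exact: measurable_itv.
have full : unif (~` (`]0, 1[%classic : set R)) = 0%E.
  rewrite probability_setC// unifE// setIidl; last first.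
    by move=> x /=; rewrite !in_itv/= => /andP[/ltW -> /ltW ->].
  by rewrite lebesgue_measure_itv/= lte_fin ltr01 oppr0 adde0 subee.
rewrite (Pr_ae_eq (B := `]p, 1]%classic) (measurableC m01) full)//.
  rewrite /Pr unifE// setIidl; last first.
    move=> x /=; rewrite !in_itv/= => /andP[px ->]; rewrite andbT.
    exact/ltW/(le_lt_trans p0).
  rewrite lebesgue_measure_itv/= lte_fin.
  by case: ltP => [//|p1']; apply/eqP; rewrite eq_sym subr_eq0 eq_le p1 p1'.
move=> s /= /contrapT; rewrite !in_itv/= => s01; rewrite hA//.
case/andP: s01 => _ /ltW ->; rewrite andbT; split => //.
Qed.

End uniform.

Section kernel_quantile.
Context {disp} {X : measurableType disp} {R : realType}.
Variable k : R.-pker X ~> R.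

Definition kquantile (p : X * R) : R := quantile (kprob k p.1) p.2.

Lemma measurable_kquantile : measurable_fun setT kquantile.
Proof.
move=> _ B mB; rewrite setTI.
apply: (real_sigma_ind (G := [set B | measurable (kquantile @^-1` B)])) mB.
  split => /=.
  - by rewrite preimage_set0; exact: measurable0.
  - by move=> A mA; rewrite setTD preimage_setC; exact: measurableC.
  - by move=> A mA; rewrite preimage_bigcup; exact: bigcup_measurable.
move=> c /=; pose I01 := [set p : X * R | 0 < p.2 < 1].
have mI : measurable I01.
  rewrite (_ : I01 = [set p | 0 < p.2] `&` [set p | p.2 < 1]).
    by apply: measurableI; apply: measurable_lt_set => //; exact: measurable_snd.
  by apply/seteqP; split => p /=; rewrite /I01 /= => /andP.
have mF : measurable [set p : X * R | Fcdf (kprob k p.1) c < p.2].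
  apply: measurable_lt_set; last exact: measurable_snd.
  have mc := measurable_Pr_kprob k (measurable_le_ray c).
  exact: (measurableT_comp mc measurable_fst).
rewrite (_ : _ @^-1` _ = (I01 `&` [set p | Fcdf (kprob k p.1) c < p.2]) `|`
    (~` I01 `&` [set p | c < 0])).
  apply: measurableU; first exact: measurableI.
  apply: measurableI; first exact: measurableC.
  have [c0|c0] := boolP (c < 0).
    by rewrite (_ : [set p | _] = setT)//; apply/seteqP; split.
  by rewrite (_ : [set p | _] = set0)//; apply/seteqP; split.
apply/seteqP; split => p /=; rewrite /kquantile /I01 /=.
  have [p01|p01] := boolP (0 < p.2 < 1); first by rewrite quantile_gt//; left.
  by rewrite /quantile (negbTE p01) => c0; right.
case=> [[p01]|[/negP p01 c0]]; first by rewrite quantile_gt.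
by rewrite /quantile (negbTE p01).
Qed.

Lemma unif_kquantile_gt (x : X) (c : R) :
  Pr unif [set s | c < kquantile (x, s)] = Pr (kprob k x) [set r | c < r].
Proof.
rewrite Pr_gt_ray; apply: unif_gt.
- exact: Fcdf_ge0.
- exact: Fcdf_le1.
- apply: measurable_gtc_set.
  exact: (measurableT_comp measurable_kquantile (pair1_measurable x)).
- by move=> s s01 /=; rewrite /kquantile/= quantile_gt.
Qed.

End kernel_quantile.

(** Both quantiles are driven by the same uniform variable, so the two events are [s > F(c)] and
    [s > F'(c')]: the coupling is comonotone and the joint tail attains its largest possible
    value. *)
Lemma unif_kquantile_gt2 {d1 d2} {X : measurableType d1} {Y : measurableType d2}
    {R : realType} (k : R.-pker X ~> R) (l : R.-pker Y ~> R)
    (x : X) (y : Y) (c c' : R) :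
  Pr unif [set s | c < kquantile k (x, s) /\ c' < kquantile l (y, s)] =
  Num.min (Pr (kprob k x) [set r | c < r]) (Pr (kprob l y) [set r | c' < r]).
Proof.
rewrite !Pr_gt_ray.
set p := Fcdf _ c; set q := Fcdf _ c'.
have -> : Num.min (1 - p) (1 - q) = 1 - Num.max p q.
  by rewrite /Num.min /Num.max ltrD2l ltrN2; case: ltgtP => // ->.
apply: unif_gt.
- by rewrite le_max Fcdf_ge0.
- by rewrite ge_max !Fcdf_le1.
- apply: measurableI; apply: measurable_gtc_set.
    exact: (measurableT_comp (measurable_kquantile k) (pair1_measurable x)).
  exact: (measurableT_comp (measurable_kquantile l) (pair1_measurable y)).
- move=> s s01 /=; rewrite /kquantile/= !quantile_gt// gt_max.
  by split => [[-> ->]//|/andP].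
Qed.

(** * Competitors for the optimal plan *)

Section update.
Context {R : realType} {d : nat}.

(** The index counts from the last coordinate, as in [rcoord], whence the [rev_ord]. *)
Definition update (i : nat) (p : d.-tuple R * R) : d.-tuple R :=
  [tuple if rev_ord j == i :> nat then p.2 else tnth p.1 j | j < d].

Lemma rcoord_update (i n : nat) (p : d.-tuple R * R) : (n < d)%N ->
  rcoord n (update i p) = if n == i then p.2 else rcoord n p.1.
Proof.
move=> nd; rewrite !(rcoord_tnth nd) tnth_mktuple rev_ordK/=.
by case: ifP.
Qed.

Lemma rcoords_update (i : nat) (p : d.-tuple R * R) : (i <= d)%N ->
  rcoords i (update i p) = rcoords i p.1.
Proof.
move=> id; apply: eq_from_tnth => j; rewrite !tnth_rcoords rcoord_update.
  by rewrite ltn_eqF.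
exact: leq_trans (ltn_ord j) id.
Qed.

Lemma measurable_update (i : nat) : measurable_fun setT (update i).
Proof.
apply/measurable_fun_tnthP => j.
have [ji|ji] := boolP (rev_ord j == i :> nat).
  rewrite (_ : _ \o _ = snd); first exact: measurable_snd.
  by apply/funext => p /=; rewrite tnth_mktuple ji.
rewrite (_ : _ \o _ = (fun x : d.-tuple R => tnth x j) \o fst).
  exact: (measurableT_comp (measurable_tnth j) measurable_fst).
by apply/funext => p /=; rewrite tnth_mktuple (negbTE ji).
Qed.

End update.

Section resampling.
Context {R : realType} {d : nat} (mu : probability (d.-tuple R) R).
Variable kappa : forall m : nat, R.-pker (m.-tuple R) ~> R.
Hypothesis hmu : disintegration mu kappa.
Context {disp} {W : measurableType disp} (P : probability W R).
Variable X : W -> d.-tuple R.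
Hypothesis mX : measurable_fun setT X.

Definition resample (i : nat) (w : W * R) : R :=
  kquantile (kappa i) (rcoords i (X w.1), w.2).

Let mXi i : measurable_fun setT (@rcoords R d i \o X).
Proof. by apply: measurableT_comp => //; exact: measurable_rcoords. Qed.

Lemma measurable_resample i : measurable_fun setT (resample i).
Proof.
apply: (measurableT_comp (measurable_kquantile (kappa i))).
apply: measurable_fun_pair; last exact: measurable_snd.
exact: (measurableT_comp (@mXi i) measurable_fst).
Qed.

(** Only the law of the upper coordinates of [X] enters, not that of [X] itself; the result thus
    applies to either component of a plan whose lower coordinates are still wrong. *)
Lemma resample_law (i : nat) : (i < d)%N ->
  same_law mu (@rcoords R d i) P (@rcoords R d i \o X) ->
  same_law mu (@rpair R d i) (product_probability P unif)
    (fun w => (rcoords i (X w.1), resample i w)).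
Proof.
move=> id law; have mR := @measurable_rcoords R d i.
have mr := @measurable_rcoord R d i.
have mXf : measurable_fun setT (fun w : W * R => rcoords i (X w.1)).
  exact: (measurableT_comp (@mXi i) measurable_fst).
apply: same_law_pair => //; first exact: measurable_resample.
move=> A B mA mB; apply: ray_law => //.
- exact: measurable_preimage mR mA.
- exact: measurable_preimage mXf mA.
- exact: measurable_resample.
- rewrite (law _ mA) -[LHS](product_probability_fst P unif)//.
  exact: measurable_preimage (@mXi i) mA.
move=> c {mB B}; have mC := measurable_gt_ray c.
have mKc : measurable_fun setT (fun t => Pr (kprob (kappa i) t) [set r | c < r]).
  exact: measurable_Pr_kprob.
have mC1 : measurable (rcoords i @^-1` A `&` [set x : d.-tuple R | c < rcoord i x]).
  by apply: measurableI; [exact: measurable_preimage mR mA|exact: measurable_gtc_set].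
have mC2 : measurable ((fun w => rcoords i (X w.1)) @^-1` A `&`
    [set w : W * R | c < resample i w]).
  apply: measurableI; first exact: measurable_preimage mXf mA.
  by apply: measurable_gtc_set; exact: measurable_resample.
rewrite !PrE//; congr (_%:E).
rewrite product_probability_Pr//.
have -> : rcoords i @^-1` A `&` [set x : d.-tuple R | c < rcoord i x] =
    @rpair R d i @^-1` (A `*` [set r | c < r]) by [].
rewrite (disintegration_Pr hmu id); last exact: measurableX.
pose h (t : i.-tuple R) : R := Pr (kprob (kappa i) t) [set r | c < r] * \1_A t.
have mh : measurable_fun setT h.
  by apply: measurable_funM => //; exact: measurable_indic.
have hE t : Pr (kprob (kappa i) t) (xsection (A `*` [set r | c < r]) t) = h t.
  rewrite /h indicE; have [tA|tA] := boolP (t \in A); first by rewrite in_xsectionX// mulr1.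
  by rewrite notin_xsectionX// mulr0 /Pr measure0.
have hE2 w : Pr unif (xsection ((fun w => rcoords i (X w.1)) @^-1` A `&`
    [set w : W * R | c < resample i w]) w) = h (rcoords i (X w)).
  rewrite /h indicE; have [/set_mem tA|/negP tA] := boolP (rcoords i (X w) \in A).
    rewrite mulr1 -unif_kquantile_gt; congr Pr.
    by apply/seteqP; split => s; rewrite xsectionE /=; [case|split].
  rewrite mulr0 (_ : xsection _ _ = set0) ?/Pr ?measure0//.
  by apply/seteqP; split => s; rewrite xsectionE //= => -[/mem_set].
under [in LHS]eq_fun do rewrite hE.
under [in RHS]eq_fun do rewrite hE2.
apply: (same_law_E mR (@mXi i) law mh).
apply: (@L1_bounded _ _ _ _ _ 1); first exact: (measurableT_comp mh mR).
move=> x /=; rewrite /h normrM -[leRHS]mulr1 ler_pM//; first exact: Pr_kprob_bound.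
by rewrite indicE; case: (_ \in _); rewrite ?normr1 ?normr0.
Qed.

End resampling.

Section competitor.
Context {R : realType} {d : nat} (mu nu : probability (d.-tuple R) R).
Variables mu_ nu_ : forall m : nat, R.-pker (m.-tuple R) ~> R.
Hypotheses (hmu_ : disintegration mu mu_) (hnu_ : disintegration nu nu_).

Notation plan := (probability (d.-tuple R * d.-tuple R)%type R).

Definition rcoords2 (i : nat) (z : d.-tuple R * d.-tuple R) :=
  (rcoords i z.1, rcoords i z.2).

Definition rcoord2 (i : nat) (z : d.-tuple R * d.-tuple R) :=
  (rcoord i z.1, rcoord i z.2).

(* The quantile coupling of the conditional laws of the [i]-th coordinates,
   driven by a uniform variable independent of the plan. *)
Definition resample2 (i : nat) (w : (d.-tuple R * d.-tuple R) * R) :=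
  (resample mu_ fst i w, resample nu_ snd i w).

(** Nothing is required of the lower coordinates: changing one coordinate spoils their joint law
    with the upper ones, and they are resampled in turn until both marginals are restored. *)
Definition partial_coupling (i : nat) (pi : plan) : Prop :=
  same_law mu (@rcoords R d i) pi (@rcoords R d i \o fst) /\
  same_law nu (@rcoords R d i) pi (@rcoords R d i \o snd).

Lemma measurable_rcoord2 i : measurable_fun setT (rcoord2 i).
Proof.
apply: measurable_fun_pair.
  exact: (measurableT_comp (@measurable_rcoord R d i) measurable_fst).
exact: (measurableT_comp (@measurable_rcoord R d i) measurable_snd).
Qed.

Lemma measurable_resample2 i : measurable_fun setT (resample2 i).
Proof.
by apply: measurable_fun_pair; apply: measurable_resample.
Qed.

Lemma resample_step (i : nat) (pi : plan) : (i < d)%N ->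
  partial_coupling i pi -> exists pi' : plan, [/\ partial_coupling i.+1 pi',
    same_law pi (rcoords2 i) pi' (rcoords2 i) &
    same_law (product_probability pi unif) (resample2 i) pi' (rcoord2 i)].
Proof.
move=> id [law1 law2].
pose Phi (w : (d.-tuple R * d.-tuple R) * R) :=
  (update i (w.1.1, resample mu_ fst i w), update i (w.1.2, resample nu_ snd i w)).
have m1 : measurable_fun setT (fun w : (d.-tuple R * d.-tuple R) * R => w.1.1).
  exact: (measurableT_comp measurable_fst measurable_fst).
have m2 : measurable_fun setT (fun w : (d.-tuple R * d.-tuple R) * R => w.1.2).
  exact: (measurableT_comp measurable_snd measurable_fst).
have mPhi : measurable_fun setT Phi.
  apply: measurable_fun_pair; apply: (measurableT_comp (@measurable_update R d i)).
    by apply: measurable_fun_pair => //; exact: measurable_resample.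
  by apply: measurable_fun_pair => //; exact: measurable_resample.
exists (push_probability (product_probability pi unif) mPhi); split.
- split => B mB.
  + change (mu (rcoords i.+1 @^-1` B) = product_probability pi unif
      (Phi @^-1` ((@rcoords R d i.+1 \o fst) @^-1` B))).
    have -> : rcoords i.+1 @^-1` B = @rpair R d i @^-1` (@snoc R i @^-1` B).
      by apply/funext => x /=; rewrite snoc_rpair.
    rewrite (resample_law hmu_ measurable_fst id law1
      (measurable_preimage (@measurable_snoc R i) mB)).
    congr (pprod _ _ _); apply/funext => w /=; congr B.
    rewrite -snoc_rpair; congr snoc; rewrite /rpair /Phi/=.
    by rewrite rcoords_update ?rcoord_update ?eqxx// ltnW.
  + change (nu (rcoords i.+1 @^-1` B) = product_probability pi unif
      (Phi @^-1` ((@rcoords R d i.+1 \o snd) @^-1` B))).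
    have -> : rcoords i.+1 @^-1` B = @rpair R d i @^-1` (@snoc R i @^-1` B).
      by apply/funext => x /=; rewrite snoc_rpair.
    rewrite (resample_law hnu_ measurable_snd id law2
      (measurable_preimage (@measurable_snoc R i) mB)).
    congr (pprod _ _ _); apply/funext => w /=; congr B.
    rewrite -snoc_rpair; congr snoc; rewrite /rpair /Phi/=.
    by rewrite rcoords_update ?rcoord_update ?eqxx// ltnW.
- move=> B mB; rewrite -(product_probability_fst pi unif); last first.
    apply: measurable_preimage mB; apply: measurable_fun_pair.
      exact: (measurableT_comp (@measurable_rcoords R d i) measurable_fst).
    exact: (measurableT_comp (@measurable_rcoords R d i) measurable_snd).
  change (product_probability pi unif (fst @^-1` (rcoords2 i @^-1` B)) =
    product_probability pi unif (Phi @^-1` (rcoords2 i @^-1` B))).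
  congr (pprod _ _ _); apply/funext => w /=; congr B.
  by rewrite /rcoords2 /= !rcoords_update// ltnW.
- move=> B mB; change (product_probability pi unif (resample2 i @^-1` B) =
    product_probability pi unif (Phi @^-1` (rcoord2 i @^-1` B))).
  congr (pprod _ _ _); apply/funext => w /=; congr B.
  by rewrite /rcoord2 /resample2 /= !rcoord_update// eqxx.
Qed.

Lemma rcoords2_trunc (i j : nat) (pi pi' : plan) : (i <= j)%N ->
  same_law pi (rcoords2 j) pi' (rcoords2 j) ->
  same_law pi (rcoords2 i) pi' (rcoords2 i).
Proof.
move=> ij law B mB.
pose tr (p : j.-tuple R * j.-tuple R) := (@trunc R j i p.1, @trunc R j i p.2).
have mtr : measurable_fun setT tr.
  apply: measurable_fun_pair.
    exact: (measurableT_comp (@measurable_trunc R j i) measurable_fst).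
  exact: (measurableT_comp (@measurable_trunc R j i) measurable_snd).
have := law _ (measurable_preimage mtr mB).
by congr (pi _ = pi' _); apply/funext => z /=; congr B;
  rewrite /tr /rcoords2 /= !trunc_rcoords.
Qed.

Lemma partial_coupling_full (pi : plan) : partial_coupling d pi ->
  coupling mu nu pi.
Proof.
move=> [law1 law2] A mA; have mB := measurable_preimage (@measurable_pad R d d) mA.
split.
  have := esym (law1 _ mB); congr (pi _ = mu _); apply/funext => z /=; congr A;
    exact: pad_rcoords.
have := esym (law2 _ mB); congr (pi _ = nu _); apply/funext => z /=; congr A;
  exact: pad_rcoords.
Qed.

Lemma coupling_partial (i : nat) (pi : plan) : coupling mu nu pi ->
  partial_coupling i pi.
Proof.
move=> cpl; split => B mB; have mB' := measurable_preimage (@measurable_rcoords R d i) mB.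
  by case: (cpl _ mB') => <-.
by case: (cpl _ mB') => _ <-.
Qed.

Lemma extend_coupling (i : nat) (pi : plan) : (i <= d)%N ->
  partial_coupling i pi -> exists pi' : plan, coupling mu nu pi' /\
    same_law pi (rcoords2 i) pi' (rcoords2 i).
Proof.
move=> id; have [n] := ubnP (d - i); elim: n i pi id => // n ih i pi id dn.
move: id; rewrite leq_eqVlt => /predU1P[->|id] cpl.
  by exists pi; split => //; exact: partial_coupling_full.
have [pi1 [cpl1 law1 _]] := resample_step id cpl.
have [] := ih _ pi1 id _ cpl1.
  by rewrite subnS prednK ?subn_gt0.
move=> pi2 [cpl2 /(rcoords2_trunc (leqnSn i)) law2]; exists pi2; split => //.
by move=> B mB; rewrite law1// law2.
Qed.

Lemma rcoords2_rcoord2 (i j : nat) (pi pi' : plan) : (i < j)%N ->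
  same_law pi (rcoords2 j) pi' (rcoords2 j) ->
  same_law pi (rcoord2 i) pi' (rcoord2 i).
Proof.
move=> ij law B mB.
pose pr (p : j.-tuple R * j.-tuple R) := (nth 0 p.1 i, nth 0 p.2 i).
have mpr : measurable_fun setT pr.
  apply: measurable_fun_pair.
    exact: (measurableT_comp (@measurable_nth R j i) measurable_fst).
  exact: (measurableT_comp (@measurable_nth R j i) measurable_snd).
have := law _ (measurable_preimage mpr mB).
by congr (pi _ = pi' _); apply/funext => z /=; congr B;
  rewrite /pr /rcoords2 /rcoord2 /= !nth_rcoords.
Qed.

Lemma competitor (m : nat) (pi : plan) : (m < d)%N -> coupling mu nu pi ->
  exists pi' : plan, [/\ coupling mu nu pi',
    forall j, (j < m)%N -> same_law pi (rcoord2 j) pi' (rcoord2 j) &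
    same_law (product_probability pi unif) (resample2 m) pi' (rcoord2 m)].
Proof.
move=> md cpl.
have [pi1 [cpl1 law1 law1']] := resample_step md (coupling_partial m cpl).
have [pi2 [cpl2 law2]] := extend_coupling md cpl1.
exists pi2; split => //.
- move=> j jm B mB; rewrite (rcoords2_rcoord2 jm law1)//.
  by rewrite (rcoords2_rcoord2 (leqW jm) law2).
- move=> B mB; rewrite law1'//.
  by rewrite (rcoords2_rcoord2 (ltnSn m) law2).
Qed.

Hypotheses (hmu2 : finite_second_moment mu) (hnu2 : finite_second_moment nu).

Lemma finite_second_moment_L1 (rho : probability (d.-tuple R) R) :
  finite_second_moment rho ->
  L1 rho (fun x => \sum_(i < d) tnth x i ^+ 2).
Proof.
move=> h; apply/integrableP; split.
  apply/measurable_EFinP; apply: measurable_sum => i.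
  by apply: measurable_funX; exact: measurable_tnth.
apply: le_lt_trans h; rewrite le_eqVlt; apply/orP; left; apply/eqP.
apply: eq_integral => x _ /=; rewrite ger0_norm// sumr_ge0// => i _.
exact: sqr_ge0.
Qed.

Lemma L2_tnth (rho : probability (d.-tuple R) R) (i : 'I_d) :
  finite_second_moment rho -> L2 rho (fun x => tnth x i).
Proof.
move=> /finite_second_moment_L1 h; split; first exact: measurable_tnth.
apply: (L1_le _ h); first by apply: measurable_funX; exact: measurable_tnth.
move=> x; rewrite ger0_norm ?sqr_ge0// (bigD1 i)//= lerDl sumr_ge0// => j _.
exact: sqr_ge0.
Qed.

(** Since (a - b)^2 <= 2 (a^2 + b^2), this bounds the cost of any single coordinate under any
    coupling of [mu] and [nu]. *)
Let M := 2 * (E mu (fun x => \sum_(i < d) tnth x i ^+ 2) +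
              E nu (fun x => \sum_(i < d) tnth x i ^+ 2)).

Lemma coupling_fst (pi : plan) : coupling mu nu pi -> same_law mu id pi fst.
Proof. by move=> cpl B mB; case: (cpl B mB) => <-. Qed.

Lemma coupling_snd (pi : plan) : coupling mu nu pi -> same_law nu id pi snd.
Proof. by move=> cpl B mB; case: (cpl B mB) => _ <-. Qed.

Lemma coupling_L2_fst (pi : plan) (h : d.-tuple R -> R) : coupling mu nu pi ->
  L2 mu h -> L2 pi (fun z => h z.1).
Proof.
move=> /coupling_fst law h2.
exact: (same_law_L2 (@measurable_id _ _ _) measurable_fst law (L2_measurable h2)).
Qed.

Lemma coupling_L2_snd (pi : plan) (h : d.-tuple R -> R) : coupling mu nu pi ->
  L2 nu h -> L2 pi (fun z => h z.2).
Proof.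
move=> /coupling_snd law h2.
exact: (same_law_L2 (@measurable_id _ _ _) measurable_snd law (L2_measurable h2)).
Qed.

Lemma coupling_cost_le (pi : plan) (i : 'I_d) : coupling mu nu pi ->
  E pi (fun z => (tnth z.1 i - tnth z.2 i) ^+ 2) <= M.
Proof.
move=> cpl.
have A2 := coupling_L2_fst cpl (L2_tnth i hmu2).
have B2 := coupling_L2_snd cpl (L2_tnth i hnu2).
have [_ A1] := A2; have [_ B1] := B2.
have L1s (rho : probability (d.-tuple R) R) : finite_second_moment rho ->
    E rho (fun x => tnth x i ^+ 2) <= E rho (fun x => \sum_(i < d) tnth x i ^+ 2).
  move=> h; have [_ h1] := L2_tnth i h.
  apply: Ele => //; first exact: finite_second_moment_L1.
  move=> x; rewrite (bigD1 i)//= lerDl sumr_ge0// => j _; exact: sqr_ge0.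
have Ea : E pi (fun z => tnth z.1 i ^+ 2) = E mu (fun x => tnth x i ^+ 2).
  have [ma a1] := L2_tnth i hmu2.
  have mh : measurable_fun setT (fun x : d.-tuple R => tnth x i ^+ 2).
    exact: measurable_funX.
  exact/esym/(same_law_E (@measurable_id _ _ _) measurable_fst (coupling_fst cpl) mh a1).
have Eb : E pi (fun z => tnth z.2 i ^+ 2) = E nu (fun x => tnth x i ^+ 2).
  have [ma a1] := L2_tnth i hnu2.
  have mh : measurable_fun setT (fun x : d.-tuple R => tnth x i ^+ 2).
    exact: measurable_funX.
  exact/esym/(same_law_E (@measurable_id _ _ _) measurable_snd (coupling_snd cpl) mh a1).
apply: (@le_trans _ _ (2 * (E pi (fun z => tnth z.1 i ^+ 2) + E pi (fun z => tnth z.2 i ^+ 2)))).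
  rewrite -ED// -EZ; last exact: L1D.
  apply: Ele; [exact: L2_sqrB|exact/L1Z/L1D|move=> z].
  have := sqr_ge0 (tnth z.1 i + tnth z.2 i); nra.
by rewrite Ea Eb /M ler_wpM2l// lerD// L1s.
Qed.

Lemma coupling_weighted_cost (pi : plan) (w : 'I_d -> R) :
  coupling mu nu pi -> L1 pi (weighted_cost w) /\
  E pi (weighted_cost w) =
  \sum_(i < d) w i * E pi (fun z => (tnth z.1 i - tnth z.2 i) ^+ 2).
Proof.
move=> cpl.
have c1 i : L1 pi (fun z => (tnth z.1 i - tnth z.2 i) ^+ 2).
  apply: L2_sqrB; first exact: coupling_L2_fst cpl (L2_tnth i hmu2).
  exact: coupling_L2_snd cpl (L2_tnth i hnu2).
have c1' i : L1 pi (fun z => w i * (tnth z.1 i - tnth z.2 i) ^+ 2).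
  exact: L1Z.
split; first exact: L1_sum.
by rewrite [LHS]E_sum//; apply: eq_bigr => i _; rewrite EZ.
Qed.

(** In the comparison with the competitor, the coordinates treated before level [m] cost the same
    under both plans and cancel; the remaining ones below are nonnegative for [g], hence dropped,
    and bounded by [M] for the competitor. *)
Lemma optimal_level (m : nat) (md : (m < d)%N) (w : 'I_d -> R) (g : plan) :
  (forall i, 0 < w i) -> optimal_plan mu nu (weighted_cost w) g ->
  E g (fun z => (rcoord m z.1 - rcoord m z.2) ^+ 2) <=
  E (product_probability g unif)
    (fun u => ((resample2 m u).1 - (resample2 m u).2) ^+ 2) +
  M * \sum_(i < d | (i < rev_ord (Ordinal md))%N) w i / w (rev_ord (Ordinal md)).
Proof.
move=> w0 [cpl opt]; set i0 := rev_ord (Ordinal md).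
have [pi [cpl' law law']] := competitor md cpl.
have [g1 gE] := coupling_weighted_cost w cpl.
have [pi1 piE] := coupling_weighted_cost w cpl'.
have cost : E g (weighted_cost w) <= E pi (weighted_cost w).
  have := opt _ cpl'; rewrite /E /Rintegral => h.
  by apply: fine_le => //; apply: integrable_fin_num.
rewrite gE piE in cost.
pose sq (p : R * R) := (p.1 - p.2) ^+ 2.
have msq : measurable_fun setT sq.
  apply: measurable_funX; apply: measurable_funB.
    exact: measurable_fst.
  exact: measurable_snd.
have sqE (rho : plan) (i : 'I_d) :
    E rho (fun z => (tnth z.1 i - tnth z.2 i) ^+ 2) = E rho (sq \o rcoord2 (rev_ord i)).
  by congr E; apply/funext => z; rewrite /sq /= !rcoord_rev_ord.
have sqL1 (rho : plan) (i : 'I_d) : coupling mu nu rho -> L1 rho (sq \o rcoord2 (rev_ord i)).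
  move=> c; rewrite (_ : _ \o _ = fun z => (tnth z.1 i - tnth z.2 i) ^+ 2).
    apply: L2_sqrB; first exact: coupling_L2_fst c (L2_tnth i hmu2).
    exact: coupling_L2_snd c (L2_tnth i hnu2).
  by apply/funext => z; rewrite /sq /= !rcoord_rev_ord.
have mE : (rev_ord i0 : nat) = m by rewrite /i0 rev_ordK.
(* A larger tuple index is a smaller level: these are the coordinates whose joint law the competitor
   has kept. *)
have same (i : 'I_d) : (i0 < i)%N -> E g (fun z => (tnth z.1 i - tnth z.2 i) ^+ 2) =
    E pi (fun z => (tnth z.1 i - tnth z.2 i) ^+ 2).
  move=> ii; have im : (rev_ord i < m)%N.
    by rewrite -mE /= ltn_sub2l// (leq_trans _ (ltn_ord i)).
  rewrite !sqE; apply: (same_law_E _ _ (law _ im) msq); [exact: measurable_rcoord2..|].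
  exact: sqL1.
have main : E (product_probability g unif)
    (fun u => ((resample2 m u).1 - (resample2 m u).2) ^+ 2) =
    E pi (fun z => (tnth z.1 i0 - tnth z.2 i0) ^+ 2).
  rewrite sqE mE; apply/esym.
  have := sqL1 pi i0 cpl'; rewrite mE => h.
  exact: (same_law_E (measurable_rcoord2 m) (measurable_resample2 m) (same_law_sym law') msq h).
have -> : E g (fun z => (rcoord m z.1 - rcoord m z.2) ^+ 2) =
    E g (fun z => (tnth z.1 i0 - tnth z.2 i0) ^+ 2) by rewrite sqE mE.
rewrite main -(ler_pM2l (w0 i0)).
set a := fun i => E g (fun z => (tnth z.1 i - tnth z.2 i) ^+ 2).
set b := fun i => E pi (fun z => (tnth z.1 i - tnth z.2 i) ^+ 2).
change (is_true (w i0 * a i0 <=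
  w i0 * (b i0 + M * \sum_(i < d | (i < i0)%N) w i / w i0))).
change (is_true (\sum_(i < d) w i * a i <= \sum_(i < d) w i * b i)) in cost.
have a0 i : 0 <= a i by apply: E_ge0 => z; exact: sqr_ge0.
have split3 (c : 'I_d -> R) : \sum_(i < d) c i =
    c i0 + (\sum_(i < d | (i < i0)%N) c i + \sum_(i < d | (i0 < i)%N) c i).
  rewrite (bigD1 i0)//=; congr (_ + _).
  rewrite (bigID (fun i : 'I_d => (i < i0)%N))/=; congr (_ + _).
    by apply: eq_bigl => i; case: eqVneq => [->|_] //=; rewrite ltnn.
  apply: eq_bigl => i; case: eqVneq => [->|ne] /=; first by rewrite ltnn.
  rewrite -leqNgt leq_eqVlt; case: eqP => // e.
  by case/eqP: ne; exact/esym/val_inj.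
move: cost; rewrite (split3 (fun i => w i * a i)) (split3 (fun i => w i * b i)).
have -> : \sum_(i < d | (i0 < i)%N) w i * a i = \sum_(i < d | (i0 < i)%N) w i * b i.
  by apply: eq_bigr => i ii; rewrite /a /b same.
have ha : 0 <= \sum_(i < d | (i < i0)%N) w i * a i.
  by apply: sumr_ge0 => i _; rewrite mulr_ge0// ltW.
have hb : \sum_(i < d | (i < i0)%N) w i * b i <= w i0 * (M * \sum_(i < d | (i < i0)%N) w i / w i0).
  rewrite mulrCA mulr_sumr mulr_sumr; apply: ler_sum => i _.
  have -> : M * (w i0 * (w i / w i0)) = w i * M by field; rewrite gt_eqF.
  by rewrite ler_wpM2l ?(ltW (w0 i))//; exact: coupling_cost_le.
by rewrite mulrDr; lra.
Qed.

End competitor.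

Definition limsup_eq {I : Type} {R : realType} (F : set_system I)
  (a b : I -> R) : Prop := limsup_le F a b /\ limsup_le F b a.

(** * Convergence of joint laws *)

Section convergence_class.
Context {I : Type} {R : realType} (F : set_system I) {FF : Filter F}.
Context {d1 d2 d3} {W : measurableType d1} {W0 : measurableType d2}
  {S : measurableType d3}.
Variables (P : I -> probability W R) (P0 : probability W0 R).
Variables (V : W -> S) (V0 : W0 -> S) (H : set W) (H0 : set W0).
Hypotheses (mV : measurable_fun setT V) (mV0 : measurable_fun setT V0).
Hypotheses (mH : measurable H) (mH0 : measurable H0).
Hypothesis law : forall i, same_law P0 V0 (P i) V.

Let conv (C : set S) := limsup_eq F (fun i => Pr (P i) (V @^-1` C `&` H))
  (fun=> Pr P0 (V0 @^-1` C `&` H0)).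

Let mVC C : measurable C -> measurable (V @^-1` C).
Proof. exact: measurable_preimage. Qed.

Let mVC0 C : measurable C -> measurable (V0 @^-1` C).
Proof. exact: measurable_preimage. Qed.

Let convT : limsup_eq F (fun i => Pr (P i) H) (fun=> Pr P0 H0) -> conv setT.
Proof. by rewrite /conv !preimage_setT !setTI. Qed.

Let convC C : conv setT -> measurable C -> conv C -> conv (~` C).
Proof.
rewrite {1}/conv !preimage_setT !setTI => -[t1 t2] mC [c1 c2].
have e i : Pr (P i) (V @^-1` (~` C) `&` H) = Pr (P i) H - Pr (P i) (V @^-1` C `&` H).
  have := PrD (P i) mH (mVC mC); rewrite [H `&` _]setIC.
  have -> : H `\` V @^-1` C = V @^-1` (~` C) `&` H.
    by apply/seteqP; split => x [].
  by move=> ->; lra.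
have e0 : Pr P0 (V0 @^-1` (~` C) `&` H0) = Pr P0 H0 - Pr P0 (V0 @^-1` C `&` H0).
  have := PrD P0 mH0 (mVC0 mC); rewrite [H0 `&` _]setIC.
  have -> : H0 `\` V0 @^-1` C = V0 @^-1` (~` C) `&` H0.
    by apply/seteqP; split => x [].
  by move=> ->; lra.
split.
  by apply: eq_limsup_le (limsup_leB t1 c2) => i; rewrite ?e ?e0.
by apply: eq_limsup_le (limsup_leB t2 c1) => i; rewrite ?e ?e0.
Qed.

Let conv_bigcup (G : (set S)^nat) : (forall n, measurable (G n)) ->
  trivIset setT G -> (forall n, conv (G n)) -> conv (\bigcup_k G k).
Proof.
move=> mG tG cG.
pose U N := \big[setU/set0]_(k < N) G k.
have mU N : measurable (U N) by exact: bigsetU_measurable.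
have mC : measurable (\bigcup_k G k) by exact: bigcup_measurable.
have UC N : U N `<=` \bigcup_k G k.
  by rewrite /U -bigcup_mkord => s [k _ Gk]; exists k.
have tail0 (e : R) : 0 < e -> exists N, Pr P0 (V0 @^-1` (\bigcup_k G k `\` U N)) <= e.
  move=> e0.
  have : P0 \o (fun N => V0 @^-1` (U N)) @ \oo --> P0 (V0 @^-1` (\bigcup_k G k)).
    have -> : V0 @^-1` (\bigcup_k G k) = \bigcup_N (V0 @^-1` (U N)).
      apply/seteqP; split => x [n _].
        by move=> Gn; exists n.+1 => //; rewrite /= /U -bigcup_mkord; exists n => /=.
      by rewrite /= => /UC.
    apply: nondecreasing_cvg_mu => //.
    - by move=> n; exact: mVC0.
    - by apply: bigcup_measurable => n _; exact: mVC0.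
    - move=> i j ij; apply/subsetPset; apply: preimage_subset.
      exact: subset_bigsetU.
  rewrite [X in _ --> X]PrE; last exact: mVC0.
  move=> /fine_cvg /= cv.
  have [N /= hN] := filter_ex (cvg_limsup_ge cv e0); exists N.
  have := PrD P0 (mVC0 mC) (mVC0 (mU N)).
  rewrite setIidr; last by apply: preimage_subset; exact: UC.
  move: hN; rewrite -[fine _]/(Pr P0 (V0 @^-1` U N)).
  rewrite -[V0 @^-1` _ `\` V0 @^-1` _]/(V0 @^-1` (\bigcup_k G k `\` U N)).
  lra.
have split_sum dd (T : measurableType dd) (Q : probability T R) (Z : T -> S)
    (K : set T) N : measurable_fun setT Z -> measurable K ->
    \sum_(n < N) Pr Q (Z @^-1` (G n) `&` K) <= Pr Q (Z @^-1` (\bigcup_k G k) `&` K) /\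
    Pr Q (Z @^-1` (\bigcup_k G k) `&` K) <=
      \sum_(n < N) Pr Q (Z @^-1` (G n) `&` K) +
      Pr Q (Z @^-1` (\bigcup_k G k `\` U N)).
  move=> mZ mK; have mZC C : measurable C -> measurable (Z @^-1` C).
    exact: measurable_preimage.
  have -> : \sum_(n < N) Pr Q (Z @^-1` (G n) `&` K) = Pr Q (Z @^-1` (U N) `&` K).
    elim: N => [|N ih]; first by rewrite big_ord0 /U big_ord0 preimage_set0 set0I /Pr measure0.
    rewrite big_ord_recr ih /=.
    have mUK : measurable (Z @^-1` (U N.+1) `&` K) by apply: measurableI => //; exact: mZC.
    rewrite (PrD Q mUK (mZC _ (mU N))); congr (_ + _); congr (Pr Q _).
      apply/seteqP; split => x /=; rewrite /U big_ord_recr /=; tauto.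
    apply/seteqP; split => x /=; rewrite /U big_ord_recr /=.
      move=> [Gx Kx]; split; first by tauto.
      rewrite -bigcup_mkord => -[k /= kN Gk].
      have kE : k = N by apply: tG => //; exists (Z x).
      by rewrite kE ltnn in kN.
    tauto.
  split.
    apply: Pr_le; try by apply: measurableI => //; exact: mZC.
    by move=> x [/UC].
  apply: le_trans (PrU_le _ _ _).
  - apply: Pr_le; first by apply: measurableI => //; exact: mZC.
    + apply: measurableU; first by apply: measurableI => //; exact: mZC.
      by apply: mZC; exact: measurableD.
    + move=> x [Gx Kx]; have [Ux|Ux] := pselect (U N (Z x)); first by left.
      by right.
  - by apply: measurableI => //; exact: mZC.
  - by apply: mZC; exact: measurableD.
split; apply: limsup_le_approx => e e0; have [N hN] := tail0 e e0.
  exists (fun i => \sum_(n < N) Pr (P i) (V @^-1` (G n) `&` H)),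
    (fun=> \sum_(n < N) Pr P0 (V0 @^-1` (G n) `&` H0)); split.
  - by apply: limsup_le_sum => n; case: (cG n).
  - move=> i; have [_] := split_sum _ _ (P i) V H N mV mH.
    rewrite -(same_law_Pr (law i)); last exact: measurableD.
    by move=> /le_trans; apply; rewrite lerD2l.
  - move=> i; have [+ _] := split_sum _ _ P0 V0 H0 N mV0 mH0.
    by move=> /le_trans; apply; rewrite lerDl ltW.
exists (fun=> \sum_(n < N) Pr P0 (V0 @^-1` (G n) `&` H0)),
  (fun i => \sum_(n < N) Pr (P i) (V @^-1` (G n) `&` H)); split.
- by apply: limsup_le_sum => n; case: (cG n).
- move=> i; have [_] := split_sum _ _ P0 V0 H0 N mV0 mH0.
  by move=> /le_trans; apply; rewrite lerD2l.
- move=> i; have [+ _] := split_sum _ _ (P i) V H N mV mH.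
  by move=> /le_trans; apply; rewrite lerDl ltW.
Qed.

(** Convergence on a pi-system does not in general extend to the generated sigma-algebra. It does
    here because the law of [V] is the same for every [i]: the tail of a disjoint union has the same
    small mass for all of them. *)
Lemma dynkin_limsup_eq (G : set (set S)) : @measurable _ S = <<s G >> ->
  setI_closed G ->
  limsup_eq F (fun i => Pr (P i) H) (fun=> Pr P0 H0) ->
  (forall C, G C -> limsup_eq F (fun i => Pr (P i) (V @^-1` C `&` H))
    (fun=> Pr P0 (V0 @^-1` C `&` H0))) ->
  forall C, measurable C -> limsup_eq F (fun i => Pr (P i) (V @^-1` C `&` H))
    (fun=> Pr P0 (V0 @^-1` C `&` H0)).
Proof.
move=> GE GI hT hG C; rewrite GE; move: C; apply: dynkin_induction => //.
- exact: convT.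
- by move=> C mC; apply: convC => //; exact: convT.
Qed.

End convergence_class.

Section joint_convergence.
Context {I : Type} {R : realType} (F : set_system I) {FF : Filter F}.
Context {d1 d2 d3} {W : measurableType d1} {W0 : measurableType d2}
  {S : measurableType d3}.
Variables (P : I -> probability W R) (P0 : probability W0 R).
Variables (V : W -> S) (V0 : W0 -> S) (Y : W -> R) (Y0 : W0 -> R).
Variables (H : set W) (H0 : set W0).
Hypotheses (mV : measurable_fun setT V) (mV0 : measurable_fun setT V0).
Hypotheses (mY : measurable_fun setT Y) (mY0 : measurable_fun setT Y0).
Hypotheses (mH : measurable H) (mH0 : measurable H0).
Hypothesis law : forall i, same_law P0 (fun x => (V0 x, Y0 x)) (P i) (fun x => (V x, Y x)).
Hypothesis HH : limsup_eq F (fun i => Pr (P i) H) (fun=> Pr P0 H0).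

Let law1 i : same_law P0 V0 (P i) V.
Proof.
by move=> A mA; exact: (law i (measurable_preimage measurable_fst mA)).
Qed.

Let law2 i : same_law P0 Y0 (P i) Y.
Proof.
by move=> A mA; exact: (law i (measurable_preimage measurable_snd mA)).
Qed.

(** Two Dynkin inductions. The inner one, with [V in A] absorbed into the event [H], passes from
    rays to Borel sets in [Y]; the outer one passes from rectangles to all measurable sets of
    pairs. *)
Lemma joint_limsup_eq :
  (forall A c, measurable A -> limsup_eq F
     (fun i => Pr (P i) (V @^-1` A `&` [set x | c < Y x] `&` H))
     (fun=> Pr P0 (V0 @^-1` A `&` [set x | c < Y0 x] `&` H0))) ->
  (forall A, measurable A -> limsup_eq F
     (fun i => Pr (P i) (V @^-1` A `&` H)) (fun=> Pr P0 (V0 @^-1` A `&` H0))) ->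
  forall C, measurable C ->
  limsup_eq F (fun i => Pr (P i) ((fun x => (V x, Y x)) @^-1` C `&` H))
    (fun=> Pr P0 ((fun x => (V0 x, Y0 x)) @^-1` C `&` H0)).
Proof.
move=> hAc hA.
apply: (dynkin_limsup_eq _ _ _ _ _ (measurable_prod_measurableType _ _)) => //.
- exact: measurable_fun_pair.
- exact: measurable_fun_pair.
- move=> _ _ [A1 mA1 [B1 mB1 <-]] [A2 mA2 [B2 mB2 <-]].
  exists (A1 `&` A2); first exact: measurableI.
  by exists (B1 `&` B2); [exact: measurableI|rewrite setXI].
move=> _ [A mA [B mB <-]].
have mVA := measurable_preimage mV mA; have mVA0 := measurable_preimage mV0 mA.
have := @dynkin_limsup_eq I R F FF _ _ _ W W0 R P P0 Y Y0
  (V @^-1` A `&` H) (V0 @^-1` A `&` H0) mY mY0 (measurableI _ _ mVA mH)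
  (measurableI _ _ mVA0 mH0) law2 _ (RGenOInfty.measurableE R).
move=> /(_ _ (hA _ mA) _ _ mB).
have e1 (w : set W) B' : Y @^-1` B' `&` (V @^-1` A `&` w) =
    (fun x => (V x, Y x)) @^-1` (A `*` B') `&` w.
  by apply/seteqP; split => x /=; tauto.
have e2 (w : set W0) B' : Y0 @^-1` B' `&` (V0 @^-1` A `&` w) =
    (fun x => (V0 x, Y0 x)) @^-1` (A `*` B') `&` w.
  by apply/seteqP; split => x /=; tauto.
rewrite e2; under eq_fun do rewrite e1; apply.
- move=> _ _ [a ->] [b ->]; exists (Num.max a b).
  by apply/seteqP; split => x /=; rewrite !in_itv/= !andbT gt_max => /andP.
- move=> _ [c ->]; have -> : `]c, +oo[%classic = [set r | c < r].
    by rewrite set_itvE.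
  rewrite e2; under eq_fun do rewrite e1.
  exact: hAc.
Qed.

End joint_convergence.

(** The intervals leave out [a], so they shrink to the empty set even if [X] has an atom at [a]. *)
Lemma small_right_interval {disp} {T : measurableType disp} {R : realType}
    (P : probability T R) (X : T -> R) (a e : R) : measurable_fun setT X ->
  0 < e -> exists2 delta, 0 < delta & Pr P [set x | a < X x /\ X x < a + delta] <= e.
Proof.
move=> mX e0; pose G n := [set x | a < X x /\ X x < a + n.+1%:R^-1].
have mG n : measurable (G n).
  by apply: measurableI; [exact: measurable_gtc_set|exact: measurable_lt_set].
have IG : \bigcap_n G n = set0.
  apply/seteqP; split => // x h; have [ax _] := h 0%N I.
  have ax0 : 0 < X x - a by rewrite subr_gt0.
  have [_] := h (Num.truncn (X x - a)^-1) I; apply/negP; rewrite -leNgt.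
  rewrite -lerBrDl -[leRHS]invrK lef_pV2 ?posrE ?ltr0n ?invr_gt0//.
  by rewrite ltW// truncnS_gt.
have : P \o G @ \oo --> 0%E.
  rewrite -(measure0 P) -IG; apply: nonincreasing_cvg_mu => //.
  - by rewrite ltey_eq fin_num_measure.
  - by rewrite IG.
  - move=> m n mn; apply/subsetPset => x [ax xn]; split => //.
    by apply: lt_le_trans xn _; rewrite lerD2l lef_pV2 ?posrE ?ltr0n// ler_nat.
move=> /fine_cvg /= cv.
have [n /= hn] := filter_ex (cvg_limsup_le cv e0).
exists n.+1%:R^-1; first by rewrite invr_gt0.
by move: hn; rewrite add0r.
Qed.

Section clip.
Context {R : realType}.

(** For positive [delta], a ramp rising from 0 at [a] to [delta] at a + delta; divided by [delta] it
    approximates the indicator of the ray above [a]. Its slope is at most 1, so that r - clip(r) is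
    nondecreasing too. *)
Definition clip (a delta r : R) : R := Num.min delta (Num.max 0 (r - a)).

Lemma clip_ge0 a delta r : 0 <= delta -> 0 <= clip a delta r.
Proof. by move=> d0; rewrite le_min d0 le_max lexx. Qed.

Lemma clip_le a delta r : clip a delta r <= delta.
Proof. by rewrite ge_min lexx. Qed.

Lemma clip_nondecreasing a delta r s : r <= s -> clip a delta r <= clip a delta s.
Proof.
move=> rs; rewrite /clip /Num.min /Num.max.
by repeat case: ifPn; rewrite -?leNgt => *; lra.
Qed.

Lemma subr_clip_nondecreasing a delta r s : r <= s ->
  r - clip a delta r <= s - clip a delta s.
Proof.
move=> rs; rewrite /clip /Num.min /Num.max.
by repeat case: ifPn; rewrite -?leNgt => *; lra.
Qed.

Lemma clip_eq0 a delta r : 0 <= delta -> r <= a -> clip a delta r = 0.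
Proof.
move=> d0 ra; rewrite /clip max_l ?subr_le0// min_r//.
Qed.

Lemma clip_eq a delta r : 0 <= delta -> a + delta <= r -> clip a delta r = delta.
Proof.
move=> d0 ar; rewrite /clip min_l// le_max; apply/orP; right; lra.
Qed.

Lemma measurable_clip a delta : measurable_fun setT (clip a delta).
Proof.
apply: measurable_minr => //; apply: measurable_maxr => //.
exact: measurable_funB.
Qed.

End clip.

(** * Continuous functions of two tuples *)

Section bounded_continuous.
Context {R : realType} {d : nat}.
Variable f : d.-tuple R * d.-tuple R -> R.
Hypothesis cf : continuous (fun p : 'rV[R]_d * 'rV[R]_d =>
  f (tuple_of_rV p.1, tuple_of_rV p.2)).

Definition rV_of_tuple (x : d.-tuple R) : 'rV[R]_d := \row_j tnth x j.

Lemma rV_of_tupleK (x : d.-tuple R) : tuple_of_rV (rV_of_tuple x) = x.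
Proof. by apply: eq_from_tnth => j; rewrite tnth_mktuple mxE. Qed.

Lemma ball_rV (x y : d.-tuple R) (e : R) : 0 < e ->
  (forall j, `|tnth x j - tnth y j| < e) ->
  ball (rV_of_tuple x) e (rV_of_tuple y).
Proof. by move=> e0 h; split => // i j; rewrite !mxE; exact: h. Qed.

Lemma tuple_continuous (x y : d.-tuple R) (e : R) : 0 < e ->
  exists2 delta, 0 < delta & forall x' y' : d.-tuple R,
    (forall j, `|tnth x j - tnth x' j| < delta) ->
    (forall j, `|tnth y j - tnth y' j| < delta) ->
    `|f (x, y) - f (x', y')| < e.
Proof.
move=> e0; have /cvgrPdist_lt/(_ _ e0) := @cf (rV_of_tuple x, rV_of_tuple y).
move=> /nbhs_ballP[delta /= delta0 h]; exists delta => // x' y' hx hy.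
have := h (rV_of_tuple x', rV_of_tuple y'); rewrite /= !rV_of_tupleK; apply.
by split => /=; exact: ball_rV.
Qed.

Let grid (n : nat) (k : int) : R := k%:~R / n.+1%:R.
Let cell (n : nat) (r : R) : int := Num.floor (r * n.+1%:R).

Let grid_dist n r : `|r - grid n (cell n r)| < n.+1%:R^-1 *+ 2.
Proof.
have n0 : 0 < n.+1%:R :> R by rewrite ltr0n.
rewrite /grid /cell; set k := Num.floor _.
have /andP[k1 k2] := floor_itv (r * n.+1%:R).
have -> : r - k%:~R / n.+1%:R = (r * n.+1%:R - k%:~R) / n.+1%:R.
  by rewrite mulrBl mulfK// gt_eqF.
rewrite normrM (ger0_norm (_ : 0 <= n.+1%:R^-1)) ?invr_ge0//.
rewrite -[_^-1 *+ 2]mulr_natl ltr_pM2r ?invr_gt0//.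
move: k2; rewrite intrD ltr_norml; move: k1; lra.
Qed.

(** [f] is the pointwise limit of its values at points rounded to a grid. Each rounded function
    takes countably many values, on cells that are measurable for the coordinate sigma-algebra. *)
Lemma measurable_tuple_continuous : measurable_fun setT f.
Proof.
pose gr n (x : d.-tuple R) : d.-tuple R := [tuple grid n (cell n (tnth x j)) | j < d].
pose fn n (z : d.-tuple R * d.-tuple R) := f (gr n z.1, gr n z.2).
apply: (@measurable_fun_cvg _ _ _ _ fn).
  move=> n _ B mB; rewrite setTI.
  pose K := (d.-tuple int * d.-tuple int)%type.
  pose tg (k : d.-tuple int) : d.-tuple R := [tuple grid n (tnth k j) | j < d].
  pose C (k : d.-tuple int) := [set x : d.-tuple R | forall j, cell n (tnth x j) = tnth k j].
  have mC k : measurable (C k).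
    rewrite (_ : C k = \bigcap_(j in [set: 'I_d]) [set x | cell n (tnth x j) = tnth k j]).
      apply: fin_bigcap_measurable => // j _.
      rewrite (_ : [set x | _] = [set x : d.-tuple R | (tnth k j)%:~R <= tnth x j * n.+1%:R] `&`
          [set x : d.-tuple R | tnth x j * n.+1%:R < (tnth k j + 1)%:~R]).
        have mt : measurable_fun setT (fun x : d.-tuple R => tnth x j * n.+1%:R).
          by apply: measurable_funM => //; exact: measurable_tnth.
        apply: measurableI; first exact: (measurable_le_set (measurable_cst _) mt).
        exact: (measurable_lt_set mt (measurable_cst _)).
      apply/seteqP; split => x /=; rewrite /cell.
        by move=> <-; have /andP[] := floor_itv (tnth x j * n.+1%:R).
      by move=> [h1 h2]; apply: floor_def; rewrite h1.
    by apply/seteqP; split => [x h j _|x h j]; [exact: h|exact: h j I].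
  pose D (m : nat) : set (d.-tuple R * d.-tuple R) :=
    if @choice.unpickle K m is Some k then
      if `[< B (f (tg k.1, tg k.2)) >] then C k.1 `*` C k.2 else set0
    else set0.
  rewrite (_ : _ @^-1` B = \bigcup_m D m).
    apply: bigcup_measurable => m _; rewrite /D.
    case: choice.unpickle => [k|]; last exact: measurable0.
    case: ifP => _; last exact: measurable0.
    exact: measurableX.
  have tgE x k : C k x -> tg k = gr n x.
    by move=> Ck; apply: eq_from_tnth => j; rewrite !tnth_mktuple Ck.
  apply/seteqP; split => [z Bz|z [m _]].
    pose k : K := ([tuple cell n (tnth z.1 j) | j < d], [tuple cell n (tnth z.2 j) | j < d]).
    have C1 : C k.1 z.1 by move=> j; rewrite tnth_mktuple.
    have C2 : C k.2 z.2 by move=> j; rewrite tnth_mktuple.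
    exists (choice.pickle k) => //; rewrite /D choice.pickleK.
    by case: asboolP => //; rewrite (tgE _ _ C1) (tgE _ _ C2).
  rewrite /D; case: choice.unpickle => [k|//]; case: asboolP => // Bk [C1 C2].
  by rewrite /= /fn -(tgE _ _ C1) -(tgE _ _ C2).
move=> [x y] _; apply/cvgrPdist_lt => e e0.
have [delta delta0 h] := tuple_continuous x y e0.
have d2 : 0 < delta / 2 by rewrite divr_gt0.
have /cvgrPdist_lt/(_ _ d2) := @cvg_harmonic R; apply: filterS => n /= hn.
have hd : n.+1%:R^-1 *+ 2 < delta.
  by move: hn; rewrite sub0r normrN ger0_norm// ltr_pdivlMr// mulr_natr.
apply: h => j; rewrite tnth_mktuple; exact: lt_trans (grid_dist _ _) hd.
Qed.

(** Compactness of the box makes the local [delta] uniform. The point [y'] is not confined to the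
    box: it will be the second component of a plan, of which only its closeness to [T x] is
    known. *)
Lemma box_unif_continuous (M e : R) : 0 < e ->
  exists2 delta, 0 < delta & forall x y y' : d.-tuple R,
    (forall j, `|tnth x j| <= M) -> (forall j, `|tnth y j| <= M) ->
    (forall j, `|tnth y j - tnth y' j| < delta) -> `|f (x, y) - f (x, y')| < e.
Proof.
move=> e0; pose A : set 'rV[R]_d := [set v | forall j, `[- M, M]%classic (v ord0 j)].
have cA : compact A.
  by apply: (@rV_compact R d (fun=> `[- M, M]%classic)) => j; exact: segment_compact.
have cAA := compact_setX cA cA.
pose cov := (compact_near_coveringP (A `*` A)).1 cAA.
pose Q (delta : R) (p : 'rV[R]_d * 'rV[R]_d) := forall y' : d.-tuple R,
  (forall j, `|p.2 ord0 j - tnth y' j| < delta) ->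
  `|f (tuple_of_rV p.1, tuple_of_rV p.2) - f (tuple_of_rV p.1, y')| < e.
have local : forall p, (A `*` A) p -> \forall p' \near p & delta \near (0:R)^'+, Q delta p'.
  move=> p _; have e2 : 0 < e / 2 by rewrite divr_gt0.
  have /cvgrPdist_lt/(_ _ e2) := @cf p.
  move=> /nbhs_ballP[r /= r0 h]; have r2 : 0 < r / 2 by rewrite divr_gt0.
  exists (ball p (r / 2), [set delta | delta < r / 2]).
    split; first exact: nbhsx_ballx.
    exact: nbhs_right_lt.
  move=> [p' delta] [/= pp' dr] y' hy.
  have h1 : `|f (tuple_of_rV p.1, tuple_of_rV p.2) - f (tuple_of_rV p'.1, tuple_of_rV p'.2)| < e / 2.
    by apply: h; apply: le_ball pp'; rewrite ler_pdivrMr// ler_pMr// ler1n.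
  have h2 : `|f (tuple_of_rV p.1, tuple_of_rV p.2) - f (tuple_of_rV p'.1, y')| < e / 2.
    have := h (p'.1, rV_of_tuple y'); rewrite /= rV_of_tupleK; apply.
    case: pp' => b1 b2; split => /=.
      by apply: le_ball b1; rewrite ler_pdivrMr// ler_pMr// ler1n.
    rewrite [r]splitr; apply: ball_triangle b2 _; split => // i j; rewrite mxE.
    by rewrite (ord1 i); exact: lt_trans (hy j) dr.
  have := ler_distD (f (tuple_of_rV p.1, tuple_of_rV p.2))
    (f (tuple_of_rV p'.1, tuple_of_rV p'.2)) (f (tuple_of_rV p'.1, y')).
  rewrite [`|f (tuple_of_rV p'.1, _) - f (tuple_of_rV p.1, _)|]distrC; lra.
have hQ : \forall delta \near (0 : R)^'+, A `*` A `<=` Q delta .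
  exact: cov R _ Q _ local.
have [delta [delta0 hd]] : exists delta : R, 0 < delta /\ A `*` A `<=` Q delta.
  have h0 : \forall delta \near (0 : R)^'+, 0 < delta := nbhs_right_gt 0.
  by have [delta [? ?]] := filter_ex (filterI h0 hQ); exists delta.
exists delta => // x y y' xM yM yy.
have inA (v : d.-tuple R) : (forall j, `|tnth v j| <= M) -> A (rV_of_tuple v).
  by move=> vM j; rewrite mxE /= in_itv/= -ler_norml.
have := hd (rV_of_tuple x, rV_of_tuple y) (conj (inA _ xM) (inA _ yM)) y'.
by rewrite /= !rV_of_tupleK; apply => j; rewrite mxE.
Qed.

End bounded_continuous.

(** * Induction on the coordinates *)

Section main_induction.
Context {R : realType} (d : nat) (mu nu : probability (d.-tuple R) R).
Variables mu_ nu_ : forall m : nat, R.-pker (m.-tuple R) ~> R.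
Hypotheses (hmu2 : finite_second_moment mu) (hnu2 : finite_second_moment nu).
Hypotheses (hmu_ : disintegration mu mu_) (hnu_ : disintegration nu nu_).
Hypothesis htarget : H_target d nu_.
Variable T : d.-tuple R -> d.-tuple R.
Hypothesis mT : measurable_fun setT T.
Variable U : forall m : nat, m.-tuple R -> R -> R.
Arguments U : clear implicits.
Hypothesis TU : forall x : d.-tuple R,
  T x = [tuple of rev (KR_coords U [tuple of rev x])].
Hypothesis hU : forall m : nat, (m < d)%N ->
  {ae pushforward mu (@rcoords R d m), forall t,
     monotone_transport (mu_ m t) (nu_ m (KR_coords U t)) (U m t)}.
Context {I : Type} (F : set_system I) {FF : Filter F}.
Variable g : I -> probability (d.-tuple R * d.-tuple R)%type R.
Hypothesis cpl : forall i, coupling mu nu (g i).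

Let plan_space := (d.-tuple R * d.-tuple R)%type.

Let Tfst (z : plan_space) : d.-tuple R := T z.1.

Let mTfst : measurable_fun setT Tfst.
Proof. exact: (measurableT_comp mT measurable_fst). Qed.

Let mR (m : nat) : measurable_fun setT (@rcoords R d m) := @measurable_rcoords R d m.
Let mr (m : nat) : measurable_fun setT (@rcoord R d m) := @measurable_rcoord R d m.

Let mRT m : measurable_fun setT (@rcoords R d m \o T).
Proof. exact: (measurableT_comp (@mR m) mT). Qed.

Let mrT m : measurable_fun setT (@rcoord R d m \o T).
Proof. exact: (measurableT_comp (@mr m) mT). Qed.

Let lawT : same_law mu T nu id := KR_law hmu_ hnu_ mT TU hU.

Let law1 i : same_law mu id (g i) fst := coupling_fst (cpl i).
Let law2 i : same_law nu id (g i) snd := coupling_snd (cpl i).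

Let lawTfst i : same_law nu id (g i) Tfst.
Proof.
move=> B mB; rewrite -(lawT mB).
exact: (law1 i (measurable_preimage mT mB)).
Qed.

Definition agree (B : set (d.-tuple R)) : Prop := asymp_agree F g snd Tfst B.

Definition agree_upto (m : nat) : Prop :=
  forall n c, (n < m)%N -> agree [set y | c < rcoord n y].

Lemma agree_rcoords (m : nat) (B : set (m.-tuple R)) : agree_upto m ->
  measurable B -> agree (rcoords m @^-1` B).
Proof.
move=> am; move: B.
apply: (tuple_sigma_ind (G := [set B | agree (@rcoords R d m @^-1` B)])).
  apply: (@sigma_algebra_comap _ _ (@rcoords R d m) agree).
  exact: (asymp_agree_sigma_algebra measurable_snd mTfst law2 lawTfst).
move=> n c /=; rewrite (_ : _ @^-1` _ = [set y | c < rcoord n y]).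
  exact: am.
by apply/seteqP; split => x /=; rewrite tnth_rcoords.
Qed.

Section level.
Variables (m : nat) (md : (m < d)%N).
Hypothesis am : agree_upto m.


Let mRP : measurable_fun setT (@rpair R d m) := @measurable_rpair R d m.

Let law_rpair i : same_law mu (@rpair R d m) (g i) (@rpair R d m \o fst).
Proof. by move=> B mB; exact: (law1 i (measurable_preimage mRP mB)). Qed.

Let law_snd i : same_law nu (@rcoord R d m) (g i) (@rcoord R d m \o snd).
Proof. by move=> B mB; exact: (law2 i (measurable_preimage (@mr m) mB)). Qed.

Let law_KR : same_law nu (@rcoord R d m) mu (@rcoord R d m \o T).
Proof. by move=> B mB; rewrite -(lawT (measurable_preimage (@mr m) mB)). Qed.

(* The key one-sided estimate: at the level of up-sets, the limit plan cannot
   beat the monotone coupling of the conditional laws. *)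
Lemma upward_limsup_le (A : set (m.-tuple R * R)) (B : set R) :
  measurable A -> measurable B ->
  (forall t, upward_on setT (xsection A t)) -> upward_on setT B ->
  limsup_le F
    (fun i => Pr (g i) [set z | A (rpair m z.1) /\ B (rcoord m z.2)])
    (fun=> Pr mu [set x | A (rpair m x) /\ B (rcoord m (T x))]).
Proof.
move=> mA mB uA uB.
pose p t := Pr (kprob (mu_ m) t) (xsection A t).
pose q t := Pr (kprob (nu_ m) (KR_coords U t)) B.
have mp : measurable_fun setT p by exact: measurable_Pr_xsection.
have mKR : measurable_fun setT (@KR_coords R U m).
  exact: (measurable_KR_coords mT TU (ltnW md)).
have mq : measurable_fun setT q.
  exact: (measurableT_comp (measurable_Pr_kprob (nu_ m) mB) mKR).
(* Over [S] the event on x is the smaller of the two, off [S] the event on T x is. *)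
pose S := [set t | p t <= q t].
have mS : measurable S by exact: measurable_le_set.
(* The complement of [S] becomes a condition [C] on the upper coordinates of T x, where it can be
   compared with the same condition on y. *)
have [C [N [mC mN N0 SC]]] :=
  KR_invertible hmu_ hnu_ htarget mT TU hU md (measurableC mS).
have [N1 [mN1 N10 good]] := monotone_transport_ae TU hU md.
pose UB := [set s : m.-tuple R * R | B (U m s.1 s.2)].
have mUB : measurable UB.
  exact: (measurable_preimage (measurable_KR_coord mT TU md) mB).
have mSf : measurable [set s : m.-tuple R * R | S s.1].
  exact: (measurable_preimage measurable_fst mS).
have nest x : ~ N1 x -> let t := rcoords m x in
    Pr (kprob (mu_ m) t) (xsection A t `&` xsection UB t) = Num.min (p t) (q t) /\
    Pr (kprob (mu_ m) t) (xsection UB t) = q t.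
  move=> /good[[D [mD D0 mono]] push] t.
  have qE : Pr (kprob (mu_ m) t) (xsection UB t) = q t.
    rewrite /q -(rcoords_KR TU x (ltnW md)) /Pr -push//.
    by congr (fine (kprob _ _ _)); apply/seteqP; split => r; rewrite xsectionE.
  split => //; rewrite -qE; apply: (Pr_upward_setI mD D0).
  - exact: measurable_xsection.
  - exact: measurable_xsection.
  - by move=> r s _ _; exact: uA.
  - move=> r s Dr Ds rs; rewrite !xsectionE /UB /= => Br.
    by apply: (uB _ _ Logic.I Logic.I _ Br); exact: mono.
(* In almost every fibre the two up-sets are nested, so the smaller probability identifies the
   smaller set up to null sets: [A] lies in [UB] over [S], and [UB] in [A] off [S]. *)
have null1 : mu (@rpair R d m @^-1` ([set s | S s.1] `&` (A `\` UB))) = 0%E.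
  apply: (disintegration_null hmu_ md mN1 N10).
    by apply: measurableI => //; exact: measurableD.
  move=> x /nest /=; set t := rcoords m x => -[h1 h2].
  have [St|St] := pselect (S t); last first.
    rewrite (_ : xsection _ _ = set0) ?measure0//.
    by apply/seteqP; split => r; rewrite xsectionE //= => -[].
  rewrite (_ : xsection _ _ = xsection A t `\` xsection UB t); last first.
    by apply/seteqP; split => r; rewrite !xsectionE /=; [case|move=> h; split].
  have mA' : measurable (xsection A t) by exact: measurable_xsection.
  have mU' : measurable (xsection UB t) by exact: measurable_xsection.
  rewrite PrE; last exact: measurableD.
  have := PrD (kprob (mu_ m) t) mA' mU'; rewrite h1 min_l//.
  by rewrite -/(p t) => /eqP; rewrite -subr_eq0 opprD addrA subrr sub0r oppr_eq0 => /eqP ->.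
have null2 : mu (@rpair R d m @^-1` (~` [set s | S s.1] `&` (UB `\` A))) = 0%E.
  apply: (disintegration_null hmu_ md mN1 N10).
    by apply: measurableI; [exact: measurableC|exact: measurableD].
  move=> x /nest /=; set t := rcoords m x => -[h1 h2].
  have [St|St] := pselect (S t).
    rewrite (_ : xsection _ _ = set0) ?measure0//.
    by apply/seteqP; split => r; rewrite xsectionE //= => -[].
  rewrite (_ : xsection _ _ = xsection UB t `\` xsection A t); last first.
    by apply/seteqP; split => r; rewrite !xsectionE /=; [case|move=> h; split].
  have mA' : measurable (xsection A t) by exact: measurable_xsection.
  have mU' : measurable (xsection UB t) by exact: measurable_xsection.
  rewrite PrE; last exact: measurableD.
  have := PrD (kprob (mu_ m) t) mU' mA'; rewrite setIC h1 min_r; last first.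
    by move/negP: St; rewrite -ltNge => /ltW.
  by rewrite h2 => /eqP; rewrite -subr_eq0 opprD addrA subrr sub0r oppr_eq0 => /eqP ->.
have UBE x : UB (rpair m x) <-> B (rcoord m (T x)).
  by rewrite (rcoord_KR TU x md).
have [mC' agC] := agree_rcoords am mC.
pose XA := [set x : d.-tuple R | A (rpair m x)].
pose XS := [set x : d.-tuple R | S (rcoords m x)].
pose XB := [set x : d.-tuple R | B (rcoord m (T x))].
pose YB := [set x : d.-tuple R | B (rcoord m x)].
pose YC := [set x : d.-tuple R | C (rcoords m x)].
have mXA : measurable XA by exact: measurable_preimage mRP mA.
have mXS : measurable XS by exact: measurable_preimage (@mR m) mS.
have mXB : measurable XB by exact: measurable_preimage (@mrT m) mB.
have mYB : measurable YB by exact: measurable_preimage (@mr m) mB.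
have mYC : measurable YC by exact: measurable_preimage (@mR m) mC.
have e1 : Pr mu (XA `&` XS) = Pr mu (XA `&` XB `&` XS).
  apply: (Pr_ae_eq (N := rpair m @^-1` ([set s | S s.1] `&` (A `\` UB)))) => //.
  - apply: measurable_preimage mRP _; apply: measurableI => //; exact: measurableD.
  - exact: measurableI.
  - by apply: measurableI => //; exact: measurableI.
  - move=> x /= h; split; last by rewrite /XA /XB /XS /=; tauto.
    rewrite /XA /XB /XS /= => -[Ax Sx]; split => //; split => //.
    by apply/UBE; apply: contrapT => nB; apply: h; split.
have e2 : Pr mu (XB `&` ~` XS) = Pr mu (XA `&` XB `\` XS).
  apply: (Pr_ae_eq (N := rpair m @^-1` (~` [set s | S s.1] `&` (UB `\` A)))) => //.
  - apply: measurable_preimage mRP _; apply: measurableI; [exact: measurableC|exact: measurableD].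
  - by apply: measurableI => //; exact: measurableC.
  - by apply: measurableD => //; exact: measurableI.
  - move=> x /= h; split; last by rewrite /XA /XB /XS /=; tauto.
    rewrite /XA /XB /XS /= => -[/UBE Bx Sx]; split => //; split; last exact/UBE.
    by apply: contrapT => nA; apply: h; split.
have e3 : Pr mu (XB `&` ~` XS) = Pr nu (YC `&` YB).
  rewrite /Pr -(lawT (measurableI _ _ mYC mYB)).
  rewrite -[LHS]/(Pr mu _) -[RHS]/(Pr mu _); apply: (Pr_ae_eq mN N0).
  - by apply: measurableI => //; exact: measurableC.
  - exact: (measurable_preimage mT (measurableI _ _ mYC mYB)).
  - by move=> x /SC h; split => [[Bx /h Cx]|[/h Cx Bx]]; split.
have eK : Pr mu (XA `&` XB) = Pr mu (XA `&` XS) + Pr nu (YC `&` YB).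
  by rewrite -e3 e1 e2; apply: PrD => //; exact: measurableI.
have -> : [set x | A (rpair m x) /\ B (rcoord m (T x))] = XA `&` XB by [].
have mf (V : set (d.-tuple R)) : measurable V -> measurable ((fst : plan_space -> _) @^-1` V).
  exact: measurable_preimage measurable_fst.
have ms (V : set (d.-tuple R)) : measurable V -> measurable ((snd : plan_space -> _) @^-1` V).
  exact: measurable_preimage measurable_snd.
have agC' := asymp_agree_sym measurable_snd mTfst law2 lawTfst (agree_rcoords am mC).
move=> e e0; near=> i.
have hC : Pr (g i) (Tfst @^-1` (rcoords m @^-1` C) `\` snd @^-1` (rcoords m @^-1` C)) <= 0 + e.
  by near: i; exact: agC'.
have mTC : measurable (Tfst @^-1` (rcoords m @^-1` C)).
  exact: measurable_preimage mTfst mYC.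
(* Over [S] only the event on x is kept. Off [S], either y satisfies [C] and only events on y are
   kept, or T x satisfies [C] and y does not, which is asymptotically negligible. *)
have b1 : Pr (g i) [set z | A (rpair m z.1) /\ B (rcoord m z.2)] <=
    Pr (g i) (fst @^-1` (XA `&` XS) `|` (snd @^-1` (YC `&` YB) `|`
     ((Tfst @^-1` (rcoords m @^-1` C) `\` snd @^-1` (rcoords m @^-1` C)) `|`
      fst @^-1` N))).
  apply: Pr_le.
  - by apply: measurableI; [exact: mf mXA|exact: ms mYB].
  - apply: measurableU; first by apply: mf; exact: measurableI.
    apply: measurableU; first by apply: ms; exact: measurableI.
    by apply: measurableU; [apply: measurableD => //; exact: ms mYC|exact: mf].
  - move=> z [Az Bz]; have [Sz|Sz] := pselect (S (rcoords m z.1)); first by left.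
    right; have [Nz|Nz] := pselect (N z.1); first by right; right.
    have [Cz|Cz] := pselect (C (rcoords m z.2)); first by left.
    by right; left; split => //; exact/(SC _ Nz).
have b2 := PrU_le (g i) (mf _ (measurableI _ _ mXA mXS))
  (measurableU _ _ (ms _ (measurableI _ _ mYC mYB)) (measurableU _ _
    (measurableD mTC (ms _ mYC)) (mf _ mN))).
have b3 := PrU_le (g i) (ms _ (measurableI _ _ mYC mYB)) (measurableU _ _
    (measurableD mTC (ms _ mYC)) (mf _ mN)).
have b4 := PrU_le (g i) (measurableD mTC (ms _ mYC)) (mf _ mN).
have b5 : Pr (g i) (fst @^-1` N) = 0 by rewrite /Pr -(law1 i mN) N0.
have b6 := same_law_Pr (law1 i) (measurableI _ _ mXA mXS).
have b7 := same_law_Pr (law2 i) (measurableI _ _ mYC mYB).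
rewrite preimage_id in b6; rewrite preimage_id in b7.
rewrite eK b6 b7; apply: (le_trans b1); apply: (le_trans b2).
rewrite -addrA lerD2l; apply: (le_trans b3); rewrite lerD2l.
by apply: (le_trans b4); rewrite b5 addr0; move: hC; rewrite add0r.
Unshelve. all: by end_near. Qed.

(** Under the resampled plan the joint tail is E[min(p(x), q(y))], with p and q the conditional
    tails given the upper coordinates, while for T it is at most E[min(p(x), q(T x))], a joint
    probability never exceeding either marginal one. The two expectations differ by at most E|q(y) -
    q(T x)|, which tends to 0 by agreement on the upper coordinates. *)
Lemma resample_limsup_ge (c c' : R) : limsup_le F
  (fun=> Pr mu [set x | c < rcoord m x /\ c' < rcoord m (T x)])
  (fun i => Pr (product_probability (g i) unif)
     [set w | c < (resample2 mu_ nu_ m w).1 /\ c' < (resample2 mu_ nu_ m w).2]).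
Proof.
pose p t := Pr (kprob (mu_ m) t) [set r | c < r].
pose q t := Pr (kprob (nu_ m) t) [set r | c' < r].
have mp : measurable_fun setT p by apply: measurable_Pr_kprob; exact: measurable_gt_ray.
have mq : measurable_fun setT q by apply: measurable_Pr_kprob; exact: measurable_gt_ray.
have p1 t : `|p t| <= 1 by apply: Pr_kprob_bound; exact: measurable_gt_ray.
have q1 t : `|q t| <= 1 by apply: Pr_kprob_bound; exact: measurable_gt_ray.
pose C := [set s : m.-tuple R * R | c < s.2 /\ c' < U m s.1 s.2].
have mC : measurable C.
  apply: measurableI; apply: measurable_gtc_set; first exact: measurable_snd.
  exact: (measurable_KR_coord mT TU md).
pose h (y : d.-tuple R) := q (rcoords m y).
have mh : measurable_fun setT h by exact: (measurableT_comp mq (@mR m)).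
have mpx : measurable_fun setT (fun x : d.-tuple R => p (rcoords m x)).
  exact: (measurableT_comp mp (@mR m)).
have mmin dd (W : measurableType dd) (u v : W -> R) :
    measurable_fun setT u -> measurable_fun setT v ->
    (forall w, `|u w| <= 1) -> (forall w, `|v w| <= 1) ->
    forall Q : probability W R, L1 Q (fun w => Num.min (u w) (v w)).
  move=> mu' mv' u1 v1 Q; apply: (@L1_bounded _ _ _ _ _ 1).
    exact: measurable_minr.
  by move=> w; rewrite /Num.min; case: ifP.
have [N [mN N0 good]] := monotone_transport_ae TU hU md.
have L1mu : L1 mu (fun x => Num.min (p (rcoords m x)) (h (T x))).
  apply: mmin => [||x|x]; [exact: mpx| |exact: p1|exact: q1].
  exact: (measurableT_comp mh mT).
have lhs : Pr mu [set x | c < rcoord m x /\ c' < rcoord m (T x)] <=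
    E mu (fun x => Num.min (p (rcoords m x)) (h (T x))).
  have -> : [set x | c < rcoord m x /\ c' < rcoord m (T x)] = @rpair R d m @^-1` C.
    by apply/seteqP; split => x; rewrite /C /= (rcoord_KR TU x md).
  rewrite (disintegration_Pr hmu_ md mC); apply: (ae_le_E mN N0).
  - apply: (@L1_bounded _ _ _ _ _ 1).
      exact: (measurableT_comp (measurable_Pr_xsection (mu_ m) mC) (@mR m)).
    by move=> x; exact: (Pr_kprob_bound (mu_ m) _ (measurable_xsection _ mC)).
  - exact: L1mu.
  - move=> x /good[_ push]; rewrite le_min; apply/andP; split.
      apply: Pr_le; [exact: measurable_xsection|exact: measurable_gt_ray|].
      by move=> r; rewrite xsectionE /C /= => -[].
    rewrite /h /q /Pr -push; last exact: measurable_gt_ray.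
    set a := kprob (mu_ m) _; rewrite -!/(Pr a _).
    apply: Pr_le; first exact: measurable_xsection.
      exact: (measurable_preimage (measurable_KR_section mT TU _ md)
        (measurable_gt_ray c')).
    by move=> r; rewrite xsectionE /C /= => -[].
have rhs i : Pr (product_probability (g i) unif)
     [set w | c < (resample2 mu_ nu_ m w).1 /\ c' < (resample2 mu_ nu_ m w).2] =
    E (g i) (fun z => Num.min (p (rcoords m z.1)) (h z.2)).
  have m2 := @measurable_resample2 R d mu_ nu_ m.
  rewrite product_probability_Pr; last first.
    apply: measurableI; apply: measurable_gtc_set.
      exact: (measurableT_comp measurable_fst m2).
    exact: (measurableT_comp measurable_snd m2).
  congr E; apply/funext => z; rewrite -unif_kquantile_gt2; congr Pr.
  by apply/seteqP; split => s; rewrite xsectionE.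
have h2 : L2 nu h by apply: (L2_bounded nu mh) => y; exact: q1.
have hc k : agree [set y | k < h y].
  by apply: (agree_rcoords am (B := [set t | k < q t])); exact: measurable_gtc_set.
have lim := asymp_agree_E_abs measurable_snd mTfst law2 lawTfst h2 hc.
move=> e e0; near=> i.
have h0 : E (g i) (fun w => `|h w.2 - h (Tfst w)|) <= 0 + e.
  by near: i; exact: lim.
rewrite rhs; apply: (le_trans lhs).
have mpz : measurable_fun setT (fun z : plan_space => p (rcoords m z.1)).
  exact: (measurableT_comp mpx measurable_fst).
have mh2 : measurable_fun setT (fun z : plan_space => h z.2).
  exact: (measurableT_comp mh measurable_snd).
have mhT : measurable_fun setT (fun z : plan_space => h (Tfst z)).
  exact: (measurableT_comp mh mTfst).
have -> : E mu (fun x => Num.min (p (rcoords m x)) (h (T x))) =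
    E (g i) (fun z => Num.min (p (rcoords m z.1)) (h (Tfst z))).
  apply: (same_law_E (X1 := id) (h := fun x => Num.min (p (rcoords m x)) (h (T x)))
    (@measurable_id _ _ _) measurable_fst (law1 i)).
    by apply: measurable_minr => //; exact: (measurableT_comp mh mT).
  exact: L1mu.
have L1m : L1 (g i) (fun z => Num.min (p (rcoords m z.1)) (h z.2)).
  by apply: mmin => // z; exact: q1.
have L1d : L1 (g i) (fun w => `|h w.2 - h (Tfst w)|).
  apply: (@L1_bounded _ _ _ _ _ 2).
    by apply: measurableT_comp => //; exact: measurable_funB.
  move=> w; rewrite normr_id; apply: (le_trans (ler_normB _ _)).
  have := q1 (rcoords m w.2); have := q1 (rcoords m (Tfst w)); rewrite /h; lra.
apply: (@le_trans _ _ (E (g i) (fun z => Num.min (p (rcoords m z.1)) (h z.2) +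
    `|h z.2 - h (Tfst z)|))).
  have L1T : L1 (g i) (fun z => Num.min (p (rcoords m z.1)) (h (Tfst z))).
    by apply: mmin => // z; exact: q1.
  apply: Ele => // [|z]; first exact: L1D.
  rewrite -lerBlDr le_min; apply/andP; split.
    rewrite lerBlDr; apply: (@le_trans _ _ (p (rcoords m z.1))).
      by rewrite ge_min lexx.
    by rewrite lerDl.
  rewrite lerBlDr; apply: (@le_trans _ _ (h (Tfst z))).
    by rewrite ge_min lexx orbT.
  by rewrite -lerBlDl distrC ler_norm.
rewrite ED//.
by rewrite lerD2l; move: h0; rewrite add0r.
Unshelve. all: by end_near. Qed.

Let rm2_mu : L2 mu (@rcoord R d m).
Proof.
rewrite (_ : @rcoord R d m = fun x => tnth x (rev_ord (Ordinal md))).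
  exact: L2_tnth.
by apply/funext => x; exact: rcoord_tnth.
Qed.

Let rm2_nu : L2 nu (@rcoord R d m).
Proof.
rewrite (_ : @rcoord R d m = fun x => tnth x (rev_ord (Ordinal md))).
  exact: L2_tnth.
by apply/funext => x; exact: rcoord_tnth.
Qed.

Let law_fst i : same_law mu (@rcoord R d m) (g i) (@rcoord R d m \o fst).
Proof. by move=> B mB; exact: (law1 i (measurable_preimage (@mr m) mB)). Qed.

(** The second moments of each variable are fixed by the marginals, so a comparison of quadratic
    costs is a comparison of mixed moments, with a factor -2 that explains the tolerance 2e. *)
Lemma mixed_moment_lower :
  limsup_le F (fun i => E (g i) (fun z => (rcoord m z.1 - rcoord m z.2) ^+ 2))
    (fun i => E (product_probability (g i) unif)
      (fun w => ((resample2 mu_ nu_ m w).1 - (resample2 mu_ nu_ m w).2) ^+ 2)) ->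
  limsup_le F (fun=> E mu (fun x => rcoord m x * rcoord m (T x)))
    (fun i => E (g i) (fun z => rcoord m z.1 * rcoord m z.2)).
Proof.
move=> opt.
pose X1 (w : plan_space * R) := (resample2 mu_ nu_ m w).1.
pose X2 (w : plan_space * R) := (resample2 mu_ nu_ m w).2.
have m2 := @measurable_resample2 R d mu_ nu_ m.
have mX1 : measurable_fun setT X1 by exact: (measurableT_comp measurable_fst m2).
have mX2 : measurable_fun setT X2 by exact: (measurableT_comp measurable_snd m2).
have lX1 i : same_law mu (@rcoord R d m) (product_probability (g i) unif) X1.
  have [l1 _] := coupling_partial m (cpl i).
  move=> B mB.
  exact: (resample_law hmu_ measurable_fst md l1 (measurable_preimage measurable_snd mB)).
have lX2 i : same_law nu (@rcoord R d m) (product_probability (g i) unif) X2.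
  have [_ l2] := coupling_partial m (cpl i).
  move=> B mB.
  exact: (resample_law hnu_ measurable_snd md l2 (measurable_preimage measurable_snd mB)).
have lower : limsup_le F (fun=> E mu (fun x => rcoord m x * rcoord m (T x)))
    (fun i => E (product_probability (g i) unif) (fun w => X1 w * X2 w)).
  apply: (limsup_le_mixed_moment (P := fun=> mu) (Y := @rcoord R d m \o T)
    (Q1 := mu) (A := @rcoord R d m) (Q2 := nu) (B := @rcoord R d m)) => //.
  move=> c c'; exact: resample_limsup_ge.
apply: limsup_le_trans lower _.
have msq : measurable_fun setT (fun r : R => r ^+ 2) by exact: exprn_measurable.
have [_ sq_mu] := rm2_mu; have [_ sq_nu] := rm2_nu.
have mrf : measurable_fun setT (@rcoord R d m \o (fst : plan_space -> _)).
  exact: (measurableT_comp (@mr m) measurable_fst).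
have mrs : measurable_fun setT (@rcoord R d m \o (snd : plan_space -> _)).
  exact: (measurableT_comp (@mr m) measurable_snd).
have idm : measurable_fun setT (id : R -> R) by exact: measurable_id.
move=> e e0; have e2 : 0 < 2 * e by rewrite mulr_gt0.
near=> i.
have h : E (g i) (fun z => (rcoord m z.1 - rcoord m z.2) ^+ 2) <=
    E (product_probability (g i) unif) (fun w => (X1 w - X2 w) ^+ 2) + 2 * e.
  by near: i; exact: opt.
have b1 := same_law_L2 (h := id) (@mr m) mrf (law_fst i) idm rm2_mu.
have b2 := same_law_L2 (h := id) (@mr m) mrs (law_snd i) idm rm2_nu.
have b3 := same_law_L2 (h := id) (@mr m) mX1 (lX1 i) idm rm2_mu.
have b4 := same_law_L2 (h := id) (@mr m) mX2 (lX2 i) idm rm2_nu.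
move: h; have /= -> := E_sqrB b1 b2; have /= -> := E_sqrB b3 b4.
have /= <- := same_law_E (@mr m) mrf (law_fst i) msq sq_mu.
have /= <- := same_law_E (@mr m) mrs (law_snd i) msq sq_nu.
have /= <- := same_law_E (@mr m) mX1 (lX1 i) msq sq_mu.
have /= <- := same_law_E (@mr m) mX2 (lX2 i) msq sq_nu.
lra.
Unshelve. all: by end_near. Qed.

(** The sets [c < f] and [c' < psi] are up-sets in the last coordinate, so [upward_limsup_le] bounds
    every joint tail. No monotonicity in the upper coordinates is involved. *)
Lemma monotone_limsup_le (f : m.-tuple R * R -> R) (psi : R -> R) :
  measurable_fun setT f -> measurable_fun setT psi ->
  (forall t r s, r <= s -> f (t, r) <= f (t, s)) ->
  (forall r s, r <= s -> psi r <= psi s) ->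
  L2 mu (f \o @rpair R d m) -> L2 nu (psi \o @rcoord R d m) ->
  limsup_le F (fun i => E (g i) (fun z => f (rpair m z.1) * psi (rcoord m z.2)))
    (fun=> E mu (fun x => f (rpair m x) * psi (rcoord m (T x)))).
Proof.
move=> mf mpsi fnd psind f2 psi2.
have mfr : measurable_fun setT (f \o @rpair R d m) by exact: measurableT_comp.
have mpr : measurable_fun setT (psi \o @rcoord R d m).
  exact: (measurableT_comp mpsi (@mr m)).
apply: (limsup_le_mixed_moment (X := (f \o @rpair R d m) \o fst)
  (Y := (psi \o @rcoord R d m) \o snd) (P' := fun=> mu)
  (X' := f \o @rpair R d m) (Y' := (psi \o @rcoord R d m) \o T)
  (Q1 := mu) (A := f \o @rpair R d m) (Q2 := nu) (B := psi \o @rcoord R d m)) => //.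
- exact: (measurableT_comp mfr measurable_fst).
- exact: (measurableT_comp mpr measurable_snd).
- exact: (measurableT_comp mpr mT).
- by move=> i B mB; exact: (law1 i (measurable_preimage mfr mB)).
- by move=> i B mB; exact: (law2 i (measurable_preimage mpr mB)).
- by move=> i B mB; rewrite -(lawT (measurable_preimage mpr mB)).
- move=> c c'; apply: (upward_limsup_le (A := [set s | c < f s]) (B := [set r | c' < psi r])).
  + exact: measurable_gtc_set.
  + exact: measurable_gtc_set.
  + by move=> t r s _ _ rs; rewrite !xsectionE /= => /lt_le_trans; apply; exact: fnd.
  + by move=> r s _ _ rs /= /lt_le_trans; apply; exact: psind.
Qed.

Section level_conclusion.
Hypothesis lower : limsup_le F (fun=> E mu (fun x => rcoord m x * rcoord m (T x)))
    (fun i => E (g i) (fun z => rcoord m z.1 * rcoord m z.2)).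

Section clipped.
Variables (A : set (m.-tuple R)) (mA : measurable A) (a b delta : R).
Hypothesis delta0 : 0 < delta.

(** The factor [\1_A] localizes to a set of upper coordinates; in each fibre it is 0 or 1, so [f]
    and [s.2 - f s] remain nondecreasing in the last coordinate. *)
Let f (s : m.-tuple R * R) : R := \1_A s.1 * clip a delta s.2.
Let psi : R -> R := clip b delta.

Let mf : measurable_fun setT f.
Proof.
have m1 : measurable_fun setT (\1_A : m.-tuple R -> R) by exact: measurable_indic.
apply: measurable_funM; first exact: (measurableT_comp m1 measurable_fst).
exact: (measurableT_comp (measurable_clip a delta) measurable_snd).
Qed.

Let mpsi : measurable_fun setT psi. Proof. exact: measurable_clip. Qed.

Let indic01 (t : m.-tuple R) : \1_A t = 0 :> R \/ \1_A t = 1 :> R.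
Proof. by rewrite indicE; case: (_ \in _); [right|left]. Qed.

Let fnd t r s : r <= s -> f (t, r) <= f (t, s).
Proof.
move=> rs; rewrite /f /=; case: (indic01 t) => ->; rewrite ?mul0r ?mul1r//.
exact: clip_nondecreasing.
Qed.

Let subfnd t r s : r <= s -> r - f (t, r) <= s - f (t, s).
Proof.
move=> rs; rewrite /f /=; case: (indic01 t) => ->; rewrite ?mul0r ?subr0 ?mul1r//.
exact: subr_clip_nondecreasing.
Qed.

Let f_ge0 s : 0 <= f s.
Proof.
by rewrite /f; case: (indic01 s.1) => ->; rewrite ?mul0r ?mul1r// clip_ge0// ltW.
Qed.

Let psi_ge0 r : 0 <= psi r. Proof. by rewrite /psi clip_ge0// ltW. Qed.

Let f_bound s : `|f s| <= delta.
Proof.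
rewrite ger0_norm// /f.
by case: (indic01 s.1) => ->; rewrite ?mul0r ?mul1r ?clip_le// ltW.
Qed.

Let psi_bound r : `|psi r| <= delta.
Proof. by rewrite /psi ger0_norm ?clip_le// clip_ge0// ltW. Qed.

(* Both terms of id = clip + (id - clip) are nondecreasing, so optimality of
   the total moment forces equality in each monotone piece. *)
Lemma clip_limsup_eq : limsup_eq F
  (fun i => E (g i) (fun z => f (rpair m z.1) * psi (rcoord m z.2)))
  (fun=> E mu (fun x => f (rpair m x) * psi (rcoord m (T x)))).
Proof.
have f2 : L2 mu (f \o @rpair R d m).
  apply: (L2_bounded mu) => [|x]; first exact: (measurableT_comp mf mRP).
  exact: f_bound.
have psi2 : L2 nu (psi \o @rcoord R d m).
  apply: (L2_bounded nu) => [|x]; first exact: (measurableT_comp mpsi (@mr m)).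
  exact: psi_bound.
have f2' : L2 mu ((fun s => s.2 - f s) \o @rpair R d m) by exact: (L2B rm2_mu f2).
have psi2' : L2 nu ((fun r => r - psi r) \o @rcoord R d m).
  exact: (L2B rm2_nu psi2).
have id2 : L2 mu ((fun s : m.-tuple R * R => s.2) \o @rpair R d m) by exact: rm2_mu.
have idn2 : L2 nu (id \o @rcoord R d m) by exact: rm2_nu.
have ms : measurable_fun setT (fun s : m.-tuple R * R => s.2) by exact: measurable_snd.
have mid : measurable_fun setT (id : R -> R) by exact: measurable_id.
have mf' : measurable_fun setT (fun s : m.-tuple R * R => s.2 - f s) by exact: measurable_funB.
have mpsi' : measurable_fun setT (fun r : R => r - psi r) by exact: measurable_funB.
have psind r s : r <= s -> psi r <= psi s by exact: clip_nondecreasing.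
have psind' r s : r <= s -> r - psi r <= s - psi s by exact: subr_clip_nondecreasing.
split; first exact: monotone_limsup_le.
have h1 := monotone_limsup_le mf mpsi' (fun t r s => @fnd t r s) psind' f2 psi2'.
have idnd (r s : R) : r <= s -> id r <= id s by [].
have h2 := monotone_limsup_le mf' mid (fun t r s => @subfnd t r s) idnd f2' idn2.
(* E[f psi] = E[x y] - E[f (y - psi)] - E[(x - f) y], where the first moment is bounded below and
   the two subtracted ones above. *)
have key := limsup_leB (FF := FF) (limsup_leB (FF := FF) lower h1) h2.
have e1 (Q : probability plan_space R) (X1 X2 : plan_space -> d.-tuple R) :
    L2 Q (f \o @rpair R d m \o X1) -> L2 Q (@rcoord R d m \o X1) ->
    L2 Q (psi \o @rcoord R d m \o X2) -> L2 Q (@rcoord R d m \o X2) ->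
    E Q (fun z => f (rpair m (X1 z)) * psi (rcoord m (X2 z))) =
    E Q (fun z => rcoord m (X1 z) * rcoord m (X2 z)) -
    E Q (fun z => f (rpair m (X1 z)) * (rcoord m (X2 z) - psi (rcoord m (X2 z)))) -
    E Q (fun z => (rcoord m (X1 z) - f (rpair m (X1 z))) * rcoord m (X2 z)).
  move=> a1 a2 a3 a4.
  have c1 := L2_L1 a2 a4; have c2 := L2_L1 a1 (L2B a4 a3); have c3 := L2_L1 (L2B a2 a1) a4.
  rewrite -EB// -EB//; last exact: L1B.
  by congr E; apply/funext => z; rewrite /=; ring.
have e2 : E mu (fun x => f (rpair m x) * psi (rcoord m (T x))) =
    E mu (fun x => rcoord m x * rcoord m (T x)) -
    E mu (fun x => f (rpair m x) * (rcoord m (T x) - psi (rcoord m (T x)))) -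
    E mu (fun x => (rcoord m x - f (rpair m x)) * rcoord m (T x)).
  have a3 : L2 mu (psi \o @rcoord R d m \o T).
    apply: (L2_bounded mu) => [|x]; last exact: psi_bound.
    exact: (measurableT_comp mpsi (@mrT m)).
  have a4 : L2 mu (@rcoord R d m \o T).
    exact: (same_law_L2 (h := id) (@mr m) (@mrT m) law_KR mid rm2_nu).
  have c1 := L2_L1 rm2_mu a4; have c2 := L2_L1 f2 (L2B a4 a3); have c3 := L2_L1 f2' a4.
  rewrite -EB// -EB//; last exact: L1B.
  by congr E; apply/funext => z; rewrite /=; ring.
apply: eq_limsup_le key => i; first exact: e2.
apply: (e1 (g i) fst snd).
- exact: (coupling_L2_fst (cpl i) f2).
- exact: (coupling_L2_fst (cpl i) rm2_mu).
- exact: (coupling_L2_snd (cpl i) psi2).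
- exact: (coupling_L2_snd (cpl i) rm2_nu).
Qed.

(** The product f psi / delta^2 lies between 0 and the indicator of the event, and equals it unless
    one of the two variables lies within [delta] to the right of its threshold. *)
Lemma clip_indic {dd} {W : measurableType dd} (Q : probability W R)
    (X1 : W -> m.-tuple R * R) (X2 : W -> R) :
  measurable_fun setT X1 -> measurable_fun setT X2 ->
  let K := Pr Q [set w | (A (X1 w).1 /\ a < (X1 w).2) /\ b < X2 w] in
  let K' := (delta ^+ 2)^-1 * E Q (fun w => f (X1 w) * psi (X2 w)) in
  K' <= K /\ K <= K' + Pr Q [set w | a < (X1 w).2 /\ (X1 w).2 < a + delta]
                     + Pr Q [set w | b < X2 w /\ X2 w < b + delta].
Proof.
move=> mX1 mX2 K K'.
have mX12 : measurable_fun setT (fun w => (X1 w).2).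
  exact: (measurableT_comp measurable_snd mX1).
have mX11 : measurable_fun setT (fun w => (X1 w).1).
  exact: (measurableT_comp measurable_fst mX1).
pose SK := [set w | (A (X1 w).1 /\ a < (X1 w).2) /\ b < X2 w].
pose Sa := [set w | a < (X1 w).2 /\ (X1 w).2 < a + delta].
pose Sb := [set w | b < X2 w /\ X2 w < b + delta].
have mSK : measurable SK.
  apply: measurableI; last exact: measurable_gtc_set.
  by apply: measurableI; [exact: measurable_preimage mX11 mA|exact: measurable_gtc_set].
have mSa : measurable Sa.
  by apply: measurableI; [exact: measurable_gtc_set|exact: measurable_lt_set].
have mSb : measurable Sb.
  by apply: measurableI; [exact: measurable_gtc_set|exact: measurable_lt_set].
have L1f : L1 Q (fun w => f (X1 w) * psi (X2 w)).
  apply: (@L1_bounded _ _ _ _ _ (delta * delta)).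
    by apply: measurable_funM; [exact: measurableT_comp mf mX1|exact: measurableT_comp mpsi mX2].
  by move=> w; rewrite normrM ler_pM.
have d2 : delta * delta != 0 by rewrite mulf_neq0 ?gt_eqF.
have fpsi0 w : 0 <= f (X1 w) * psi (X2 w) <= delta * delta.
  apply/andP; split; first by rewrite mulr_ge0.
  by apply: (le_trans (ler_norm _)); rewrite normrM ler_pM.
have dK : (delta ^+ 2)^-1 * (delta * delta) = 1 by rewrite expr2 mulVf.
have d20 : 0 <= (delta ^+ 2)^-1 by rewrite invr_ge0 sqr_ge0.
rewrite /K /K' -/SK -/Sa -/Sb -EZ//.
rewrite -!E_indic//; split.
  apply: Ele; [exact: L1Z|exact: L1_indic|move=> w].
  rewrite [\1_SK w]indicE; have [_|/negP nS] := boolP (w \in SK).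
    rewrite -dK ler_wpM2l//; by case/andP: (fpsi0 w).
  suff -> : f (X1 w) * psi (X2 w) = 0 by rewrite mulr0.
  rewrite /f indicE; have [At|_] := boolP ((X1 w).1 \in A); last by rewrite !mul0r.
  have [ax|xa] := ltP a (X1 w).2; last by rewrite (clip_eq0 _ xa) ?mulr0 ?mul0r// ltW.
  have [bx|xb] := ltP b (X2 w); last by rewrite /psi (clip_eq0 _ xb) ?mulr0// ltW.
  by exfalso; apply: nS; apply/mem_set; split => //; split => //; exact/set_mem.
have i1 := L1Z (delta ^+ 2)^-1 L1f.
have i2 := L1_indic Q mSa; have i3 := L1_indic Q mSb.
rewrite -ED// -ED//; last exact: L1D.
apply: Ele; [exact: L1_indic|by apply: L1D => //; exact: L1D|move=> w].
have pos : 0 <= (delta ^+ 2)^-1 * (f (X1 w) * psi (X2 w)).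
  by rewrite mulr_ge0//; case/andP: (fpsi0 w).
have indic0 (V : set W) : 0 <= (\1_V w : R) by rewrite indicE ler0n.
rewrite [\1_SK w]indicE; have [/set_mem[[Aw aw] bw]|_] := boolP (w \in SK); last first.
  by rewrite !addr_ge0.
have [ad|da] := ltP (X1 w).2 (a + delta).
  have -> : \1_Sa w = 1 :> R by rewrite indicE mem_set.
  move: pos (indic0 Sb); move: (_ * (f _ * _)) (\1_Sb w) => u v /=; lra.
have [bd|db] := ltP (X2 w) (b + delta).
  have -> : \1_Sb w = 1 :> R by rewrite indicE mem_set.
  move: pos (indic0 Sa); move: (_ * (f _ * _)) (\1_Sa w) => u v /=; lra.
have -> : f (X1 w) * psi (X2 w) = delta * delta.
  rewrite /f /psi (clip_eq (ltW delta0) da) (clip_eq (ltW delta0) db).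
  by rewrite indicE mem_set// mul1r.
by rewrite dK -addrA lerDl addr_ge0.
Qed.

End clipped.

(** For the lower bound, the error-free half of [clip_indic] is used under the plans and the half
    with an error under [mu]; [delta] is therefore chosen once, from [mu] and [nu]. *)
Lemma quadrant_limsup_eq (A : set (m.-tuple R)) (a b : R) : measurable A ->
  limsup_eq F
  (fun i => Pr (g i) [set z | (A (rcoords m z.1) /\ a < rcoord m z.1) /\ b < rcoord m z.2])
  (fun=> Pr mu [set x | (A (rcoords m x) /\ a < rcoord m x) /\ b < rcoord m (T x)]).
Proof.
move=> mA; split.
  apply: (upward_limsup_le (A := A `*` [set r | a < r]) (B := [set r | b < r])).
  - exact: (measurableX mA (measurable_gt_ray a)).
  - exact: measurable_gt_ray.
  - move=> t r s _ _ rs; rewrite !xsectionE /= => -[At ar].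
    by split => //; exact: lt_le_trans rs.
  - by move=> r s _ _ rs /= br; exact: (lt_le_trans br rs).
apply: limsup_le_approx => e e0; have e2 : 0 < e / 2 by rewrite divr_gt0.
have [d1 d10 hd1] := small_right_interval mu a (@mr m) e2.
have [d2 d20 hd2] := small_right_interval nu b (@mr m) e2.
pose delta := Num.min d1 d2.
have delta0 : 0 < delta by rewrite lt_min d10.
have mI c c' (h : d.-tuple R -> R) : measurable_fun setT h ->
    measurable [set y : d.-tuple R | c < h y /\ h y < c'].
  move=> mh; apply: measurableI; first exact: measurable_gtc_set.
  exact: (measurable_lt_set mh (measurable_cst _)).
have [cl1 cl2] := clip_limsup_eq mA a b delta0.
have dm : 0 <= (delta ^+ 2)^-1 by rewrite invr_ge0 sqr_ge0.
exists (fun=> (delta ^+ 2)^-1 * E mu (fun x => \1_A (rpair m x).1 *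
    clip a delta (rpair m x).2 * clip b delta (rcoord m (T x)))),
  (fun i => (delta ^+ 2)^-1 * E (g i) (fun z => \1_A (rpair m z.1).1 *
    clip a delta (rpair m z.1).2 * clip b delta (rcoord m z.2))); split.
- exact: limsup_leZ.
- move=> _; have [_ h] := clip_indic mA a b delta0 mu mRP (@mrT m).
  apply: (le_trans h); rewrite -addrA lerD2l [leRHS]splitr; apply: lerD.
    apply: le_trans hd1; apply: Pr_le; [exact: (mI _ _ _ (@mr m))|exact: (mI _ _ _ (@mr m))|].
    move=> x /= [ax xd]; split => //; apply: lt_le_trans xd _.
    by rewrite lerD2l ge_min lexx.
  apply: le_trans hd2.
  apply: (@le_trans _ _ (Pr nu [set y : d.-tuple R | b < rcoord m y /\ rcoord m y < b + delta])).
    by rewrite /Pr -(lawT (mI b (b + delta) _ (@mr m))).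
  apply: Pr_le; [exact: (mI _ _ _ (@mr m))|exact: (mI _ _ _ (@mr m))|].
  move=> x /= [ax xd]; split => //; apply: lt_le_trans xd _.
  by rewrite lerD2l ge_min lexx orbT.
- move=> i.
  have [h _] := clip_indic mA a b delta0 (g i)
    (measurableT_comp mRP measurable_fst) (measurableT_comp (@mr m) measurable_snd).
  by apply: (le_trans h); rewrite lerDl ltW.
Qed.

Lemma agree_level (b : R) : agree [set y | b < rcoord m y].
Proof.
have mB : measurable [set y : d.-tuple R | b < rcoord m y] by exact: measurable_gtc_set.
split => //.
pose H := [set z : plan_space | b < rcoord m z.2].
pose H0 := [set x : d.-tuple R | b < rcoord m (T x)].
have mH : measurable H by exact: (measurable_preimage measurable_snd mB).
have mH0 : measurable H0 by exact: (measurable_preimage mT mB).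
have mRf : measurable_fun setT (@rcoords R d m \o (fst : plan_space -> _)).
  exact: (measurableT_comp (@mR m) measurable_fst).
have mrf : measurable_fun setT (@rcoord R d m \o (fst : plan_space -> _)).
  exact: (measurableT_comp (@mr m) measurable_fst).
have HE i : Pr (g i) H = Pr mu H0.
  by rewrite /Pr -(law2 i mB) -(lawT mB).
have HH : limsup_eq F (fun i => Pr (g i) H) (fun=> Pr mu H0).
  by split; apply: limsup_leW => i; rewrite HE.
have up (A : set (m.-tuple R)) : measurable A -> limsup_le F
    (fun i => Pr (g i) ((@rcoords R d m \o fst) @^-1` A `&` H))
    (fun=> Pr mu (@rcoords R d m @^-1` A `&` H0)).
  move=> mA; apply: eq_limsup_le (upward_limsup_le (A := A `*` setT) (B := [set r | b < r]) _ _ _ _).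
  - by move=> i; congr (Pr _ _); apply/seteqP; split => z /= [] //; case.
  - by move=> i; congr (Pr _ _); apply/seteqP; split => z /= [] //; case.
  - exact: measurableX.
  - exact: measurable_gt_ray.
  - by move=> t r s _ _ rs; rewrite !xsectionE.
  - by move=> r s _ _ rs /= br; exact: (lt_le_trans br rs).
have conv := joint_limsup_eq (V := @rcoords R d m \o fst) (V0 := @rcoords R d m)
  (Y := @rcoord R d m \o fst) (Y0 := @rcoord R d m) mRf (@mR m) mrf (@mr m)
  mH mH0 law_rpair HH.
have {}conv C : measurable C -> limsup_eq F
    (fun i => Pr (g i) ((fun z => (rcoords m z.1, rcoord m z.1)) @^-1` C `&` H))
    (fun=> Pr mu ((fun x => (rcoords m x, rcoord m x)) @^-1` C `&` H0)).
  apply: conv => [A c mA|A mA]; first exact: quadrant_limsup_eq.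
  split; first exact: up.
  (* The lower bound is the upper bound on the complement of [A], since [H] has the same probability
     under every plan. *)
  have up0 : limsup_le F (fun=> Pr mu H0) (fun=> Pr mu H0) by exact: limsup_leW.
  have := limsup_leB (FF := FF) up0 (up _ (measurableC mA)).
  apply: eq_limsup_le => i.
    have mA0 := measurable_preimage (@mR m) mA.
    have := PrD mu mH0 mA0; rewrite [H0 `&` _]setIC => ->.
    rewrite (_ : H0 `\` _ = rcoords m @^-1` (~` A) `&` H0) ?addrK//.
    by apply/seteqP; split => x [].
  have mAi := measurable_preimage mRf mA.
  have := PrD (g i) mH mAi; rewrite [H `&` _]setIC HE => ->.
  rewrite (_ : H `\` _ = (rcoords m \o fst) @^-1` (~` A) `&` H) ?addrK//.
  by apply/seteqP; split => x [].
pose C := [set s : m.-tuple R * R | ~ (b < U m s.1 s.2)].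
have mC : measurable C.
  apply: measurableC; apply: measurable_gtc_set.
  exact: (measurable_KR_coord mT TU md).
have [cv _] := conv C mC.
apply: eq_limsup_le cv => i.
  congr (Pr _ _); apply/seteqP; split => z; rewrite /C /H /Tfst /= (rcoord_KR TU _ md).
    by case.
  by case.
rewrite (_ : _ `&` _ = set0) ?/Pr ?measure0//.
apply/seteqP; split => // x; rewrite /C /H0 /= (rcoord_KR TU _ md).
by case.
Qed.

End level_conclusion.

End level.

Variable lam : 'I_d -> I -> R.
Hypothesis lam_gt0 : \forall i \near F, forall k, 0 < lam k i.
Hypothesis lam_cvg : forall j k : 'I_d, k = j.+1 :> nat ->
  lam j i / lam k i @[i --> F] --> (0 : R).
Hypothesis opt : \forall i \near F,
  optimal_plan mu nu (weighted_cost (lam ^~ i)) (g i).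

(** Telescoping over consecutive ratios; the intermediate weights cancel where they are nonzero,
    hence eventually. *)
Lemma weight_ratio_cvg (j k : 'I_d) : (j < k)%N ->
  lam j i / lam k i @[i --> F] --> (0 : R).
Proof.
move=> /subnKC; move: (k - j.+1)%N => n; elim: n j k => [|n ih] j k jk.
  by apply: lam_cvg; rewrite -jk addn0.
have j'd : (j.+1 < d)%N.
  by apply: leq_ltn_trans (ltn_ord k); rewrite -jk leq_addr.
pose j' := Ordinal j'd.
have h1 : lam j i / lam j' i @[i --> F] --> (0 : R) by exact: lam_cvg.
have h2 : lam j' i / lam k i @[i --> F] --> (0 : R).
  by apply: ih; rewrite -jk /= addSnnS.
have h : (lam j i / lam j' i) * (lam j' i / lam k i) @[i --> F] --> (0 : R).
  by rewrite -[X in _ --> X](mulr0 0); exact: cvgM.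
apply: cvg_trans h; apply: near_eq_cvg.
by near=> i; rewrite /= mulrA divfK// gt_eqF//; near: i; apply: filterS lam_gt0.
Unshelve. all: by end_near. Qed.

(** Agreement on the previous levels enters each step twice: it makes the resampled coordinate
    asymptotically as good as T, and it yields the upper bounds that the moment must saturate. *)
Lemma agree_all (m : nat) : (m <= d)%N -> agree_upto m.
Proof.
elim: m => [//|m ih] md n c; have am := ih (ltnW md).
rewrite ltnS leq_eqVlt => /orP[/eqP ->|nm]; last exact: am.
apply: (agree_level md am).
apply: (mixed_moment_lower md am).
set k := rev_ord (Ordinal md).
pose M := 2 * (E mu (fun x => \sum_(i < d) tnth x i ^+ 2) +
               E nu (fun x => \sum_(i < d) tnth x i ^+ 2)).
have cv : M * (\sum_(j < d | (j < k)%N) lam j i / lam k i) @[i --> F] --> (0 : R).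
  rewrite -[X in _ --> X](mulr0 M); apply: cvgM; first exact: cvg_cst.
  have : \sum_(j < d | (j < k)%N) lam j i / lam k i @[i --> F] -->
      \sum_(j < d | (j < k)%N) (0 : R).
    apply: cvg_big => [|j jk]; last exact: weight_ratio_cvg.
    exact: add_continuous.
  by rewrite big1_eq.
move=> e e0; have /cvgrPdist_lt/(_ _ e0) cv0 := cv.
near=> i.
have hl : forall j, 0 < lam j i by near: i.
have ho : optimal_plan mu nu (weighted_cost (lam ^~ i)) (g i) by near: i.
have hs : `|0 - M * (\sum_(j < d | (j < k)%N) lam j i / lam k i)| < e by near: i.
apply: le_trans (optimal_level hmu_ hnu_ hmu2 hnu2 md hl ho) _.
rewrite lerD2l; apply: le_trans (ltW hs).
by rewrite sub0r normrN ler_norm.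
Unshelve. all: by end_near. Qed.

Lemma coord_error_cvg (j : 'I_d) : limsup_le F
  (fun i => E (g i) (fun z => (tnth z.2 j - tnth (T z.1) j) ^+ 2)) (fun=> 0).
Proof.
apply: (asymp_agree_E_sqr measurable_snd mTfst
  (fun i => coupling_snd (cpl i)) lawTfst (L2_tnth j hnu2)) => c.
rewrite (_ : [set s | _] = [set s : d.-tuple R | c < rcoord (rev_ord j) s]).
  exact: (agree_all (leqnn d) _ (ltn_ord (rev_ord j))).
by apply/seteqP; split => s /=; rewrite rcoord_rev_ord.
Qed.

Let L2_fst i j : L2 (g i) (fun z => tnth z.1 j) := coupling_L2_fst (cpl i) (L2_tnth j hmu2).
Let L2_snd i j : L2 (g i) (fun z => tnth z.2 j) := coupling_L2_snd (cpl i) (L2_tnth j hnu2).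

Let L2_T i j : L2 (g i) (fun z => tnth (T z.1) j).
Proof.
have h2 := L2_tnth j hnu2.
exact: (same_law_L2 (@measurable_id _ _ _) mTfst (@lawTfst i) (L2_measurable h2)).
Qed.

Let err (z : d.-tuple R * d.-tuple R) : R :=
  \sum_(j < d) (tnth z.2 j - tnth (T z.1) j) ^+ 2.

Let L1_err i : L1 (g i) err.
Proof. by apply: L1_sum => j; exact: (L2B (L2_snd i j) (L2_T i j)).2. Qed.

Lemma error_cvg : E (g i) (fun z => \sum_(j < d)
    (tnth z.2 j - tnth (T z.1) j) ^+ 2) @[i --> F] --> (0 : R).
Proof.
apply: limsup_le_cvg; last first.
  by apply: limsup_leW => i; apply: E_ge0 => z; apply: sumr_ge0 => j _; exact: sqr_ge0.
have := limsup_le_sum (FF := FF) (index_enum 'I_d) coord_error_cvg.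
rewrite big1_eq; under eq_fun => i.
  rewrite -E_sum; last by move=> j; exact: (L2B (L2_snd i j) (L2_T i j)).2.
  over.
by [].
Qed.

Let sqr_norm (x : d.-tuple R) : R := \sum_(j < d) tnth x j ^+ 2.

Let L1_norm_fst i : L1 (g i) (fun z => sqr_norm z.1).
Proof. by apply: L1_sum => j; exact: (L2_fst i j).2. Qed.

Let L1_norm_T i : L1 (g i) (fun z => sqr_norm (T z.1)).
Proof. by apply: L1_sum => j; exact: (L2_T i j).2. Qed.

Let E_norm_fst i : E (g i) (fun z => sqr_norm z.1) = E mu sqr_norm.
Proof.
have h1 := finite_second_moment_L1 hmu2.
exact/esym/(same_law_E (@measurable_id _ _ _) measurable_fst
  (coupling_fst (cpl i)) (L1_measurable h1) h1).
Qed.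

Let E_norm_T i : E (g i) (fun z => sqr_norm (T z.1)) = E nu sqr_norm.
Proof.
have h1 := finite_second_moment_L1 hnu2.
exact/esym/(same_law_E (@measurable_id _ _ _) mTfst (@lawTfst i)
  (L1_measurable h1) h1).
Qed.

Let sqr_le_sum (a : 'I_d -> R) (j : 'I_d) (c : R) : 0 <= c -> c <= `|a j| ->
  c ^+ 2 <= \sum_(k < d) a k ^+ 2.
Proof.
move=> c0 caj; rewrite (bigD1 j)//=.
have h : 0 <= \sum_(k < d | k != j) a k ^+ 2 by apply: sumr_ge0 => k _; exact: sqr_ge0.
apply: (@le_trans _ _ (a j ^+ 2)); last by rewrite lerDl.
by rewrite -[leRHS]real_normK ?num_real// lerXn2r// nnegrE.
Qed.

(** Under the plan itself f(x, y) is compared with f(x, T x), whose expectation depends on [mu]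
    only. As [f] is uniformly continuous on boxes only, the second moments of x and T x control what
    lies outside. *)
Lemma E_continuous_cvg (f : d.-tuple R * d.-tuple R -> R) (B : R) :
  continuous (fun p : 'rV[R]_d * 'rV[R]_d =>
    f (tuple_of_rV p.1, tuple_of_rV p.2)) ->
  (forall z, `|f z| <= B) ->
  E (g i) f @[i --> F] --> E mu (fun x => f (x, T x)).
Proof.
move=> cf fB; have mf := measurable_tuple_continuous cf.
have mpT : measurable_fun setT (fun x : d.-tuple R => (x, T x)).
  by apply: measurable_fun_pair.
have mfT : measurable_fun setT (fun x : d.-tuple R => f (x, T x)).
  exact: (measurableT_comp mf mpT).
have EfT i : E mu (fun x => f (x, T x)) = E (g i) (fun z => f (z.1, T z.1)).
  exact: (same_law_E (@measurable_id _ _ _) measurable_fst (coupling_fst (cpl i))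
    mfT (@L1_bounded _ _ _ _ _ B mfT (fun=> fB _))).
pose K := `|B| + 1; have K0 : 0 < K by rewrite ltr_wpDl.
have fK z : `|f z| <= K.
  by apply: le_trans (fB z) _; apply: le_trans (ler_norm B) _; rewrite lerDl.
pose C := E mu sqr_norm + E nu sqr_norm.
have C0 : 0 <= C.
  by rewrite addr_ge0// E_ge0// => x; apply: sumr_ge0 => j _; exact: sqr_ge0.
apply/cvgrPdist_le => e e0.
(* The summand 1 gives M >= 1, hence C / M^2 <= C / M; the other one makes 2 K C / M at most e /
   3. *)
pose M := 1 + 6 * K * C / e.
have M1 : 1 <= M.
  by rewrite lerDl divr_ge0 ?(ltW e0)// !mulr_ge0// ltW.
have M0 : 0 < M by apply: lt_le_trans M1.
have MC : 2 * K * (C / M ^+ 2) <= e / 3.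
  have h1 : C / M ^+ 2 <= C / M.
    by rewrite ler_wpM2l// lef_pV2 ?posrE ?exprn_gt0// expr2 ler_pMl.
  have h2 : 6 * K * C <= e * M.
    by rewrite /M [e * (1 + _)]mulrDr mulr1 [e * (_ / e)]mulrC divfK ?gt_eqF// lerDr ltW.
  apply: (@le_trans _ _ (2 * K * (C / M))).
    by rewrite ler_pM2l// mulr_gt0.
  rewrite mulrA ler_pdivrMr//; move: h2; lra.
have e3 : 0 < e / 3 by rewrite divr_gt0.
have [delta delta0 hdelta] := box_unif_continuous cf M e3.
(* Chebyshev in pointwise form: if a coordinate of x or T x exceeds [M], or one of y - T x reaches
   [delta], the bracket is at least 1 and 2 K bounds the difference; otherwise uniform continuity
   gives e / 3. *)
pose dom (z : d.-tuple R * d.-tuple R) : R := e / 3 + 2 * K *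
  (M ^- 2 * (sqr_norm z.1 + sqr_norm (T z.1)) + delta ^- 2 * err z).
have domP z : `|f z - f (z.1, T z.1)| <= dom z.
  have n1 (x : d.-tuple R) : 0 <= sqr_norm x.
    by apply: sumr_ge0 => j _; exact: sqr_ge0.
  have n2 : 0 <= err z by apply: sumr_ge0 => j _; exact: sqr_ge0.
  have i1 : 0 <= M ^- 2 * (sqr_norm z.1 + sqr_norm (T z.1)).
    by rewrite mulr_ge0 ?addr_ge0// invr_ge0 exprn_ge0// ltW.
  have i2 : 0 <= delta ^- 2 * err z.
    by rewrite mulr_ge0// invr_ge0 exprn_ge0// ltW.
  have far : 1 <= M ^- 2 * (sqr_norm z.1 + sqr_norm (T z.1)) + delta ^- 2 * err z ->
      `|f z - f (z.1, T z.1)| <= dom z.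
    move=> h; apply: (@le_trans _ _ (2 * K)).
      have := fK z; have := fK (z.1, T z.1).
      by have := ler_normB (f z) (f (z.1, T z.1)); lra.
    rewrite /dom; apply: (@le_trans _ _ (2 * K * (M ^- 2 * (sqr_norm z.1 + sqr_norm (T z.1)) + delta ^- 2 * err z))).
      by rewrite ler_pMr// mulr_gt0.
    by rewrite lerDr ltW.
  have sqr1 (c s : R) : 0 < c -> c ^+ 2 <= s -> 1 <= c ^- 2 * s.
    by move=> c0 cs; rewrite mulrC ler_pdivlMr ?exprn_gt0// mul1r.
  case: (pselect (forall j, `|tnth z.1 j| <= M)) => [b1|/existsNP[j /negP]]; last first.
    rewrite -ltNge => /ltW h; apply: far; apply: ler_wpDr => //.
    apply: sqr1 => //; apply: ler_wpDr => //; exact: sqr_le_sum (ltW M0) h.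
  case: (pselect (forall j, `|tnth (T z.1) j| <= M)) => [b2|/existsNP[j /negP]]; last first.
    rewrite -ltNge => /ltW h; apply: far; apply: ler_wpDr => //.
    apply: sqr1 => //; apply: ler_wpDl => //; exact: sqr_le_sum (ltW M0) h.
  case: (pselect (forall j, `|tnth (T z.1) j - tnth z.2 j| < delta)) => [b3|/existsNP[j /negP]]; last first.
    rewrite -leNgt distrC => h; apply: far; apply: ler_wpDl => //.
    apply: sqr1 => //.
    exact: (@sqr_le_sum (fun j => tnth z.2 j - tnth (T z.1) j) _ _ (ltW delta0) h).
  have := hdelta _ _ _ b1 b2 b3; rewrite distrC -surjective_pairing => /ltW h.
  by apply: le_trans h _; rewrite /dom lerDl mulr_ge0// ?addr_ge0// mulr_ge0// ltW.
have ee : 0 < e / 3 / (2 * K * delta ^- 2).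
  by rewrite divr_gt0// !mulr_gt0// invr_gt0 exprn_gt0.
have := error_cvg => /cvgrPdist_lt/(_ _ ee); apply: filterS => i hi.
rewrite (EfT i) distrC.
have fL1 : L1 (g i) f by apply: (@L1_bounded _ _ _ _ _ B).
have fTL1 : L1 (g i) (fun z => f (z.1, T z.1)).
  apply: (@L1_bounded _ _ _ _ _ B) => //.
  exact: (measurableT_comp mfT measurable_fst).
have L1a := L1Z (M ^- 2) (L1D (L1_norm_fst i) (L1_norm_T i)).
have L1b := L1Z (delta ^- 2) (L1_err i).
have L1c := L1Z (2 * K) (L1D L1a L1b).
apply: (E_dist_le fL1 fTL1 (L1D (L1cst _ (e / 3)) L1c)) => //.
rewrite (ED (L1cst _ _) L1c) Ecst (EZ _ (L1D L1a L1b)) (ED L1a L1b).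
rewrite (EZ _ (L1D (L1_norm_fst i) (L1_norm_T i))) (EZ _ (L1_err i)).
rewrite (ED (L1_norm_fst i) (L1_norm_T i)) E_norm_fst E_norm_T -/C.
have : E (g i) err * (2 * K * delta ^- 2) <= e / 3.
  rewrite -ler_pdivlMr ?mulr_gt0// ?invr_gt0 ?exprn_gt0// ?mulr_gt0//.
  by apply: le_trans (ltW hi); rewrite sub0r normrN ler_norm.
move: MC; rewrite ![_ * (C / _)]mulrA.
move: (E (g i) err) (M ^- 2) (delta ^- 2) => a b c; lra.
Qed.

(** When the plan is carried by the graph of [S i], the error |y - T x|^2 is |S i x - T x|^2, so the
    distance is the square root of a quantity that tends to 0. *)
Lemma L2_dist_cvg (S : I -> {mfun d.-tuple R >-> d.-tuple R}) :
  (\forall i \near F, forall C : set (d.-tuple R * d.-tuple R), measurable C ->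
    g i C = plan_of_map mu (S i) C) ->
  L2_dist mu (S i) T @[i --> F] --> 0%E.
Proof.
move=> gS.
have h : (Num.sqrt (E (g i) err))%:E @[i --> F] --> 0%E.
  apply: cvg_EFin; first by near=> i.
  rewrite -(@sqrtr0 R); apply: continuous_cvg; first exact: sqrt_continuous.
  exact: error_cvg.
apply: cvg_trans h; apply: near_eq_cvg; near=> i.
have hg : forall C : set (d.-tuple R * d.-tuple R), measurable C ->
  g i C = plan_of_map mu (S i) C by near: i.
have law : same_law (g i) id mu (id_times (S i)) by move=> C mC; rewrite hg.
have mS : measurable_fun setT (id_times (S i)) by apply: measurable_fun_pair.
have merr := L1_measurable (L1_err i).
have e1 : L1 mu (err \o id_times (S i)).
  exact: (same_law_L1 (@measurable_id _ _ _) mS law merr (L1_err i)).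
rewrite (same_law_E (@measurable_id _ _ _) mS law merr (L1_err i)).
rewrite /L2_dist unlock.
have sqrE x : (`|(Num.sqrt (\sum_(j < d) (tnth (S i x) j - tnth (T x) j) ^+ 2))%:E| `^ 2 =
    ((err \o id_times (S i)) x)%:E)%E.
  rewrite /= ger0_norm ?sqrtr_ge0// powR_mulrn ?sqrtr_ge0// sqr_sqrtr//.
  by apply: sumr_ge0 => j _; exact: sqr_ge0.
under eq_integral do rewrite sqrE.
have e0 : 0 <= E mu (err \o id_times (S i)).
  by apply: E_ge0 => x; apply: sumr_ge0 => j _; exact: sqr_ge0.
have -> : (\int[mu]_x ((err \o id_times (S i)) x)%:E)%E =
    (E mu (err \o id_times (S i)))%:E.
  by rewrite fineK//; exact: (integrable_fin_num measurableT e1).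
by rewrite poweR_EFin powR12_sqrt.
Unshelve. all: by end_near. Qed.

End main_induction.

(** * Plans induced by maps, and the limit as eps decreases to 0 *)

Section plan_of_map_coupling.
Context {R : realType} {d : nat} (mu nu : probability (d.-tuple R) R).

Lemma plan_of_map_coupling (T : {mfun d.-tuple R >-> d.-tuple R}) :
  same_law mu T nu id -> coupling mu nu (plan_of_map mu T).
Proof. by move=> law A mA; split => //; exact: law. Qed.

Lemma E_plan_of_map (T : {mfun d.-tuple R >-> d.-tuple R})
    (f : d.-tuple R * d.-tuple R -> R) : measurable_fun setT f ->
  L1 (plan_of_map mu T) f ->
  E (plan_of_map mu T) f = E mu (fun x => f (x, T x)).
Proof.
move=> mf f1.
have mT : measurable_fun setT (id_times T) by apply: measurable_fun_pair.
have law : same_law (plan_of_map mu T) id mu (id_times T) by [].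
exact: (same_law_E (@measurable_id _ _ _) mT law mf f1).
Qed.

End plan_of_map_coupling.

Theorem theorem2p1 (R : realType) (d : nat) (hd : (0 < d)%N)
    (mu nu : probability (d.-tuple R) R)
    (mu_ nu_ : forall m : nat, R.-pker (m.-tuple R) ~> R)
    (hmu2 : finite_second_moment mu) (hnu2 : finite_second_moment nu)
    (hmu_ : disintegration mu mu_) (hnu_ : disintegration nu nu_)
    (hsource : H_source d mu_) (htarget : H_target d nu_)
    (lambda : 'I_d -> R -> R)
    (hlambda_gt0 : forall (i : 'I_d) (eps : R), 0 < eps -> 0 < lambda i eps)
    (hlambda_cvg : forall i j : 'I_d, j = i.+1 :> nat ->
       lambda i eps / lambda j eps @[eps --> 0^'+] --> (0 : R))
    (gamma : R -> probability (d.-tuple R * d.-tuple R)%type R)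
    (hgamma : forall eps : R, 0 < eps ->
       optimal_plan mu nu (weighted_cost (fun i => lambda i eps)) (gamma eps))
    (T : {mfun d.-tuple R >-> d.-tuple R})
    (hT : is_Knothe_Rosenblatt mu mu_ nu_ T) :
  weak_cvg (0 : R)^'+ gamma (plan_of_map mu T) /\
  (forall Teps : R -> {mfun d.-tuple R >-> d.-tuple R},
     (forall eps : R, 0 < eps ->
        forall C : set (d.-tuple R * d.-tuple R), measurable C ->
          gamma eps C = plan_of_map mu (Teps eps) C) ->
     L2_dist mu (Teps eps) T @[eps --> 0^'+] --> 0%E).
Proof.
have [U [TU hU]] := hT.
have mT : measurable_fun setT T by [].
(* The plans are constrained for positive eps only; replacing the others by gamma_K makes [g] a
   coupling for every eps and does not affect the limit at 0 from the right. *)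
pose g eps := if 0 < eps then gamma eps else plan_of_map mu T.
have cpl eps : coupling mu nu (g eps).
  rewrite /g; case: ifP => [/hgamma[]//|_].
  exact/plan_of_map_coupling/(KR_law hmu_ hnu_ mT TU hU).
have pos : \forall eps \near (0 : R)^'+, 0 < eps := nbhs_right_gt 0.
have lam0 : \forall eps \near (0 : R)^'+, forall k, 0 < lambda k eps.
  by apply: filterS pos => eps eps0 k; exact: hlambda_gt0.
have opt : \forall eps \near (0 : R)^'+,
    optimal_plan mu nu (weighted_cost (lambda ^~ eps)) (g eps).
  by apply: filterS pos => eps eps0; rewrite /g eps0; exact: hgamma.
split=> [f cf [B fB]|Teps hTeps].
  have mf := measurable_tuple_continuous cf.
  have h : E (g eps) f @[eps --> (0 : R)^'+] --> E (plan_of_map mu T) f.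
    rewrite (E_plan_of_map mf (@L1_bounded _ _ _ _ _ B mf fB)).
    exact: (E_continuous_cvg hmu2 hnu2 hmu_ hnu_ htarget mT TU hU cpl
      lam0 hlambda_cvg opt cf fB).
  apply: cvg_trans h; apply: near_eq_cvg.
  by apply: filterS pos => eps eps0; rewrite /g eps0.
apply: (L2_dist_cvg hmu2 hnu2 hmu_ hnu_ htarget mT TU hU cpl
  lam0 hlambda_cvg opt).
by apply: filterS pos => eps eps0; rewrite /g eps0; exact: hTeps.
Qed.
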